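(* Fix $(L,E,r_0,\dot r_0)\in\mathbb R^*\times(\mathbb R_+^* )^2\times\mathbb R$ such that $\lambda L^2+E^2\ge0$, and let $\gamma$ be the unique maximal non-circular, non-radial equatorial null geodesic of the Reissner--Nordström--(anti) de Sitter metric with parameters $\lambda,M,Q$, with energy $E$, angular momentum $L$, and such that $r(0)=r_0$ and $\dot r(0)=\dot r_0$ in the polar parametrization $r=r(\phi)$ (dot $=\mathrm d/\mathrm d\phi$). Let $\overline r\in\mathbb R$ be a chosen real root of $(\lambda+E^2/L^2)x^4-x^2+2Mx-Q^2$, and put $$\delta=\lambda+\frac{E^2}{L^2},\quad c=4\overline r\delta,\quad \beta=6\overline r^2\delta-1,\quad \alpha=4\overline r^3\delta-2\overline r+2M,$$ $$g_2:=\frac14\left(\frac{\beta^2}{3}-\alpha c\right),\quad g_3:=\frac18\left(\frac{\alpha\beta c}{6}-\frac{\alpha^2\delta}{2}-\frac{\beta^3}{27}\right).$$ If $g_2^3-27g_3^2\neq0$, then the function $r$ is given (on its domain of definition) by $$r(\phi)=\overline r+\frac{\alpha}{4\wp_{g_2,g_3}(z_0+\phi)-\beta/3},\qquad\text{where}\quad z_0:=R_F(\wp_0-z_1,\wp_0-z_2,\wp_0-z_3)\in\mathbb C,$$ with $z_1,z_2,z_3\in\mathbb C$ the roots of the Weierstrass cubic $4z^3-g_2z-g_3$ and $\wp_0:=\frac{\alpha}{4(r_0-\overline r)}+\frac{\beta}{12}$.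
   Context: The Reissner--Nordström--(anti) de Sitter (RNdS) metric with parameters $\lambda\in\mathbb R$, $M,Q\ge0$ is, in spherical coordinates $(t,r,\theta,\phi)$, $$\mathrm ds^2=-\underline\Delta\,\mathrm dt^2+\frac{\mathrm dr^2}{\underline\Delta}+r^2(\mathrm d\theta^2+\sin^2\theta\,\mathrm d\phi^2),\qquad \underline\Delta=1-\lambda r^2-\frac{2M}{r}+\frac{Q^2}{r^2}.$$ For an equatorial ($\theta\equiv\pi/2$) null geodesic (photon path) with affine parameter $\ell$, the energy $E=\underline\Delta\,\frac{\mathrm dt}{\mathrm d\ell}$ and the angular momentum $L=r^2\frac{\mathrm d\phi}{\mathrm d\ell}$ are constant. Radial means $\mathrm d\phi/\mathrm d\ell\equiv0$ (equivalently $L=0$); circular means $r$ is constant. For a non-radial geodesic, $\ell\mapsto\phi(\ell)$ is a diffeomorphism onto its image, and the polar parametrization $r=r(\phi)$ is the re-parametrization by $\phi$. $\wp_{g_2,g_3}$ is the Weierstrass elliptic function with invariants $g_2,g_3$, satisfying $(\wp')^2=4\wp^3-g_2\wp-g_3$. The Carlson integral is $$R_F(x,y,z):=\frac12\int_0^\infty\frac{\mathrm d\zeta}{\sqrt{(\zeta+x)(\zeta+y)(\zeta+z)}}.$$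
   Formalization: As printed, z_0 ignores the sign of the initial derivative of r, so the formula fails for half the data; here z_0 = R_F (principal root) if alpha times that derivative is >= 0, else -R_F; z_0 = 0 if r_0 = rbar (wp_0 undefined); at poles of wp the formula means r = rbar. *)

(* Defs.v *)
From HB Require Import structures.
From mathcomp Require Import all_boot all_order all_algebra.
From mathcomp Require Import all_classical all_reals all_analysis.
From mathcomp Require Import complex.

Set Implicit Arguments.
Unset Strict Implicit.
Unset Printing Implicit Defensive.

Import Order.TTheory GRing.Theory Num.Theory.
Import numFieldTopology.Exports numFieldNormedType.Exports.

Local Open Scope classical_set_scope.
Local Open Scope ring_scope.
Local Open Scope complex_scope.

Section Geometry.
Context {R : realType}.

(* A point is the row vector (t, r, theta, phi); phi ranges over all of R
   (it is the lifted angle). *)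
Definition ct : 'I_4 := @Ordinal 4 0 isT.
Definition cr : 'I_4 := @Ordinal 4 1 isT.
Definition ctheta : 'I_4 := @Ordinal 4 2 isT.
Definition cphi : 'I_4 := @Ordinal 4 3 isT.

Definition RNdS_Delta (lambda M Q r : R) : R :=
  1 - lambda * r ^+ 2 - 2 * M / r + Q ^+ 2 / r ^+ 2.

Definition RNdS_metric (lambda M Q : R) (x : 'rV[R]_4) : 'M[R]_4 :=
  let r := x 0 cr in
  diag_mx (\row_(i < 4)
    [:: - RNdS_Delta lambda M Q r; (RNdS_Delta lambda M Q r)^-1;
        r ^+ 2; r ^+ 2 * sin (x 0 ctheta) ^+ 2]`_i).

(* Where the coordinate expression of the metric is defined. *)
Definition RNdS_chart (lambda M Q : R) (x : 'rV[R]_4) : Prop :=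
  [/\ 0 < x 0 cr, RNdS_Delta lambda M Q (x 0 cr) != 0
    & 0 < x 0 ctheta < pi].

(* partial_j g_{kl} *)
Definition dmetric (g : 'rV[R]_4 -> 'M[R]_4) (j k l : 'I_4) (x : 'rV[R]_4) : R :=
  'D_(delta_mx 0 j) (fun y => g y k l) x.

(* Gamma^k_{ij} of the Levi-Civita connection *)
Definition christoffel (g : 'rV[R]_4 -> 'M[R]_4) (k i j : 'I_4)
    (x : 'rV[R]_4) : R :=
  2^-1 * \sum_(l < 4) invmx (g x) k l *
    (dmetric g i j l x + dmetric g j i l x - dmetric g l i j x).

Definition coord (gamma : R -> 'rV[R]_4) (i : 'I_4) : R -> R :=
  fun s => gamma s 0 i.

(* Affinely parametrized geodesic of the metric g on the chart U, defined on
   the open interval I; the values of gamma outside I are irrelevant. *)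
Definition geodesic (g : 'rV[R]_4 -> 'M[R]_4) (U : 'rV[R]_4 -> Prop)
    (I : set R) (gamma : R -> 'rV[R]_4) : Prop :=
  [/\ open I, is_interval I, I !=set0 & forall s, I s ->
   [/\ U (gamma s),
       forall k, derivable (coord gamma k) s 1,
       forall k, derivable (derive1 (coord gamma k)) s 1
     & forall k, derive1 (derive1 (coord gamma k)) s +
         \sum_(i < 4) \sum_(j < 4) christoffel g k i j (gamma s) *
           derive1 (coord gamma i) s * derive1 (coord gamma j) s = 0]].

Definition maximal_geodesic (g : 'rV[R]_4 -> 'M[R]_4) (U : 'rV[R]_4 -> Prop)
    (I : set R) (gamma : R -> 'rV[R]_4) : Prop :=
  geodesic g U I gamma /\
  forall J gamma', geodesic g U J gamma' -> I `<=` J ->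
    (forall s, I s -> gamma' s = gamma s) -> J `<=` I.

Definition null_curve (g : 'rV[R]_4 -> 'M[R]_4)
    (I : set R) (gamma : R -> 'rV[R]_4) : Prop :=
  forall s, I s ->
    \sum_(i < 4) \sum_(j < 4)
      g (gamma s) i j * derive1 (coord gamma i) s * derive1 (coord gamma j) s = 0.

Definition equatorial (I : set R) (gamma : R -> 'rV[R]_4) : Prop :=
  forall s, I s -> coord gamma ctheta s = pi / 2.

Definition radial (I : set R) (gamma : R -> 'rV[R]_4) : Prop :=
  forall s, I s -> derive1 (coord gamma cphi) s = 0.

Definition circular (I : set R) (gamma : R -> 'rV[R]_4) : Prop :=
  exists r, forall s, I s -> coord gamma cr s = r.

Definition has_energy (lambda M Q : R) (I : set R) (gamma : R -> 'rV[R]_4)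
    (E : R) : Prop :=
  forall s, I s ->
    RNdS_Delta lambda M Q (coord gamma cr s) * derive1 (coord gamma ct) s = E.

Definition has_angular_momentum (I : set R) (gamma : R -> 'rV[R]_4)
    (L : R) : Prop :=
  forall s, I s -> coord gamma cr s ^+ 2 * derive1 (coord gamma cphi) s = L.

(* rho is the polar parametrization r = rho(phi), with domain D = phi(I);
   the values of rho outside D are irrelevant. *)
Definition polar_parametrization (I : set R) (gamma : R -> 'rV[R]_4)
    (D : set R) (rho : R -> R) : Prop :=
  D = coord gamma cphi @` I /\
  forall s, I s -> rho (coord gamma cphi s) = coord gamma cr s.

End Geometry.

Section Elliptic.
Context {R : realType}.
Local Notation C := R[i].

Definition real_independent (w1 w2 : C) : Prop :=
  forall a b : R, a%:C * w1 + b%:C * w2 = 0 -> a = 0 /\ b = 0.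

Definition lattice (w1 w2 : C) : set C :=
  [set w | exists m n : int, w = m%:~R * w1 + n%:~R * w2].

Definition complex_lim (u : nat -> C) : C :=
  lim ((fun N => complex.Re (u N)) @ \oo) +i*
  lim ((fun N => complex.Im (u N)) @ \oo).

(* Sum of F over the nonzero points of Z w1 + Z w2, as the limit of the sums
   over m w1 + n w2 with -N <= m, n <= N (the shifts by N below). The series
   it is used for converge absolutely, so the order is immaterial. *)
Definition lattice_sum (w1 w2 : C) (F : C -> C) : C :=
  complex_lim (fun N : nat =>
    \sum_(m < N.*2.+1) \sum_(n < N.*2.+1 | (m != N :> nat) || (n != N :> nat))
      F ((m%:R - N%:R) * w1 + (n%:R - N%:R) * w2)).

(* Off the lattice; the poles, at the lattice points, carry no value. *)
Definition weierstrass_p (w1 w2 z : C) : C :=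
  (z ^+ 2)^-1 + lattice_sum w1 w2 (fun w => ((z - w) ^+ 2)^-1 - (w ^+ 2)^-1).

(* (w1, w2) are basic periods of the Weierstrass function with invariants
   g2 and g3. When g2^3 - 27 g3^2 <> 0 the lattice Z w1 + Z w2 exists and is
   unique, so that weierstrass_p w1 w2 depends on g2 and g3 only. *)
Definition weierstrass_periods (g2 g3 w1 w2 : C) : Prop :=
  [/\ real_independent w1 w2,
      g2 = 60 * lattice_sum w1 w2 (fun w => (w ^+ 4)^-1)
    & g3 = 140 * lattice_sum w1 w2 (fun w => (w ^+ 6)^-1)].

(* The square root is that of the product, not the product of the three roots;
   sqrtc is the principal square root on R[i] (nonnegative real part, and 'i
   times a nonnegative real on the negative real axis). *)
Definition carlson_RF (x y z : C) : C :=
  let f (zeta : R) : C :=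
    (sqrtc ((zeta%:C + x) * (zeta%:C + y) * (zeta%:C + z)))^-1 in
  let mu := @lebesgue_measure R in
  2^-1 * ((\int[mu]_(zeta in `]0, +oo[) complex.Re (f zeta))%R +i*
          (\int[mu]_(zeta in `]0, +oo[) complex.Im (f zeta))%R).

End Elliptic.

(* Main.v *)
(* With x = r - rbar, the null condition and the geodesic equation for r give
   (dr/dphi)^2 = alpha x + beta x^2 + c x^3 + delta x^4, and
   X = alpha / (4 x) + beta / 12 turns this into X'^2 = 4 X^3 - g2 X - g3.
   Uniqueness for this first order equation fails at turning points and poles, so
   r is compared with the Weierstrass function in the chart s = 1 / (wp - beta / 12),
   where 2 s'' is a polynomial in s: the pair (s, s') and the pair given by the
   orbit solve the same regular first order system, and a Gronwall estimate shows
   that they coincide when they agree at one point. The same comparison along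
   the path
   Z(tau) = int_(1 / tau - 1)^oo dt / sqrt (4 (wp0 + t)^3 - g2 (wp0 + t) - g3),
   which starts at the pole Z(0) = 0 and ends at Z(1) = RF, gives wp RF = wp0 and
   wp' RF <= 0.

   The differential equation of wp rests on the Eisenstein identity
   sum (z - w)^-5 = wp(z) sum (z - w)^-3, obtained by multiplying the sums over a
   box and expanding in partial fractions; it makes
   wp'' - 6 wp^2 and then wp'^2 - 4 wp^3 + g2 wp constant along rays from 0. *)
Require Import Defs.
From HB Require Import structures.
From mathcomp Require Import all_boot all_order all_algebra.
From mathcomp Require Import all_classical all_reals all_analysis measurable_realfun.
From mathcomp Require Import complex.
From mathcomp Require Import ring lra zify.

Set Implicit Arguments.
Unset Strict Implicit.
Unset Printing Implicit Defensive.

Import Order.TTheory GRing.Theory Num.Theory.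
Import numFieldTopology.Exports numFieldNormedType.Exports.

Local Open Scope classical_set_scope.
Local Open Scope ring_scope.
Local Open Scope complex_scope.

Import Normc.

Local Notation Re := (@complex.Re _).
Local Notation Im := (@complex.Im _).

(** * Complex norm and complex derivatives *)

(** The base point [beta / 12] is the one for which s = 1 / (wp - beta / 12) equals 4 (r - rbar) /
    alpha, an affine function of r. A passage of r through rbar is then an ordinary zero of s, and
    the excluded value wp = beta / 12 corresponds to r infinite, which no orbit attains. The
    comparison takes place in the complex plane because RF, hence z0, need not be real.

    The obstacle along the path Z is that the cubic is real at wp0 + t but may change sign: the
    speed of Z is real on some intervals, purely imaginary on others, and infinite at the roots. A
    nonzero discriminant makes the roots simple and the speed integrable. For this reason the
    Gronwall estimate takes as its rate the derivative of a monotone function, which may blow up,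
    and asks for the equations only immediately to the right of each point. The base point on that
    path is wp0 - 1, so that the function to be recognised as the chart coordinate is tau itself.

    The nonzero discriminant is also what gives alpha <> 0, without which s would not be defined. *)

Section ComplexNorm.
Context {R : realType}.
Local Notation C := R[i].
Implicit Types x y z : C.

Lemma normc_ge0 x : 0 <= normc x.
Proof. by case: x => a b; rewrite sqrtr_ge0. Qed.

Lemma normc_eq0 x : (normc x == 0) = (x == 0).
Proof. by apply/eqP/eqP => [/eq0_normc//|->]; rewrite normc0. Qed.

Lemma normc_gt0 x : (0 < normc x) = (x != 0).
Proof. by rewrite lt_def normc_ge0 andbT normc_eq0. Qed.

Lemma normcX x n : normc (x ^+ n) = normc x ^+ n.
Proof.
by elim: n => [|n IH]; rewrite ?expr0 ?normc1// !exprS normcM IH.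
Qed.

Lemma normcR (a : R) : normc a%:C = `|a|.
Proof. by rewrite /= expr0n addr0 sqrtr_sqr. Qed.

Lemma normcB x y : normc (x - y) = normc (y - x).
Proof. by rewrite -normcN opprB. Qed.

Lemma ler_normcD x y : normc (x + y) <= normc x + normc y.
Proof. exact: le_normcD. Qed.

Lemma lerB_normcD x y : normc x - normc y <= normc (x + y).
Proof. by rewrite lerBlDr -(normcN y) -{1}(addrK y x); exact: le_normcD. Qed.

Lemma normc_Re x : `|complex.Re x| <= normc x.
Proof. by case: x => a b /=; rewrite -sqrtr_sqr ler_wsqrtr// lerDl sqr_ge0. Qed.

Lemma normc_Im x : `|complex.Im x| <= normc x.
Proof. by case: x => a b /=; rewrite -sqrtr_sqr ler_wsqrtr// lerDr sqr_ge0. Qed.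

Lemma normc_ReIm x : normc x <= `|complex.Re x| + `|complex.Im x|.
Proof.
case: x => a b; have -> : a +i* b = a%:C + 'i * b%:C by simpc.
rewrite (le_trans (ler_normcD _ _))// normcM !normcR /=.
by rewrite expr0n expr1n add0r sqrtr1 mul1r; simpc.
Qed.

Lemma ler_normc_sum (J : Type) (s : seq J) (P : pred J) (F : J -> C) :
  normc (\sum_(i <- s | P i) F i) <= \sum_(i <- s | P i) normc (F i).
Proof.
elim/big_rec2 : _ => [|i a b _ h]; first by rewrite normc0.
by rewrite (le_trans (ler_normcD _ _))// lerD2l.
Qed.

Lemma normc_nat n : normc (n%:R : C) = n%:R.
Proof.
have -> : (n%:R : C) = (n%:R : R)%:C by rewrite rmorph_nat.
by rewrite normcR normr_nat.
Qed.

Lemma normc_prod_le x y (u v : R) : normc x <= u -> normc y <= v ->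
  normc (x * y) <= u * v.
Proof. by move=> xu yv; rewrite normcM ler_pM ?normc_ge0. Qed.

Lemma normc_natM_le x (u : R) n : normc x <= u ->
  normc (n%:R * x) <= n%:R * u.
Proof. by move=> xu; rewrite normcM normc_nat ler_wpM2l. Qed.

Lemma normc_add_le x y (u v : R) : normc x <= u -> normc y <= v ->
  normc (x + y) <= u + v.
Proof. by move=> xu yv; rewrite (le_trans (ler_normcD _ _))// lerD. Qed.

Lemma normc_pow_le x (u : R) n : normc x <= u -> normc (x ^+ n) <= u ^+ n.
Proof.
move=> xu; rewrite normcX lerXn2r// nnegrE ?normc_ge0//.
by rewrite (le_trans _ xu)// normc_ge0.
Qed.

End ComplexNorm.

Ltac normc_bound := repeat first [assumption | apply: normc_natM_le
  | apply: normc_pow_le | apply: normc_prod_le | apply: normc_add_le].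

Section ComplexDerivative.
Context {R : realType}.
Local Notation C := R[i].

(* Complex differentiability with a quadratic bound on the remainder; every
   holomorphic function has it, and it needs no topology on C. *)
Definition cder (f : C -> C) (z l : C) : Prop :=
  exists K d : R, 0 < d /\ forall h, normc h <= d ->
    exists2 e, normc e <= K & f (z + h) = f z + h * l + h ^+ 2 * e.

Lemma cder_bound f z l : cder f z l ->
  exists K d : R, [/\ 0 < K, 0 < d, d <= 1 & forall h, normc h <= d ->
    exists2 e, normc e <= K & f (z + h) = f z + h * l + h ^+ 2 * e].
Proof.
move=> [K [d [d0 H]]]; exists (`|K| + 1), (Num.min d 1).
split; rewrite ?ltr_wpDl// ?lt_min ?d0 ?ltr01 ?ge_min ?lexx ?orbT//.
move=> h; rewrite le_min => /andP[/H[e He ->] _]; exists e => //.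
by rewrite (le_trans He)// (le_trans (ler_norm _))// lerDl.
Qed.

Lemma cder_cst (c z : C) : cder (fun=> c) z 0.
Proof.
by exists 0, 1; split => // h _; exists 0; rewrite ?normc0// !mulr0 !addr0.
Qed.

Lemma cder_id (z : C) : cder id z 1.
Proof.
by exists 0, 1; split => // h _; exists 0; rewrite ?normc0// mulr1 !mulr0 !addr0.
Qed.

Lemma cderD f g (z l m : C) : cder f z l -> cder g z m ->
  cder (fun x => f x + g x) z (l + m).
Proof.
move=> /cder_bound[K [d [K0 d0 d1 H]]] /cder_bound[K' [d' [K'0 d'0 d'1 H']]].
exists (K + K'), (Num.min d d'); split; first by rewrite lt_min d0.
move=> h; rewrite le_min => /andP[/H[e He ->] /H'[e' He' ->]].
exists (e + e'); last by ring.
by rewrite (le_trans (ler_normcD _ _))// lerD.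
Qed.

Lemma cderM f g (z l m : C) : cder f z l -> cder g z m ->
  cder (fun x => f x * g x) z (l * g z + f z * m).
Proof.
move=> /cder_bound[K [d [K0 d0 d1 H]]] /cder_bound[K' [d' [K'0 d'0 d'1 H']]].
exists (normc l * normc m + K * (normc (g z) + normc m + K') +
        K' * (normc (f z) + normc l)), (Num.min d d').
split; first by rewrite lt_min d0.
move=> h; rewrite le_min => /andP[hd hd'].
have h1 : normc h <= 1 by exact: le_trans d1.
have [e He ->] := H _ hd; have [e' He' ->] := H' _ hd'.
exists (l * m + e * (g z + h * m + h ^+ 2 * e') + e' * (f z + h * l)); last by ring.
have N0 := @normc_ge0 R.
have hK (x : C) : normc (h * x) <= normc x.
  by rewrite normcM -[leRHS]mul1r ler_wpM2r.
rewrite (le_trans (ler_normcD _ _))// lerD//; last first.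
  rewrite normcM ler_pM// (le_trans (ler_normcD _ _))// lerD//.
rewrite (le_trans (ler_normcD _ _))// lerD//; first by rewrite normcM.
rewrite normcM ler_pM// (le_trans (ler_normcD _ _))// lerD//.
  by rewrite (le_trans (ler_normcD _ _))// lerD.
by rewrite expr2 -mulrA; apply: le_trans (le_trans (hK _) (hK _)) _.
Qed.

Lemma cder_eq f (z l m : C) : cder f z l -> l = m -> cder f z m.
Proof. by move=> ? <-. Qed.

Lemma cderZ f (c z l : C) : cder f z l -> cder (fun x => c * f x) z (c * l).
Proof.
by move=> h; apply: cder_eq (cderM (cder_cst c z) h) _; rewrite mul0r add0r.
Qed.

Lemma cderN f (z l : C) : cder f z l -> cder (fun x => - f x) z (- l).
Proof.
move=> h; rewrite -mulN1r (_ : (fun x => - f x) = fun x => -1 * f x).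
  exact: cderZ.
by apply/funext => x; rewrite mulN1r.
Qed.

Lemma cderB f g (z l m : C) : cder f z l -> cder g z m ->
  cder (fun x => f x - g x) z (l - m).
Proof. by move=> hf /cderN hg; exact: cderD. Qed.

Lemma cderX f (z l : C) n : cder f z l ->
  cder (fun x => f x ^+ n.+1) z (n.+1%:R * f z ^+ n * l).
Proof.
move=> h; elim: n => [|n IH].
  by rewrite expr0 mulr1 mul1r.
have -> : (fun x => f x ^+ n.+2) = (fun x => f x * f x ^+ n.+1).
  by apply/funext => x; rewrite exprS.
apply: cder_eq (cderM h IH) _; rewrite -(addn1 n.+1) natrD !exprS; ring.
Qed.

Lemma cder_comp f g (z l m : C) : cder f z l -> cder g (f z) m ->
  cder (g \o f) z (m * l).
Proof.
move=> /cder_bound[K [d [K0 d0 d1 H]]] /cder_bound[K' [d' [K'0 d'0 d'1 H']]].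
have N0 := @normc_ge0 R.
pose B := normc l + K.
have B0 : 0 < B by rewrite ltr_wpDl.
exists (K * normc m + B ^+ 2 * K'), (Num.min d (d' / B)).
split; first by rewrite lt_min d0 divr_gt0.
move=> h; rewrite le_min => /andP[hd]; rewrite ler_pdivlMr// => hB.
have h1 : normc h <= 1 by exact: le_trans d1.
have hK (x : C) : normc (h * x) <= normc x.
  by rewrite normcM -[leRHS]mul1r ler_wpM2r.
rewrite /=; have [e He ->] := H _ hd.
have Hle : normc (l + h * e) <= B.
  by rewrite (le_trans (ler_normcD _ _))// lerD// (le_trans (hK _)).
have [|e' He'] := H' (h * (l + h * e)).
  by rewrite normcM (le_trans _ hB)// ler_wpM2l.
rewrite (_ : f z + h * l + _ = f z + h * (l + h * e)) => [->|]; last by ring.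
exists (e * m + (l + h * e) ^+ 2 * e'); last by ring.
rewrite (le_trans (ler_normcD _ _))// lerD//; first by rewrite normcM ler_wpM2r.
by rewrite normcM; apply: ler_pM => //; rewrite normcX lerXn2r ?nnegrE ?(ltW B0).
Qed.

Lemma cder_inv (z : C) : z != 0 -> cder GRing.inv z (- (z ^+ 2)^-1).
Proof.
move=> z0; have Nz : 0 < normc z by rewrite normc_gt0.
exists (2 / normc z ^+ 3), (normc z / 2); split; first by rewrite divr_gt0.
move=> h hz; have B : normc z / 2 <= normc (z + h).
  by rewrite (le_trans _ (lerB_normcD _ _))//; lra.
have zh : z + h != 0.
  by rewrite -normc_gt0 (lt_le_trans _ B)// divr_gt0.
exists ((z ^+ 2 * (z + h))^-1); last by field; rewrite z0 zh.
rewrite normcV normcM normcX.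
rewrite (_ : 2 / normc z ^+ 3 = (normc z ^+ 2 * (normc z / 2))^-1); last first.
  by field; rewrite gt_eqF.
have zh0 : 0 < normc (z + h) by rewrite normc_gt0.
rewrite lef_pV2 ?posrE ?mulr_gt0 ?exprn_gt0 ?divr_gt0//.
by rewrite ler_wpM2l// exprn_ge0 ?ltW.
Qed.

Lemma cderV f (z l : C) : f z != 0 -> cder f z l ->
  cder (fun x => (f x)^-1) z (- l / f z ^+ 2).
Proof.
move=> fz h; apply: cder_eq (cder_comp h (cder_inv fz)) _.
by rewrite mulNr mulNr mulrC.
Qed.

Lemma cder_near f g (z l : C) (d : R) : 0 < d ->
  (forall h, normc h <= d -> f (z + h) = g (z + h)) -> cder f z l -> cder g z l.
Proof.
move=> d0 E [K [d' [d'0 H]]]; exists K, (Num.min d d'); split.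
  by rewrite lt_min d0.
move=> h; rewrite le_min => /andP[hd /H[e He]]; exists e => //.
by rewrite -E// -(addr0 z) -E ?normc0 ?ltW// addr0.
Qed.

Lemma cder_translate f (z c l : C) : cder f (z + c) l ->
  cder (fun x => f (x + c)) z l.
Proof.
move=> [K [d [d0 H]]]; exists K, d; split => // h /H[e He E]; exists e => //.
by rewrite -E addrAC.
Qed.

Lemma cder_lip f (z l : C) : cder f z l -> exists K d : R,
  [/\ 0 < K, 0 < d & forall h, normc h <= d ->
    normc (f (z + h) - f z) <= K * normc h].
Proof.
move=> /cder_bound[K [d [K0 d0 d1 H]]]; have N0 := @normc_ge0 R.
exists (normc l + K), d; split => //; first by rewrite ltr_wpDl.
move=> h hd; have [e He ->] := H _ hd.
rewrite (_ : _ - _ = h * (l + h * e)); last by ring.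
rewrite normcM mulrC ler_wpM2r// (le_trans (ler_normcD _ _))// lerD2l normcM.
by rewrite -[K]mul1r ler_pM// (le_trans hd).
Qed.

End ComplexDerivative.

(** * Sums over the boxes of a lattice *)

Section Boxes.
Local Notation idx := (int * int)%type.
Implicit Types (c : idx) (N M i : nat).

Definition supn c : nat := maxn `|c.1|%N `|c.2|%N.

(** The index set of the double sum in [lattice_sum], recentred at 0. As a duplicate-free sequence
    it can be reindexed by permutations. *)
Definition box N : seq idx :=
  [seq (m%:Z - N%:Z, n%:Z - N%:Z) | m <- iota 0 N.*2.+1, n <- iota 0 N.*2.+1].

Lemma supn_eq0 c : (supn c == 0%N) = (c == 0).
Proof. by case: c => a b; rewrite /supn /= -leqn0 geq_max !leqn0 !absz_eq0. Qed.

Lemma supnN c : supn (- c) = supn c.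
Proof. by case: c => a b; rewrite /supn /= !abszN. Qed.

Lemma supnD c c' : (supn (c + c')%R <= supn c + supn c')%N.
Proof. case: c c' => a b [a' b']; rewrite /supn /=; lia. Qed.

Lemma mem_box c N : (c \in box N) = (supn c <= N)%N.
Proof.
have mi (k : nat) : (k \in iota 0 N.*2.+1) = (k <= N.*2)%N.
  by rewrite mem_iota.
apply/allpairsP/idP => [[[m n] []]|].
  by rewrite /= !mi; case: c => a b h1 h2 [-> ->]; rewrite /supn /=; lia.
case: c => a b; rewrite /supn /= => h.
exists (`|(a + N%:Z)%R|%N, `|(b + N%:Z)%R|%N); rewrite /= !mi.
by split; [lia|lia|congr pair; lia].
Qed.

Lemma box_uniq N : uniq (box N).
Proof.
apply: allpairs_uniq; rewrite ?iota_uniq// => -[m n] [m' n'] _ _ /= [].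
by move=> h1 h2; congr pair; lia.
Qed.

(** Four sides of 2 i + 1 points cover the shell, corners counted twice, and 8 i + 4 <= 12 i as soon
    as i > 0. *)
Lemma shell_size i N : (0 < i)%N ->
  (count (fun c => supn c == i) (box N) <= 12 * i)%N.
Proof.
move=> i0; pose J : seq int := [seq n%:Z - i%:Z | n <- iota 0 i.*2.+1].
have JP (a : int) : (`|a| <= i)%N -> a \in J.
  move=> h; apply/mapP; exists `|(a + i%:Z)%R|%N; last by lia.
  by rewrite mem_iota; lia.
pose S := [seq (i%:Z, b) | b <- J] ++ [seq (- i%:Z, b) | b <- J] ++
          [seq (a, i%:Z) | a <- J] ++ [seq (a, - i%:Z) | a <- J].
apply: (@leq_trans (size S)); last by rewrite !size_cat !size_map size_iota; lia.
rewrite -size_filter; apply: uniq_leq_size; first by rewrite filter_uniq ?box_uniq.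
move=> [a b]; rewrite mem_filter => /andP[/eqP + _]; rewrite /supn /= => h.
have [ha hb] : (`|a| <= i)%N /\ (`|b| <= i)%N by split; lia.
rewrite !mem_cat; apply/or4P.
have [?|na] := eqVneq a i%:Z.
  by apply: Or41; apply/mapP; exists b; [exact: JP|congr pair].
have [?|na'] := eqVneq a (- i%:Z).
  by apply: Or42; apply/mapP; exists b; [exact: JP|congr pair].
have [?|nb] := eqVneq b i%:Z.
  by apply: Or43; apply/mapP; exists a; [exact: JP|congr pair].
by apply: Or44; apply/mapP; exists a; [exact: JP|congr pair; lia].
Qed.

Lemma perm_boxN N : perm_eq (box N) [seq - c | c <- box N].
Proof.
apply: uniq_perm; rewrite ?(map_inj_uniq oppr_inj) ?box_uniq// => c.
rewrite -{2}(opprK c) (mem_map oppr_inj) !mem_box.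
by rewrite supnN.
Qed.

Section Sums.
Context {V : nmodType}.
Implicit Types F : idx -> V.

Lemma box_sumN N (P : pred idx) F :
  \sum_(c <- box N | P c) F c = \sum_(c <- box N | P (- c)) F (- c).
Proof. by rewrite (perm_big _ (perm_boxN N)) big_map. Qed.

Lemma box_sum_sub N M (P : pred idx) F : (forall c, P c -> (supn c <= N)%N) ->
  (N <= M)%N -> \sum_(c <- box M | P c) F c = \sum_(c <- box N | P c) F c.
Proof.
move=> hP NM; rewrite -big_filter -[RHS]big_filter; apply: perm_big.
apply: uniq_perm; rewrite ?filter_uniq ?box_uniq// => c.
rewrite !mem_filter !mem_box; case: (boolP (P c)) => //= /hP h.
by rewrite h (leq_trans h).
Qed.

(** A translation by [a] moves indices out of the box by at most [supn a]; the radius [M] leaves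
    room for that. *)
Lemma box_sum_shift N M (a : idx) (P : pred idx) F :
  (forall c, P c -> (supn c <= N)%N) -> (N + supn a <= M)%N ->
  \sum_(c <- box N | P c) F c = \sum_(c <- box M | P (c + a)) F (c + a).
Proof.
move=> hP NM; rewrite -big_filter -[RHS]big_filter.
rewrite -(big_map (fun c => c + a) xpredT F); apply: perm_big.
apply: uniq_perm; rewrite ?filter_uniq ?box_uniq//.
  by rewrite map_inj_uniq ?filter_uniq ?box_uniq//; exact: addIr.
move=> c; rewrite -{2}(subrK a c) (mem_map (addIr a)) !mem_filter !mem_box subrK.
case: (boolP (P c)) => //= /hP h; rewrite h; symmetry.
by rewrite (leq_trans (supnD _ _))// supnN (leq_trans _ NM)// leq_add2r.
Qed.

Lemma box_sumE N (F : int -> int -> V) :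
  \sum_(m < N.*2.+1) \sum_(n < N.*2.+1 | (m != N :> nat) || (n != N :> nat))
    F (m%:Z - N%:Z) (n%:Z - N%:Z) =
  \sum_(c <- box N | c != 0) F c.1 c.2.
Proof.
rewrite [RHS]big_mkcond big_allpairs_dep.
rewrite -(big_mkord xpredT (fun m : nat => \sum_(n < N.*2.+1 | (m != N) || (n != N :> nat))
    F (m%:Z - N%:Z) (n%:Z - N%:Z))) /index_iota subn0.
apply: eq_bigr => m _.
rewrite -(big_mkord (fun n => (m != N) || (n != N :> nat))
  (fun n : nat => F (m%:Z - N%:Z) (n%:Z - N%:Z))) /index_iota subn0.
rewrite [LHS]big_mkcond; apply: eq_bigr => n _; congr (if _ then _ else _).
by rewrite -pair_eqE /pair_eq /= negb_and; lia.
Qed.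

End Sums.

(** Grouping the indices by [supn] reduces a sum over the plane to a sum over radii, where radius i
    carries at most 12 i terms by [shell_size]. *)
Lemma box_sum_le (R : realType) M lo hi (P : pred idx) (F : idx -> R)
    (g : nat -> R) :
  (forall i, 0 <= g i) ->
  (forall c, P c -> (lo < supn c <= hi)%N /\ F c <= g (supn c)) ->
  \sum_(c <- box M | P c) F c <= \sum_(lo.+1 <= i < hi.+1) 12 * i%:R * g i.
Proof.
move=> g0 H.
apply: (@le_trans _ _ (\sum_(c <- box M | P c) g (supn c))).
  by apply: ler_sum => c /H[].
apply: (@le_trans _ _ (\sum_(c <- box M | P c) \sum_(lo.+1 <= i < hi.+1 | i == supn c) g i)).
  apply: ler_sum => c /H[/andP[h1 h2] _].
  by rewrite big_nat1_eq h1 ltnS h2.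
rewrite (exchange_big_dep xpredT)//= big_nat_cond [leRHS]big_nat_cond.
apply: ler_sum => i /andP[/andP[h1 h2] _].
rewrite (eq_bigl (fun c => P c && (supn c == i))); last by move=> c; rewrite eq_sym.
rewrite big_const_seq iter_addr_0 -[_ *+ count _ _]mulr_natl ler_wpM2r//.
have i0 : (0 < i)%N by exact: leq_trans h1.
rewrite -natrM ler_nat (leq_trans _ (shell_size M i0))//.
by apply: sub_count => c /andP[].
Qed.

End Boxes.

(** * Limits of complex sequences through real and imaginary parts *)

Section ComplexLimit.
Context {R : realType}.
Local Notation C := R[i].

Definition ccvg (u : nat -> C) (l : C) : Prop :=
  (Re \o u @ \oo --> Re l) /\
  (Im \o u @ \oo --> Im l).

Lemma ccvg_lim u l : ccvg u l -> complex_lim u = l.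
Proof.
move=> [hr hi]; rewrite /complex_lim.
have -> : lim (Re \o u @ \oo) = Re l by exact: cvg_lim.
have -> : lim (Im \o u @ \oo) = Im l by exact: cvg_lim.
by case: l {hr hi}.
Qed.

Lemma ccvg_unique u l m : ccvg u l -> ccvg u m -> l = m.
Proof. by move=> /ccvg_lim <- /ccvg_lim <-. Qed.

Lemma ccvg_cst l : ccvg (fun=> l) l.
Proof. by split; exact: cvg_cst. Qed.

Lemma ccvg_eq u v l : u =1 v -> ccvg u l -> ccvg v l.
Proof. by move=> /funext ->. Qed.

Lemma ReD (x y : C) : Re (x + y) = Re x + Re y.
Proof. by case: x y => a b []. Qed.
Lemma ImD (x y : C) : Im (x + y) = Im x + Im y.
Proof. by case: x y => a b []. Qed.
Lemma ReB (x y : C) : Re (x - y) = Re x - Re y.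
Proof. by case: x y => a b []. Qed.
Lemma ImB (x y : C) : Im (x - y) = Im x - Im y.
Proof. by case: x y => a b []. Qed.
Lemma ReM (x y : C) : Re (x * y) =
  Re x * Re y - Im x * Im y.
Proof. by case: x y => a b []. Qed.
Lemma ImM (x y : C) : Im (x * y) =
  Re x * Im y + Im x * Re y.
Proof. by case: x y => a b []. Qed.

Lemma ccvgD u v l m : ccvg u l -> ccvg v m -> ccvg (fun n => u n + v n) (l + m).
Proof.
move=> [ur ui] [vr vi]; rewrite /ccvg ReD ImD; split.
  rewrite (_ : Re \o _ = (Re \o u) \+ (Re \o v)); first exact: cvgD.
  by apply/funext => n; rewrite /= ReD.
rewrite (_ : Im \o _ = (Im \o u) \+ (Im \o v)); first exact: cvgD.
by apply/funext => n; rewrite /= ImD.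
Qed.

Lemma ccvgM u v l m : ccvg u l -> ccvg v m -> ccvg (fun n => u n * v n) (l * m).
Proof.
move=> [ur ui] [vr vi]; rewrite /ccvg ReM ImM; split.
  rewrite (_ : Re \o _ = fun n => Re (u n) * Re (v n) - Im (u n) * Im (v n)).
    by apply: cvgB; exact: cvgM.
  by apply/funext => n; rewrite /= ReM.
rewrite (_ : Im \o _ = fun n => Re (u n) * Im (v n) + Im (u n) * Re (v n)).
  by apply: cvgD; exact: cvgM.
by apply/funext => n; rewrite /= ImM.
Qed.

Lemma ccvgB u v l m : ccvg u l -> ccvg v m -> ccvg (fun n => u n - v n) (l - m).
Proof.
move=> hu hv; rewrite -(mulN1r m).
have := ccvgD hu (ccvgM (ccvg_cst (-1)) hv).
by apply: ccvg_eq => n; rewrite mulN1r.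
Qed.

Lemma ccvg_norm_le u l (e : nat -> R) :
  (\forall n \near \oo, normc (u n - l) <= e n) -> e @ \oo --> 0 -> ccvg u l.
Proof.
move=> H e0.
have key (f : C -> R) : {morph f : x y / x - y} -> (forall x, `|f x| <= normc x) ->
    f \o u @ \oo --> f l.
  move=> fB fN; apply/cvgrPdist_le => /= eps eps0.
  have /cvgrPdist_le/(_ _ eps0) he := e0.
  near=> n; rewrite distrC -fB; apply: le_trans (fN _) _.
  apply: (@le_trans _ _ (e n)); first by near: n.
  apply: (@le_trans _ _ `|0 - e n|); last by near: n.
  by rewrite sub0r normrN ler_norm.
split.
  by apply: key; [exact: ReB|exact: normc_Re].
by apply: key; [exact: ImB|exact: normc_Im].
Unshelve. all: by end_near. Qed.

(** The bound passes to the limit for the real and the imaginary part separately, which costs the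
    factor 2. *)
Lemma ccvg_normc_le u l (B : R) : ccvg u l -> (forall n, normc (u n) <= B) ->
  normc l <= 2 * B.
Proof.
move=> [ur ui] H; rewrite (le_trans (normc_ReIm _))// mulr_natl mulr2n.
have key (f : nat -> R) (y : R) : f @ \oo --> y -> (forall n, `|f n| <= B) -> `|y| <= B.
  move=> fy fB; have <- : lim (f @ \oo) = y by exact: cvg_lim.
  have cf : cvgn f by apply/cvg_ex; exists y.
  rewrite ler_norml; apply/andP; split.
    by apply: limr_ge => //; near=> n; have := fB n; rewrite ler_norml => /andP[].
  by apply: limr_le => //; near=> n; have := fB n; rewrite ler_norml => /andP[].
apply: lerD; [apply: key ur _|apply: key ui _] => n.
  by apply: le_trans (normc_Re _) _.
by apply: le_trans (normc_Im _) _.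
Unshelve. all: by end_near. Qed.

Lemma cvg_inv_succ (B : R) : (fun n : nat => B / n.+1%:R) @ \oo --> (0 : R).
Proof.
rewrite -(mulr0 B); apply: cvgM; first exact: cvg_cst.
exact: cvg_harmonic.
Qed.

Lemma cauchy_rate (u : nat -> R) (B : R) :
  (forall N M, (N <= M)%N -> `|u M - u N| <= B / N.+1%:R) -> cvgn u.
Proof.
move=> H; apply: R_complete; apply/cauchy_exP => /= eps eps0.
have /cvgrPdist_lt/(_ _ eps0)[N _ HN] := @cvg_inv_succ B.
exists (u N); exists N => // M /= NM; rewrite /ball /= distrC.
apply: le_lt_trans (H _ _ NM) _; have := HN N (leqnn N).
by rewrite sub0r normrN; apply: le_lt_trans; rewrite ler_norm.
Qed.

Lemma ccauchy_rate (u : nat -> C) (B : R) :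
  (forall N M, (N <= M)%N -> normc (u M - u N) <= B / N.+1%:R) ->
  exists l, ccvg u l.
Proof.
move=> H.
have /cvg_ex[a Ha] : cvgn (Re \o u).
  apply: (@cauchy_rate _ B) => N M NM; apply: le_trans (H _ _ NM).
  by apply: le_trans (normc_Re _); rewrite ReB.
have /cvg_ex[b Hb] : cvgn (Im \o u).
  apply: (@cauchy_rate _ B) => N M NM; apply: le_trans (H _ _ NM).
  by apply: le_trans (normc_Im _); rewrite ImB.
by exists (a +i* b).
Qed.

End ComplexLimit.

(** * Absolutely convergent series over the nonzero indices *)

Section BoxSeries.
Context {R : realType}.
Local Notation C := R[i].
Local Notation idx := (int * int)%type.
Implicit Types F G : idx -> C.

Definition bsum F (N : nat) : C := \sum_(c <- box N | c != 0) F c.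

Definition csum F : C := complex_lim (bsum F).

(** Cubic decay suffices in the plane: with at most 12 i indices at radius i, the terms add up like
    1 / i^2. *)
Definition dominated (K : R) F : Prop :=
  forall c, c != 0 -> normc (F c) <= K / (supn c)%:R ^+ 3.

Lemma sum_inv_sqr_le (N M : nat) :
  \sum_(N.+1 <= i < M.+1) (i%:R ^+ 2)^-1 <= 2 / N.+1%:R :> R.
Proof.
(* Keeping the telescoped tail makes the induction on [M] close, through 1 / m^2 <= 2 / m - 2 / (m +
   1). The boolean factor drops that tail when M < N. *)
apply: (@le_trans _ _ (2 / N.+1%:R - (N <= M)%:R * 2 / M.+1%:R)); last first.
  by rewrite lerBlDr lerDl divr_ge0// mulr_ge0.
elim: M => [|M IH].
  rewrite big_geq//; case: N => [|N] /=; first by rewrite mul1r subrr.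
  by rewrite !mul0r subr0 divr_ge0.
have [MN|NM] := ltnP M.+1 N.
  by rewrite big_geq /= ?mul0r ?subr0 ?divr_ge0 ?(leqW MN).
have [NM'|NM'] := ltnP M N.
  have -> : N = M.+1 by apply/eqP; rewrite eqn_leq NM NM'.
  by rewrite big_geq//= mul1r subrr.
rewrite big_nat_recr//=; apply: le_trans (lerD IH (lexx _)) _.
rewrite NM' !mul1r.
have m0 : 0 < M.+1%:R :> R by [].
have m1 : M.+2%:R = M.+1%:R + 1 :> R by rewrite -natr1.
rewrite m1; set m := M.+1%:R in m0 *.
have hm : (m ^+ 2)^-1 <= 2 / m - 2 / (m + 1).
  have : 1 <= m by rewrite ler1n.
  move: (m) => x x1; have x0 : 0 < x by lra.
  rewrite -subr_ge0 (_ : _ - _ = (x - 1) / (x ^+ 2 * (x + 1))); last first.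
    by field; rewrite !lt0r_neq0 ?addr_gt0.
  by rewrite divr_ge0 ?subr_ge0// mulr_ge0 ?exprn_ge0 ?addr_ge0 ?ltW.
by rewrite -addrA lerD2l addrC lerBlDr addrC.
Qed.

(** The constant 24 is the 12 of [shell_size] times the 2 of [sum_inv_sqr_le]. *)
Lemma dominated_tail K F N M (P : pred idx) : dominated K F ->
  0 <= K -> (forall c, P c -> (N < supn c <= M)%N) ->
  normc (\sum_(c <- box M | P c) F c) <= 24 * K / N.+1%:R.
Proof.
move=> dF K0 PN.
apply: le_trans (ler_normc_sum _ _ _) _.
apply: (@le_trans _ _ (\sum_(N.+1 <= i < M.+1) 12 * i%:R * (K / i%:R ^+ 3))).
  apply: box_sum_le => [i|c Pc]; first by rewrite divr_ge0 ?exprn_ge0.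
  split; first exact: PN.
  by apply: dF; rewrite -supn_eq0 -lt0n; case/andP: (PN _ Pc) => h _; exact: leq_ltn_trans h.
rewrite (_ : 24 * K / N.+1%:R = 12 * K * (2 / N.+1%:R)); last by ring.
apply: le_trans (ler_wpM2l _ (sum_inv_sqr_le N M)); last by rewrite mulr_ge0.
rewrite mulr_sumr big_nat_cond [leRHS]big_nat_cond.
apply: ler_sum => i /andP[/andP[Ni _] _].
have i0 : i%:R != 0 :> R by rewrite pnatr_eq0 -lt0n (leq_trans _ Ni).
by rewrite le_eqVlt; apply/orP; left; apply/eqP; field.
Qed.

Lemma bsumB F N M : (N <= M)%N ->
  bsum F M - bsum F N = \sum_(c <- box M | (N < supn c <= M)%N) F c.
Proof.
move=> NM; rewrite /bsum (bigID (fun c => supn c <= N)%N)/=.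
rewrite (@box_sum_sub _ N M)//; last by move=> c /andP[].
have E : \sum_(c <- box N | (c != 0) && (supn c <= N)%N) F c =
         \sum_(c <- box N | c != 0) F c.
  rewrite big_seq_cond [RHS]big_seq_cond; apply: eq_bigl => c.
  by rewrite mem_box; case: (supn c <= N)%N; rewrite ?andbF ?andbT.
rewrite E addrAC subrr add0r big_seq_cond [RHS]big_seq_cond; apply: eq_bigl => c.
rewrite mem_box -supn_eq0; case: (supn c <= M)%N; rewrite ?andbF//= andbT -ltnNge.
by case: (supn c).
Qed.

Lemma dominated_ge0 K F : dominated K F -> 0 <= K.
Proof.
move=> dF; have := dF (1, 0) isT; rewrite /supn /= expr1n divr1; apply: le_trans.
exact: normc_ge0.
Qed.

Lemma dominated_cvg K F : dominated K F -> ccvg (bsum F) (csum F).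
Proof.
move=> dF; suff [l hl] : exists l, ccvg (bsum F) l by rewrite /csum (ccvg_lim hl).
have K0 := dominated_ge0 dF.
apply: (@ccauchy_rate _ _ (24 * K)) => N M NM; rewrite bsumB//.
by apply: dominated_tail dF K0 _.
Qed.

(** [dominated_tail] at N = 0 gives 24 K for every box sum; [ccvg_normc_le] doubles it in the
    limit. *)
Lemma csum_le K F : dominated K F -> normc (csum F) <= 48 * K.
Proof.
move=> dF; rewrite (_ : 48 * K = 2 * (24 * K)); last by ring.
apply: (ccvg_normc_le (dominated_cvg dF)) => N.
have -> : bsum F N = \sum_(c <- box N | (0 < supn c <= N)%N) F c.
  rewrite /bsum big_seq_cond [RHS]big_seq_cond; apply: eq_bigl => c.
  by rewrite mem_box -supn_eq0 -lt0n; case: (supn c <= N)%N; rewrite ?andbF ?andbT.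
rewrite -[leRHS]divr1.
exact: (@dominated_tail K F 0 N _ dF (dominated_ge0 dF) (fun c h => h)).
Qed.

Lemma csumD K K' F G : dominated K F -> dominated K' G ->
  csum (fun c => F c + G c) = csum F + csum G.
Proof.
move=> dF dG; apply: ccvg_lim.
apply: ccvg_eq (ccvgD (dominated_cvg dF) (dominated_cvg dG)) => N.
by rewrite /bsum big_split.
Qed.

Lemma csumZ K F (a : C) : dominated K F ->
  csum (fun c => a * F c) = a * csum F.
Proof.
move=> dF; apply: ccvg_lim.
apply: ccvg_eq (ccvgM (ccvg_cst a) (dominated_cvg dF)) => N.
by rewrite /bsum mulr_sumr.
Qed.

Lemma eq_csum F G : (forall c, c != 0 -> F c = G c) -> csum F = csum G.
Proof.
move=> H; rewrite /csum; congr complex_lim; apply/funext => N.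
exact: eq_bigr.
Qed.

Lemma csumN F : csum F = csum (fun c => F (- c)).
Proof.
rewrite /csum; congr complex_lim; apply/funext => N; rewrite /bsum box_sumN.
by apply: eq_bigl => c; rewrite oppr_eq0.
Qed.

Lemma dominatedZ K F (a : C) : dominated K F ->
  dominated (normc a * K) (fun c => a * F c).
Proof. by move=> dF c c0; rewrite normcM -mulrA ler_wpM2l ?normc_ge0 ?dF. Qed.

Lemma dominatedD K K' F G : dominated K F -> dominated K' G ->
  dominated (K + K') (fun c => F c + G c).
Proof.
move=> dF dG c c0; rewrite (le_trans (ler_normcD _ _))// mulrDl.
by rewrite lerD ?dF ?dG.
Qed.

End BoxSeries.

(** * The Weierstrass function of a lattice *)

Section Lattice.
Context {R : realType} (w1 w2 : R[i]).
Local Notation C := R[i].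
Local Notation idx := (int * int)%type.
Implicit Types (c : idx) (z h : C).

Definition lat c : C := c.1%:~R * w1 + c.2%:~R * w2.

Lemma latD c c' : lat (c + c') = lat c + lat c'.
Proof. by rewrite /lat /= !rmorphD /=; ring. Qed.

Lemma latN c : lat (- c) = - lat c.
Proof. by rewrite /lat /= !rmorphN /=; ring. Qed.

Lemma latB c c' : lat (c - c') = lat c - lat c'.
Proof. by rewrite latD latN. Qed.

Lemma lat0 : lat 0 = 0.
Proof. by rewrite /lat /= !mul0r addr0. Qed.

Lemma latticeP z : lattice w1 w2 z <-> exists c, z = lat c.
Proof.
split => [[m [n ->]]|[[m n] ->]]; first by exists (m, n).
by exists m, n.
Qed.

Lemma lattice_sumE (F : C -> C) : lattice_sum w1 w2 F = csum (F \o lat).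
Proof.
rewrite /lattice_sum /csum; congr complex_lim; apply/funext => N.
rewrite /bsum -(box_sumE N (fun m n => F (lat (m, n)))).
apply: eq_bigr => m _; apply: eq_bigr => n _.
by rewrite /lat /= !rmorphB /=.
Qed.

(** The Weierstrass function minus its pole at the origin. *)
Definition wpreg z : C :=
  csum (fun c => ((z - lat c) ^+ 2)^-1 - (lat c ^+ 2)^-1).

Definition eis (k : nat) z : C := csum (fun c => ((z - lat c) ^+ k)^-1).

Lemma weierstrass_pE z : weierstrass_p w1 w2 z = (z ^+ 2)^-1 + wpreg z.
Proof. by rewrite /weierstrass_p lattice_sumE. Qed.

(** The origin is allowed: [wpreg] and [eis] leave out the index 0 and are holomorphic there. *)
Definition regular z : Prop := forall c, z = lat c -> c = 0.

Hypothesis hw : real_independent w1 w2.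

Lemma lattice_det : Re w1 * Im w2 - Re w2 * Im w1 != 0.
Proof.
move: hw; case: w1 w2 => x1 y1 [x2 y2] /= H; apply/eqP => D.
(* If the determinant vanishes, then y2 w1 - y1 w2 = 0 is a real relation, so y1 = y2 = 0. *)
have [y20 y10] : y2 = 0 /\ - y1 = 0.
  by apply: H; simpc; apply/eqP; rewrite eq_complex /=; apply/andP; split; apply/eqP; lra.
have {}y10 : y1 = 0 by lra.
have [x20 x10] : x2 = 0 /\ - x1 = 0.
  by apply: H; simpc; apply/eqP; rewrite eq_complex /= y10 y20; apply/andP; split; apply/eqP; ring.
have {}x10 : x1 = 0 by lra.
have [/eqP] : 1 = 0 :> R /\ 0 = 0 :> R.
  by apply: H; rewrite x10 x20 y10 y20; simpc.
by rewrite oner_eq0.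
Qed.

Lemma coordP z : exists a b : R, z = a%:C * w1 + b%:C * w2.
Proof.
move: lattice_det; case: w1 w2 z => x1 y1 [x2 y2] [x y] /= D.
set d := _ - _ in D.
exists ((x * y2 - y * x2) / d), ((y * x1 - x * y1) / d); simpc.
by apply/eqP; rewrite eq_complex /=; apply/andP; split; apply/eqP; rewrite /d; field.
Qed.

(** Cramer's rule: each real coordinate times the determinant is a combination of the real and
    imaginary parts, with coefficients bounded by [B]. *)
Lemma coord_bound : exists2 k : R, 0 < k & forall a b : R,
  k * `|a| <= normc (a%:C * w1 + b%:C * w2) /\
  k * `|b| <= normc (a%:C * w1 + b%:C * w2).
Proof.
move: lattice_det; case: w1 w2 => x1 y1 [x2 y2] /= D.
set d := _ - _ in D.
have d0 : 0 < `|d| by rewrite normr_gt0.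
pose B := `|x1| + `|y1| + `|x2| + `|y2| + 1.
have B0 : 0 < B by rewrite ltr_wpDl// !addr_ge0.
have key (a x y p q : R) : a * d = x * p - y * q -> `|p| + `|q| <= B ->
    `|d| / B * `|a| <= normc (x +i* y).
  move=> E pq; rewrite mulrAC ler_pdivrMr// -normrM mulrC E.
  rewrite (le_trans (ler_normB _ _))// !normrM.
  apply: (@le_trans _ _ (normc (x +i* y) * (`|p| + `|q|))).
    rewrite mulrDr; apply: lerD; rewrite ler_wpM2r//; first exact: (normc_Re (x +i* y)).
    exact: (normc_Im (x +i* y)).
  by rewrite ler_wpM2l ?normc_ge0.
exists (`|d| / B); first by rewrite divr_gt0.
move=> a b; simpc.
have N0 (x : R) : 0 <= `|x| by [].
split.
  apply: (key _ _ _ y2 x2); first by rewrite /d; ring.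
  by rewrite /B; move: (N0 x1) (N0 y1); lra.
apply: (key _ _ _ (- y1) (- x1)); first by rewrite /d; ring.
by rewrite /B !normrN; move: (N0 x2) (N0 y2); lra.
Qed.

Lemma int_dist (a : R) : (forall m : int, a <> m%:~R) ->
  exists2 e : R, 0 < e & forall m : int, e <= `|a - m%:~R|.
Proof.
move=> Ha; set f := Num.floor a.
have fa : f%:~R <= a by exact: floor_le.
have af : a < (f + 1)%:~R by rewrite floorD1_gt.
exists (Num.min (a - f%:~R) ((f + 1)%:~R - a)).
  rewrite lt_min !subr_gt0 af andbT lt_neqAle fa andbT.
  by apply/eqP => /esym; exact: Ha.
move=> m; rewrite ge_min; have [mf|fm] := leP m f.
  have : m%:~R <= f%:~R :> R by rewrite ler_int.
  by move=> h; apply/orP; left; apply: le_trans (ler_norm _); rewrite lerD2l lerN2.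
have : (f + 1)%:~R <= m%:~R :> R by rewrite ler_int lezD1.
move=> h; apply/orP; right; rewrite distrC; apply: le_trans (ler_norm _).
by rewrite lerD2r.
Qed.

Lemma supnR c : (supn c)%:R = Num.max `|c.1%:~R| `|c.2%:~R| :> R.
Proof.
rewrite /supn natr_max; congr Num.max; by rewrite -intr_norm -abszE.
Qed.

(** [X c] is the sup distance from z to [lat c] in lattice coordinates, and [coord_bound] compares
    it with the norm. As [supn c] <= X c + B, any uniform gap e <= X c yields the linear bound. Such
    a gap exists unless both coordinates of z are integers; regularity then forces z = 0, where X c
    = [supn c]. *)
Lemma regular_dist z : regular z -> exists2 k : R, 0 < k &
  forall c, c != 0 -> k * (supn c)%:R <= normc (z - lat c).
Proof.
move=> rz; have [a [b zE]] := coordP z; have [k k0 kP] := coord_bound.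
have E c : z - lat c = (a - c.1%:~R)%:C * w1 + (b - c.2%:~R)%:C * w2.
  by rewrite zE /lat !rmorphB /= !rmorph_int; ring.
pose X c := Num.max `|a - c.1%:~R| `|b - c.2%:~R|.
have XP c : k * X c <= normc (z - lat c).
  rewrite E /X; have [h1 h2] := kP (a - c.1%:~R) (b - c.2%:~R).
  by rewrite /Num.max; case: ifP.
suff [k' k'0 k'P] : exists2 k' : R, 0 < k' & forall c, c != 0 -> k' * (supn c)%:R <= X c.
  exists (k * k'); first by rewrite mulr_gt0.
  move=> c c0; apply: le_trans (XP c).
  by rewrite -mulrA ler_wpM2l ?k'P// ltW.
pose B := Num.max `|a| `|b|.
have sX c : (supn c)%:R <= X c + B.
  rewrite supnR ge_max; apply/andP; split.
    rewrite (_ : c.1%:~R = a - (a - c.1%:~R)); last by ring.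
    by rewrite (le_trans (ler_normB _ _))// addrC lerD// le_max lexx.
  rewrite (_ : c.2%:~R = b - (b - c.2%:~R)); last by ring.
  by rewrite (le_trans (ler_normB _ _))// addrC lerD// le_max lexx orbT.
have B0 : 0 <= B by rewrite le_max normr_ge0.
have sep e : 0 < e -> (forall c, e <= X c) ->
    exists2 k' : R, 0 < k' & forall c, c != 0 -> k' * (supn c)%:R <= X c.
  move=> e0 eX; have hB : 0 < 1 + B / e by rewrite ltr_pwDl// divr_ge0// ltW.
  exists (1 + B / e)^-1; first by rewrite invr_gt0.
  move=> c _; rewrite mulrC ler_pdivrMr//; apply: le_trans (sX c) _.
  rewrite mulrDr mulr1 lerD2l mulrA ler_pdivlMr// mulrC ler_wpM2r//.
have [[m am]|na] := pselect (exists m : int, a = m%:~R); last first.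
  have [|e e0 eP] := @int_dist a; first by move=> i ai; apply: na; exists i.
  by apply: (sep e e0) => c; rewrite le_max eP.
have [[n bn]|nb] := pselect (exists n : int, b = n%:~R); last first.
  have [|e e0 eP] := @int_dist b; first by move=> i bi; apply: nb; exists i.
  by apply: (sep e e0) => c; rewrite le_max eP orbT.
have [m0 n0] : (m, n) = 0 :> idx.
  by apply: rz; rewrite zE /lat am bn !rmorph_int.
exists 1 => // c _; rewrite mul1r supnR /X am bn m0 n0 /= !sub0r !normrN.
exact: lexx.
Qed.

Lemma supn_ge1 c : c != 0 -> 1 <= (supn c)%:R :> R.
Proof. by rewrite -supn_eq0 -lt0n ler1n. Qed.

Lemma regular_near z : regular z -> exists k d : R, [/\ 0 < k, 0 < d &
  forall h c, normc h <= d -> c != 0 ->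
    k * (supn c)%:R <= normc (z + h - lat c) /\
    k * (supn c)%:R <= normc (z - lat c)].
Proof.
move=> /regular_dist[k k0 kP]; exists (k / 2), (k / 2).
have h2 : 0 < k / 2 by rewrite divr_gt0.
split => // h c hd c0; have := kP c c0; have s1 := supn_ge1 c0.
have h3 : k <= k * (supn c)%:R by rewrite ler_peMr// ltW.
move=> h4; have h5 : normc (z - lat c) - normc h <= normc (z + h - lat c).
  by rewrite addrAC lerB_normcD.
have -> : k / 2 * (supn c)%:R = k * (supn c)%:R / 2 by ring.
by move: (k * _) h3 h4 => y h3 h4; split; lra.
Qed.

Lemma regular0 : regular 0.
Proof.
move=> [m n] /esym; rewrite /lat /= => E.
have [] := @hw m%:~R n%:~R; first by rewrite !rmorph_int.
by move=> /eqP; rewrite intr_eq0 => /eqP -> /eqP; rewrite intr_eq0 => /eqP ->.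
Qed.

Lemma lat_inj : injective lat.
Proof.
move=> c c' /eqP; rewrite -subr_eq0 -latB => /eqP/esym/regular0.
exact: subr0_eq.
Qed.

Lemma lat_bound : exists2 k : R, 0 < k &
  forall c, c != 0 -> k * (supn c)%:R <= normc (lat c).
Proof.
have [k k0 kP] := regular_dist regular0; exists k => // c /kP.
by rewrite sub0r normcN.
Qed.

End Lattice.

(** * Eisenstein series and their termwise derivatives *)

Section Eisenstein.
Context {R : realType} (w1 w2 : R[i]).
Local Notation C := R[i].
Local Notation idx := (int * int)%type.
Local Notation lat := (lat w1 w2).
Local Notation regular := (regular w1 w2).
Local Notation wpreg := (wpreg w1 w2).
Local Notation eis := (eis w1 w2).
Implicit Types (c : idx) (z h : C).

(** Termwise differentiation: the second-order remainders are dominated uniformly in h, so their sum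
    is bounded and is the remainder of the sum. *)
Lemma cder_csum (f : C -> idx -> C) (f' : idx -> C) (e : C -> idx -> C)
    z (K0 K1 K2 d : R) :
  0 < d -> dominated K0 (f z) -> dominated K1 f' ->
  (forall h, normc h <= d -> dominated K2 (e h)) ->
  (forall h c, normc h <= d -> c != 0 ->
     f (z + h) c = f z c + h * f' c + h ^+ 2 * e h c) ->
  cder (fun x => csum (f x)) z (csum f').
Proof.
move=> d0 D0 D1 D2 E; exists (48 * K2), d; split => // h hd.
exists (csum (e h)); first exact/csum_le/D2.
rewrite -(csumZ _ D1) -(csumZ _ (D2 _ hd)).
rewrite -(csumD D0 (dominatedZ _ D1)).
rewrite -(csumD (dominatedD D0 (dominatedZ _ D1)) (dominatedZ _ (D2 _ hd))).
by apply: eq_csum => c c0; exact: E.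
Qed.

Definition inv_bounded (k : R) (a : C) c : Prop :=
  normc a <= (k * (supn c)%:R)^-1.

Lemma inv_boundedP (k : R) (x : C) c : 0 < k -> c != 0 ->
  k * (supn c)%:R <= normc x -> inv_bounded k x^-1 c.
Proof.
move=> k0 c0 H; have s1 := @supn_ge1 R _ c0.
rewrite /inv_bounded normcV lef_pV2//; last first.
  by rewrite posrE mulr_gt0// (lt_le_trans _ s1).
by rewrite posrE (lt_le_trans _ H)// mulr_gt0// (lt_le_trans _ s1).
Qed.

Lemma pow_bound (k : R) c j : 0 < k -> c != 0 -> (3 <= j)%N ->
  (k * (supn c)%:R)^-1 ^+ j <= k^-1 ^+ j / (supn c)%:R ^+ 3.
Proof.
move=> k0 c0 j3; have s1 := @supn_ge1 R _ c0.
rewrite invfM exprMn ler_wpM2l ?exprn_ge0 ?invr_ge0 ?(ltW k0)//.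
rewrite -exprVn -(subnK j3) exprD ler_piMl ?exprn_ge0 ?invr_ge0//.
by rewrite exprn_ile1 ?invr_ge0// invf_le1// (lt_le_trans _ s1).
Qed.

Lemma inv_bounded_expr (k : R) (a : C) c j : 0 < k -> c != 0 -> (3 <= j)%N ->
  inv_bounded k a c -> normc (a ^+ j) <= k^-1 ^+ j / (supn c)%:R ^+ 3.
Proof.
move=> k0 c0 j3 H; apply: le_trans (pow_bound k0 c0 j3); rewrite normcX.
by rewrite lerXn2r// nnegrE ?normc_ge0// (le_trans _ H)// normc_ge0.
Qed.

(* Second-order remainders of x^-2, x^-3, x^-4, with a = 1/(x+h), b = 1/x. *)
Definition rem2 (a b : C) := a * b ^+ 2 * (a + 2 * b).
Definition rem3 (a b : C) := a * b ^+ 2 * (a ^+ 2 + (2 * (a * b) + 3 * b ^+ 2)).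
Definition rem4 (a b : C) :=
  a * b ^+ 2 * (a ^+ 3 + (2 * (a ^+ 2 * b) + (3 * (a * b ^+ 2) + 4 * b ^+ 3))).

Lemma rem2E (x h : C) : x != 0 -> x + h != 0 ->
  ((x + h) ^+ 2)^-1 = (x ^+ 2)^-1 + h * (- 2 * (x ^+ 3)^-1) +
    h ^+ 2 * rem2 (x + h)^-1 x^-1.
Proof. by move=> x0 xh0; rewrite /rem2; field; rewrite x0 xh0. Qed.

Lemma rem3E (x h : C) : x != 0 -> x + h != 0 ->
  ((x + h) ^+ 3)^-1 = (x ^+ 3)^-1 + h * (- 3 * (x ^+ 4)^-1) +
    h ^+ 2 * rem3 (x + h)^-1 x^-1.
Proof. by move=> x0 xh0; rewrite /rem3; field; rewrite x0 xh0. Qed.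

Lemma rem4E (x h : C) : x != 0 -> x + h != 0 ->
  ((x + h) ^+ 4)^-1 = (x ^+ 4)^-1 + h * (- 4 * (x ^+ 5)^-1) +
    h ^+ 2 * rem4 (x + h)^-1 x^-1.
Proof. by move=> x0 xh0; rewrite /rem4; field; rewrite x0 xh0. Qed.

Lemma rem2_le (a b : C) (u : R) : normc a <= u -> normc b <= u ->
  normc (rem2 a b) <= 3 * u ^+ 4.
Proof.
move=> au bu; rewrite (_ : 3 * u ^+ 4 = u * u ^+ 2 * (u + 2 * u)); last by ring.
normc_bound.
Qed.

Lemma rem3_le (a b : C) (u : R) : normc a <= u -> normc b <= u ->
  normc (rem3 a b) <= 6 * u ^+ 5.
Proof.
move=> au bu; rewrite (_ : 6 * u ^+ 5 =
  u * u ^+ 2 * (u ^+ 2 + (2 * (u * u) + 3 * u ^+ 2))); last by ring.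
normc_bound.
Qed.

Lemma rem4_le (a b : C) (u : R) : normc a <= u -> normc b <= u ->
  normc (rem4 a b) <= 10 * u ^+ 6.
Proof.
move=> au bu; rewrite (_ : 10 * u ^+ 6 = u * u ^+ 2 *
  (u ^+ 3 + (2 * (u ^+ 2 * u) + (3 * (u * u ^+ 2) + 4 * u ^+ 3)))); last by ring.
normc_bound.
Qed.

Hypothesis hw : real_independent w1 w2.

Lemma lat_neq0 c : c != 0 -> lat c != 0.
Proof.
move=> c0; apply: contra_neq c0 => H.
by apply: (lat_inj hw); rewrite H lat0.
Qed.

Lemma regular_neq0 z c : regular z -> c != 0 -> z - lat c != 0.
Proof. by move=> rz; apply: contra_neq => /subr0_eq/rz. Qed.

Lemma eis_dominated k z : (3 <= k)%N -> regular z ->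
  exists K, dominated K (fun c => ((z - lat c) ^+ k)^-1).
Proof.
move=> k3 /(regular_dist hw)[q q0 qP]; exists (q^-1 ^+ k) => c c0.
rewrite -(exprVn (z - lat c)); apply: inv_bounded_expr => //; exact/inv_boundedP/qP.
Qed.

Lemma lat_dominated k : (3 <= k)%N ->
  exists K, dominated K (fun c => (lat c ^+ k)^-1).
Proof.
move=> k3; have [K dK] := eis_dominated k3 (regular0 hw).
exists K => c /dK; rewrite sub0r -!exprVn invrN !normcX normcN.
by [].
Qed.

(** Each of the two squares decays only quadratically. With a = 1 / (z - w) and b = 1 / w one has a
    + b = z a b, so the difference a^2 - b^2 = z a b (a - b) gains one degree. *)
Lemma wpreg_dominated z : regular z ->
  exists K, dominated K (fun c => ((z - lat c) ^+ 2)^-1 - (lat c ^+ 2)^-1).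
Proof.
move=> rz; have [q q0 qP] := regular_dist hw rz; have [p p0 pP] := lat_bound hw.
pose m := Num.min p q; have m0 : 0 < m by rewrite lt_min p0.
exists (normc z * 2 * m^-1 ^+ 3) => c c0.
have z0 := regular_neq0 rz c0; have l0 := lat_neq0 c0.
pose a := (z - lat c)^-1; pose b := (lat c)^-1.
have -> : ((z - lat c) ^+ 2)^-1 - (lat c ^+ 2)^-1 = z * (a * b * (a - b)).
  by rewrite /a /b; field; rewrite z0 l0.
have s1 := @supn_ge1 R _ c0.
have aB : inv_bounded m a c.
  apply: inv_boundedP => //; apply: le_trans (qP _ c0).
  by rewrite ler_wpM2r// ge_min lexx orbT.
have bB : inv_bounded m b c.
  apply: inv_boundedP => //; apply: le_trans (pP _ c0).
  by rewrite ler_wpM2r// ge_min lexx.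
rewrite normcM; have -> (x y u : R) : x * 2 * y / u = x * (2 * (y / u)) by ring.
rewrite ler_wpM2l ?normc_ge0//.
apply: (@le_trans _ _ (2 * (m * (supn c)%:R)^-1 ^+ 3)); last first.
  by rewrite ler_wpM2l//; exact: pow_bound.
rewrite /inv_bounded in aB bB; set u := (m * _)^-1 in aB bB *.
rewrite (_ : 2 * u ^+ 3 = u * u * (u + u)); last by ring.
by normc_bound; rewrite normcN.
Qed.

Lemma regular_inv z : regular z -> exists k d : R, [/\ 0 < k, 0 < d &
  forall h c, normc h <= d -> c != 0 ->
   [/\ z - lat c != 0, z - lat c + h != 0,
      normc (z - lat c + h)^-1 <= (k * (supn c)%:R)^-1 &
      normc (z - lat c)^-1 <= (k * (supn c)%:R)^-1]].
Proof.
move=> rz; have [k [d [k0 d0 H]]] := regular_near hw rz.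
exists k, d; split => // h c hd c0; have [+ h2] := H h c hd c0.
rewrite addrAC => h1; split; [exact: regular_neq0| |exact: inv_boundedP|exact: inv_boundedP].
rewrite -normc_gt0 (lt_le_trans _ h1)// mulr_gt0// (lt_le_trans _ (supn_ge1 c0))//.
Qed.

Lemma wpreg_cder z : regular z -> cder wpreg z (- 2 * eis 3 z).
Proof.
move=> rz; have [k [d [k0 d0 H]]] := regular_inv rz.
have [K0 D0] := wpreg_dominated rz; have [K1 D1] := @eis_dominated 3 z isT rz.
rewrite -(csumZ _ D1).
apply: (cder_csum (e := fun h c => rem2 (z - lat c + h)^-1 (z - lat c)^-1)
   (K2 := 3 * k^-1 ^+ 4) d0 D0 (dominatedZ _ D1)) => [h hd c c0|h c hd c0].
  have [_ _ h1 h2] := H h c hd c0; apply: le_trans (rem2_le h1 h2) _.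
  by rewrite -mulrA ler_wpM2l//; exact: pow_bound.
have [x0 xh0 _ _] := H h c hd c0.
by rewrite (addrAC z) (rem2E x0 xh0); ring.
Qed.

Lemma eis3_cder z : regular z -> cder (eis 3) z (- 3 * eis 4 z).
Proof.
move=> rz; have [k [d [k0 d0 H]]] := regular_inv rz.
have [K0 D0] := @eis_dominated 3 z isT rz; have [K1 D1] := @eis_dominated 4 z isT rz.
rewrite -(csumZ _ D1).
apply: (cder_csum (e := fun h c => rem3 (z - lat c + h)^-1 (z - lat c)^-1)
   (K2 := 6 * k^-1 ^+ 5) d0 D0 (dominatedZ _ D1)) => [h hd c c0|h c hd c0].
  have [_ _ h1 h2] := H h c hd c0; apply: le_trans (rem3_le h1 h2) _.
  by rewrite -mulrA ler_wpM2l//; exact: pow_bound.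
by have [x0 xh0 _ _] := H h c hd c0; rewrite (addrAC z) (rem3E x0 xh0).
Qed.

Lemma eis4_cder z : regular z -> cder (eis 4) z (- 4 * eis 5 z).
Proof.
move=> rz; have [k [d [k0 d0 H]]] := regular_inv rz.
have [K0 D0] := @eis_dominated 4 z isT rz; have [K1 D1] := @eis_dominated 5 z isT rz.
rewrite -(csumZ _ D1).
apply: (cder_csum (e := fun h c => rem4 (z - lat c + h)^-1 (z - lat c)^-1)
   (K2 := 10 * k^-1 ^+ 6) d0 D0 (dominatedZ _ D1)) => [h hd c c0|h c hd c0].
  have [_ _ h1 h2] := H h c hd c0; apply: le_trans (rem4_le h1 h2) _.
  by rewrite -mulrA ler_wpM2l//; exact: pow_bound.
by have [x0 xh0 _ _] := H h c hd c0; rewrite (addrAC z) (rem4E x0 xh0).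
Qed.

Lemma wpregN z : wpreg (- z) = wpreg z.
Proof.
rewrite /wpreg csumN; apply: eq_csum => c _.
by rewrite latN -opprD !sqrrN.
Qed.

Definition wp z : C := (z ^+ 2)^-1 + wpreg z.

(* wp' = -2 epole 3. *)
Definition epole k z : C := (z ^+ k)^-1 + eis k z.

Lemma inv_pow_cder k z : z != 0 ->
  cder (fun x => (x ^+ k.+1)^-1) z (- k.+1%:R * (z ^+ k.+2)^-1).
Proof.
move=> z0; have h := cderX k (@cder_id R z).
have zk : z ^+ k.+1 != 0 by rewrite expf_neq0.
apply: cder_eq (cderV (f := fun x => x ^+ k.+1) zk h) _.
by rewrite mulr1 !exprS; field; rewrite expf_neq0// z0.
Qed.

Lemma wp_cder z : z != 0 -> regular z -> cder wp z (- 2 * epole 3 z).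
Proof.
move=> z0 rz; apply: cder_eq (cderD (inv_pow_cder 1 z0) (wpreg_cder rz)) _.
by rewrite -mulrDr.
Qed.

Lemma epole3_cder z : z != 0 -> regular z -> cder (epole 3) z (- 3 * epole 4 z).
Proof.
move=> z0 rz; apply: cder_eq (cderD (inv_pow_cder 2 z0) (eis3_cder rz)) _.
by rewrite -mulrDr.
Qed.

Lemma epole4_cder z : z != 0 -> regular z -> cder (epole 4) z (- 4 * epole 5 z).
Proof.
move=> z0 rz; apply: cder_eq (cderD (inv_pow_cder 3 z0) (eis4_cder rz)) _.
by rewrite -mulrDr.
Qed.

Lemma epoleN3 z : regular z -> epole 3 (- z) = - epole 3 z.
Proof.
move=> rz; have [K D] := @eis_dominated 3 z isT rz.
rewrite /epole opprD; congr (_ + _); first by rewrite exprNn -signr_odd expr1 mulN1r invrN.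
rewrite -[RHS]mulN1r /eis -(csumZ _ D) csumN; apply: eq_csum => c _.
by rewrite latN -opprD exprNn -signr_odd expr1 mulN1r invrN mulN1r.
Qed.

Lemma wpN z : wp (- z) = wp z.
Proof. by rewrite /wp wpregN sqrrN. Qed.

End Eisenstein.

(** * The differential equation of the Weierstrass function *)

Section BoxShift.
Context {R : realType}.
Local Notation C := R[i].
Local Notation idx := (int * int)%type.
Implicit Types (c a : idx) (F : idx -> C).

Definition fsum F N : C := \sum_(c <- box N) F c.

Lemma fsumE F N : fsum F N = F 0 + bsum F N.
Proof.
rewrite /fsum (bigD1_seq 0) ?box_uniq// mem_box /supn /=; lia.
Qed.

(** The weight i + 1 in place of i makes room for the index 0, which [box_sum_le] leaves out. *)
Lemma box_sum_le0 M (P : pred idx) (F : idx -> R) (g : nat -> R) :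
  (forall i, 0 <= g i) -> (forall c, (supn c <= M)%N -> P c -> F c <= g (supn c)) ->
  \sum_(c <- box M | P c) F c <= \sum_(0 <= i < M.+1) 12 * i.+1%:R * g i.
Proof.
move=> g0 H.
apply: (@le_trans _ _ (\sum_(c <- box M | P c) g (supn c))).
  rewrite big_seq_cond [leRHS]big_seq_cond; apply: ler_sum => c /andP[].
  by rewrite mem_box => /H h /h.
apply: (@le_trans _ _ (\sum_(c <- box M) g (supn c))).
  by rewrite big_mkcond; apply: ler_sum => c _; case: ifP.
rewrite (bigD1_seq 0) ?box_uniq ?mem_box//= big_ltn// lerD//.
  by rewrite mulr1 ler_peMl// ler1n.
apply: (@le_trans _ _ (\sum_(1 <= i < M.+1) 12 * i%:R * g i)).
  rewrite big_seq_cond; apply: box_sum_le => // c.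
  by rewrite mem_box -supn_eq0 -lt0n => /andP[-> ->].
by apply: ler_sum => i _; rewrite ler_wpM2r// ler_wpM2l// ler_nat.
Qed.

Lemma xor_region N a c : (supn a <= N)%N -> (supn c <= N)%N (+) (supn (c + a)%R <= N)%N ->
  (N - supn a < supn c <= N + supn a)%N.
Proof.
move=> aN; have h1 := supnD c a; have h2 := supnD (c + a) (- a).
rewrite addrK supnN in h2; move: (supn c) (supn (c + a)) h1 h2 => x y h1 h2.
case: (leqP x N) => p; case: (leqP y N) => q //= _; apply/andP; split; lia.
Qed.

Lemma sumB_xor M (X Y : pred idx) F :
  normc (\sum_(c <- box M | X c) F c - \sum_(c <- box M | Y c) F c) <=
  \sum_(c <- box M | X c (+) Y c) normc (F c).
Proof.
rewrite big_mkcond [X in _ - X]big_mkcond [leRHS]big_mkcond /= -sumrB.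
apply: le_trans (ler_normc_sum _ _ _) _; apply: ler_sum => c _.
by case: (X c) (Y c) => [] []; rewrite ?subrr ?subr0 ?sub0r ?normcN ?normc0.
Qed.

(** Only the indices in exactly one of the box and its translate survive. They fill at most 2
    [supn a] shells around radius N, and the shell of radius i contributes at most 12 B / i. Under
    quadratic decay the series need not converge absolutely, so reindexing rests on this boundary
    estimate. *)
Lemma box_shift_le N a F (B : R) : (supn a <= N)%N ->
  (forall c, c != 0 -> normc (F c) <= B / (supn c)%:R ^+ 2) ->
  normc (\sum_(c <- box (N + supn a) | (supn c <= N)%N) F c -
         \sum_(c <- box (N + supn a) | (supn (c + a)%R <= N)%N) F c) <=
  24 * B * (supn a)%:R / (N - supn a).+1%:R.
Proof.
move=> aN H; have B0 : 0 <= B.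
  by have := H (1, 0) isT; rewrite /supn /= expr1n divr1; apply: le_trans; exact: normc_ge0.
apply: le_trans (sumB_xor _ _ _ _) _.
apply: (@le_trans _ _ (\sum_((N - supn a).+1 <= i < (N + supn a).+1)
   12 * i%:R * (B / i%:R ^+ 2))).
  apply: box_sum_le => [i|c]; first by rewrite divr_ge0 ?exprn_ge0.
  move=> /(xor_region aN) h; split => //; apply: H; rewrite -supn_eq0.
  by case/andP: h; case: (supn c).
apply: (@le_trans _ _ (\sum_((N - supn a).+1 <= i < (N + supn a).+1)
   12 * B / (N - supn a).+1%:R)).
  rewrite big_nat_cond [leRHS]big_nat_cond; apply: ler_sum => i /andP[/andP[h _] _].
  have i0 : 0 < i%:R :> R by rewrite ltr0n (leq_trans _ h).
  have -> : 12 * i%:R * (B / i%:R ^+ 2) = 12 * B / i%:R :> R.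
    by field; rewrite gt_eqF.
  by rewrite ler_wpM2l ?mulr_ge0// lef_pV2 ?posrE// ler_nat.
rewrite sumr_const_nat -[_ *+ (_ - _)]mulr_natr subSS.
have -> : (N + supn a - (N - supn a))%N = (2 * supn a)%N by lia.
by rewrite natrM le_eqVlt; apply/orP; left; apply/eqP; ring.
Qed.

(** With cubic decay the shells themselves form a convergent sum, and the factor [supn a]
    disappears. That gain compensates for the slower weight (z - w)^-2 in [conv_symmetrized]. *)
Lemma box_shift_le3 N a F (B : R) : (supn a <= N)%N ->
  (forall c, c != 0 -> normc (F c) <= B / (supn c)%:R ^+ 3) ->
  normc (\sum_(c <- box (N + supn a) | (supn c <= N)%N) F c -
         \sum_(c <- box (N + supn a) | (supn (c + a)%R <= N)%N) F c) <=
  24 * B / (N - supn a).+1%:R.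
Proof.
move=> aN H; have B0 : 0 <= B by exact: dominated_ge0 H.
apply: le_trans (sumB_xor _ _ _ _) _.
apply: (@le_trans _ _ (\sum_((N - supn a).+1 <= i < (N + supn a).+1)
   12 * i%:R * (B / i%:R ^+ 3))).
  apply: box_sum_le => [i|c]; first by rewrite divr_ge0 ?exprn_ge0.
  move=> /(xor_region aN) h; split => //; apply: H; rewrite -supn_eq0.
  by case/andP: h; case: (supn c).
rewrite (_ : 24 * B / _ = 12 * B * (2 / (N - supn a).+1%:R)); last by ring.
apply: le_trans (ler_wpM2l _ (@sum_inv_sqr_le R _ (N + supn a))); last by rewrite mulr_ge0.
rewrite mulr_sumr big_nat_cond [leRHS]big_nat_cond; apply: ler_sum => i /andP[/andP[h _] _].
have i0 : i%:R != 0 :> R by rewrite pnatr_eq0 -lt0n (leq_trans _ h).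
by rewrite le_eqVlt; apply/orP; left; apply/eqP; field.
Qed.

Lemma box_mem_cond N (P : pred idx) F :
  \sum_(c <- box N | P c) F c = \sum_(c <- box N | P c && (supn c <= N)%N) F c.
Proof.
rewrite big_seq_cond [RHS]big_seq_cond; apply: eq_bigl => c.
by rewrite mem_box; case: (supn c <= N)%N; rewrite ?andbF ?andbT.
Qed.

Lemma box_widen N M (P : pred idx) F : (N <= M)%N ->
  \sum_(c <- box N | P c) F c = \sum_(c <- box M | P c && (supn c <= N)%N) F c.
Proof.
by move=> NM; rewrite box_mem_cond (@box_sum_sub _ N M)// => c /andP[].
Qed.

Lemma box_translate N a (P : pred idx) F :
  \sum_(c <- box N | P c) F c =
  \sum_(c <- box (N + supn a) | P (c + a) && (supn (c + a)%R <= N)%N) F (c + a).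
Proof.
rewrite box_mem_cond.
by rewrite (@box_sum_shift _ N (N + supn a) a)// => c /andP[].
Qed.

(* The diagonal convolution sum_(i + j = N) 1 / ((i+1) (j+1)) equals
   2 H_(N+1) / (N + 2), a Cesaro mean of the harmonic sequence. *)
Lemma harmonic_convolution_cvg :
  (fun N : nat => \sum_(0 <= i < N.+1) (i.+1%:R * (N - i).+1%:R)^-1) @ \oo --> (0 : R).
Proof.
have h0 := @cvg_harmonic R.
have h := cesaro h0.
have h2 : (fun n => 2 * arithmetic_mean harmonic n) @ \oo --> (2 * 0 : R).
  by apply: cvgM => //; exact: cvg_cst.
rewrite mulr0 in h2.
apply: (@squeeze_cvgr _ _ _ _ (cst 0)) (@cvg_cst _ _ _ _ _) h2.
near=> N; apply/andP; split; first by apply: sumr_ge0 => i _; rewrite invr_ge0 mulr_ge0.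
have -> : \sum_(0 <= i < N.+1) (i.+1%:R * (N - i).+1%:R)^-1 =
   (N.+2%:R)^-1 * (\sum_(0 <= i < N.+1) (i.+1%:R)^-1 + \sum_(0 <= i < N.+1) ((N - i).+1%:R)^-1) :> R.
  rewrite -big_split mulr_sumr big_nat_cond [RHS]big_nat_cond.
  apply: eq_bigr => i /andP[/andP[_ iN] _].
  have -> : N.+2%:R = i.+1%:R + (N - i).+1%:R :> R by rewrite -natrD; congr _%:R; lia.
  have : 0 < i.+1%:R :> R by []. have : 0 < (N - i).+1%:R :> R by [].
  move: (i.+1%:R : R) ((N - i).+1%:R : R) => x y y0 x0.
  by rewrite /=; field; rewrite !gt_eqF ?addr_gt0.
have -> : \sum_(0 <= i < N.+1) ((N - i).+1%:R)^-1 = \sum_(0 <= i < N.+1) (i.+1%:R)^-1 :> R.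
  by rewrite big_nat_rev /= big_nat_cond [RHS]big_nat_cond; apply: eq_bigr => i
    /andP[/andP[_ iN] _]; congr (_%:R^-1); lia.
rewrite /arithmetic_mean /= /series /= -mulr2n -[X in _ * X]mulr_natl mulrCA ler_wpM2l//.
rewrite mulrC [leRHS]mulrC ler_wpM2l ?sumr_ge0//.
by rewrite lef_pV2 ?posrE// ler_nat.
Unshelve. all: by end_near. Qed.

End BoxShift.

(** * The third-order equation of the Weierstrass function *)

Section WeierstrassIdentity.
Context {R : realType} (w1 w2 : R[i]).
Local Notation C := R[i].
Local Notation idx := (int * int)%type.
Local Notation lat := (lat w1 w2).
Local Notation regular := (regular w1 w2).
Local Notation wp := (wp w1 w2).
Local Notation epole := (epole w1 w2).
Implicit Types (a b c : idx) (z : C).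

Hypothesis hw : real_independent w1 w2.

(** The successor makes the bound meaningful at c = 0 too, where the distance is |z|. *)
Lemma offlattice_dist z : z != 0 -> regular z -> exists2 k : R, 0 < k &
  forall c, k * (supn c).+1%:R <= normc (z - lat c).
Proof.
move=> z0 rz; have [k k0 kP] := regular_dist hw rz.
have nz : 0 < normc z by rewrite normc_gt0.
exists (Num.min (normc z) (k / 2)); first by rewrite lt_min nz divr_gt0.
move=> c; have [->|c0] := eqVneq c 0.
  by rewrite lat0 subr0 /supn /= mulr1 ge_min lexx.
apply: le_trans (kP _ c0); apply: (@le_trans _ _ (k / 2 * (supn c).+1%:R)).
  by rewrite ler_wpM2r// ge_min lexx orbT.
have s1 := @supn_ge1 R _ c0; rewrite -[(supn c).+1%:R]natr1 -mulrA ler_wpM2l ?(ltW k0)//.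
by move: ((supn c)%:R : R) s1 => s s1; lra.
Qed.

Lemma offlattice_neq0 z c : z != 0 -> regular z -> z - lat c != 0.
Proof.
by move=> z0 rz; apply: contra_neq z0 => /subr0_eq h; rewrite h (rz _ h) lat0.
Qed.

(** The two parts of [wp], neither of which converges absolutely, are kept apart so that the first
    can be multiplied and translated on its own. *)
Definition wpbox z N : C :=
  fsum (fun c => ((z - lat c) ^+ 2)^-1) N - bsum (fun c => (lat c ^+ 2)^-1) N.

Lemma wpbox_cvg z : regular z -> ccvg (wpbox z) (wp z).
Proof.
move=> rz; have [K D] := wpreg_dominated hw rz.
apply: ccvg_eq (ccvgD (ccvg_cst ((z ^+ 2)^-1)) (dominated_cvg D)) => N.
by rewrite /wpbox fsumE lat0 subr0 -addrA /bsum sumrB.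
Qed.

Lemma epole_cvg k z : (3 <= k)%N -> regular z ->
  ccvg (fsum (fun c => ((z - lat c) ^+ k)^-1)) (epole k z).
Proof.
move=> k3 rz; have [K D] := eis_dominated hw k3 rz.
apply: ccvg_eq (ccvgD (ccvg_cst ((z ^+ k)^-1)) (dominated_cvg D)) => N.
by rewrite fsumE lat0 subr0.
Qed.

Section Convolution.
Context (z : C).
Hypotheses (z0 : z != 0) (rz : regular z).
Local Notation p c := (z - lat c).

Let p_neq0 c : p c != 0.
Proof. exact: offlattice_neq0. Qed.

Let r_neq0 a b : b != a -> lat b - lat a != 0.
Proof. by move=> ba; rewrite -latB (lat_neq0 hw)// subr_eq0. Qed.

(** The off-diagonal product of the sums of weights 3 and 2. The subtracted (lat b - lat a)^-2 is
    chosen so that symmetrizing in a and b collapses the summand by partial fractions. *)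
Definition conv N : C := \sum_(a <- box N) \sum_(b <- box N | b != a)
  (p a ^+ 3)^-1 * ((p b ^+ 2)^-1 - ((lat b - lat a) ^+ 2)^-1).

Definition shifted_sum (k N : nat) a : C :=
  \sum_(b <- box N | b != a) ((lat b - lat a) ^+ k)^-1.

(** The missing diagonal accounts for the sum of weight 5. The last sum is the error made in
    replacing inverse squares centred at a by those centred at 0. *)
Lemma conv_expand N : conv N =
  fsum (fun c => (p c ^+ 3)^-1) N * wpbox z N - fsum (fun c => (p c ^+ 5)^-1) N +
  \sum_(a <- box N) (p a ^+ 3)^-1 *
    (bsum (fun c => (lat c ^+ 2)^-1) N - shifted_sum 2 N a).
Proof.
rewrite /fsum mulr_suml -sumrB -big_split /= /conv.
rewrite big_seq [RHS]big_seq; apply: eq_bigr => a aN.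
rewrite -mulr_sumr sumrB -/(shifted_sum 2 N a).
have -> : \sum_(b <- box N | b != a) (p b ^+ 2)^-1 =
    fsum (fun c => (p c ^+ 2)^-1) N - (p a ^+ 2)^-1.
  by rewrite /fsum [in RHS](bigD1_seq a) ?box_uniq//= addrAC subrr add0r.
by rewrite /wpbox; field; exact: p_neq0.
Qed.

Lemma pair_swap N (F : idx -> idx -> C) :
  \sum_(a <- box N) \sum_(b <- box N | b != a) F a b =
  \sum_(a <- box N) \sum_(b <- box N | b != a) F b a.
Proof.
rewrite (exchange_big_dep xpredT)//=; apply: eq_bigr => a _.
by apply: eq_bigl => b; rewrite eq_sym.
Qed.

(** With x = z - lat a and y = z - lat b, so that x - y = lat b - lat a, the identity is x^-3 (y^-2
    - (x - y)^-2) + y^-3 (x^-2 - (x - y)^-2) = (x - y)^-3 (x^-2 - y^-2). Summing over both orders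
    counts everything twice. *)
Lemma conv_symmetrized N :
  conv N = - \sum_(b <- box N) (p b ^+ 2)^-1 *
    \sum_(a <- box N | a != b) ((lat b - lat a) ^+ 3)^-1.
Proof.
pose Y : C := \sum_(a <- box N) \sum_(b <- box N | b != a)
  ((lat b - lat a) ^+ 3)^-1 * (p b ^+ 2)^-1.
have EY : \sum_(b <- box N) (p b ^+ 2)^-1 *
    \sum_(a <- box N | a != b) ((lat b - lat a) ^+ 3)^-1 = Y.
  rewrite /Y pair_swap; apply: eq_bigr => b _; rewrite mulr_sumr.
  by apply: eq_bigr => a _; rewrite mulrC.
rewrite EY; suff : conv N + conv N = - Y - Y.
  move=> E; have n2 : (2 : C) != 0 by rewrite pnatr_eq0.
  by apply: (mulfI n2); rewrite !mulr_natl !mulr2n.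
rewrite {2}/conv pair_swap /conv -big_split /=.
have -> : - Y - Y = \sum_(a <- box N) \sum_(b <- box N | b != a)
   (- ((lat b - lat a) ^+ 3)^-1 * (p b ^+ 2)^-1 - ((lat a - lat b) ^+ 3)^-1 * (p a ^+ 2)^-1).
  rewrite {2}/Y pair_swap /Y -!sumrN -big_split /=; apply: eq_bigr => a _.
  by rewrite -!sumrN -big_split /=; apply: eq_bigr => b _; rewrite mulNr.
apply: eq_bigr => a _; rewrite -big_split /=; apply: eq_bigr => b ba.
have h1 := p_neq0 a; have h2 := p_neq0 b; have h3 := r_neq0 ba.
have E1 : lat b - lat a = p a - p b by ring.
have -> : lat a - lat b = - (p a - p b) by ring.
move: h3; rewrite E1; move: (p a) (p b) h1 h2 => x y h1 h2 h3.
rewrite sqrrN exprNn -signr_odd expr1 mulN1r invrN.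
by field; rewrite h1 h2 h3.
Qed.

Lemma shifted_sum2_le : exists2 B : R, 0 <= B & forall N a, (supn a <= N)%N ->
  normc (bsum (fun c => (lat c ^+ 2)^-1) N - shifted_sum 2 N a) <=
  B * (supn a)%:R / (N - supn a).+1%:R.
Proof.
have [k k0 kP] := lat_bound hw; exists (24 * k^-1 ^+ 2).
  by rewrite mulr_ge0// exprn_ge0// invr_ge0 ltW.
move=> N a aN.
pose F c := if c == 0 then 0 else (lat c ^+ 2)^-1.
have FB c : c != 0 -> normc (F c) <= k^-1 ^+ 2 / (supn c)%:R ^+ 2.
  move=> c0; rewrite /F (negbTE c0) -(exprVn (lat c)) normcX.
  rewrite -(exprVn (supn c)%:R) -exprMn -invfM.
  have h := inv_boundedP k0 c0 (kP _ c0); apply: lerXn2r => //.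
    by rewrite nnegrE normc_ge0.
  by rewrite nnegrE (le_trans _ h)// normc_ge0.
apply: le_trans (box_shift_le aN FB); rewrite le_eqVlt; apply/orP; left.
apply/eqP; congr (normc (_ - _)).
  rewrite /bsum (box_widen _ _ (leq_addr (supn a) N)) big_mkcond [RHS]big_mkcond.
  by apply: eq_bigr => c _; rewrite /F; case: eqP => //=; case: ifP.
rewrite /shifted_sum (box_translate N a) big_mkcond [RHS]big_mkcond.
apply: eq_bigr => c _; rewrite latD addrK /F.
have -> : (c + a == a) = (c == 0) by rewrite -subr_eq0 addrK.
by case: eqP => //=; case: ifP.
Qed.

(** An odd function sums to 0 over a box centred at the origin; what is left is the boundary
    discrepancy of the translated box. *)
Lemma shifted_sum3_le : exists2 B : R, 0 <= B & forall N a, (supn a <= N)%N ->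
  normc (\sum_(c <- box N | c != a) ((lat a - lat c) ^+ 3)^-1) <=
  B / (N - supn a).+1%:R.
Proof.
have [k k0 kP] := lat_bound hw; exists (24 * k^-1 ^+ 3).
  by rewrite mulr_ge0// exprn_ge0// invr_ge0 ltW.
move=> N a aN.
pose F c := if c == 0 then 0 else (lat c ^+ 3)^-1.
have FN c : F (- c) = - F c.
  rewrite /F oppr_eq0; case: eqP; rewrite ?oppr0// latN.
  by rewrite exprNn -signr_odd expr1 mulN1r invrN.
have FB c : c != 0 -> normc (F c) <= k^-1 ^+ 3 / (supn c)%:R ^+ 3.
  move=> c0; rewrite /F (negbTE c0) -(exprVn (lat c)).
  by apply: inv_bounded_expr => //; exact: (inv_boundedP k0 c0 (kP _ c0)).
apply: le_trans (box_shift_le3 aN FB); rewrite le_eqVlt; apply/orP; left.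
have -> : \sum_(c <- box (N + supn a) | (supn c <= N)%N) F c = 0.
  set s := LHS; have : s = - s.
    rewrite /s {1}box_sumN -sumrN; apply: eq_big => c; first by rewrite supnN.
    by rewrite FN.
  move=> h; have := mulrn_eq0 s 2.
  by rewrite mulr2n {1}h addNr eqxx /= => /esym/eqP.
apply/eqP; rewrite sub0r (box_translate N a) -sumrN; congr normc.
rewrite big_mkcond [RHS]big_mkcond; apply: eq_bigr => c _.
have -> : (c + a == a) = (c == 0) by rewrite -subr_eq0 addrK.
rewrite latD opprD addrCA subrr addr0 -latN -FN /F oppr_eq0.
by case: eqP => //=; case: ifP.
Qed.

(** Grouped by i = [supn a], there are at most 12 (i + 1) terms of size (i + 1)^-j (i + 1)^(j - 2) /
    (N - i + 1). The power of i + 1 left is -1 for every j, which gives the harmonic convolution. *)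
Lemma convolution_error (e : idx -> nat -> C) (B k : R) j : (2 <= j)%N ->
  0 <= B -> 0 < k -> (forall c, k * (supn c).+1%:R <= normc (p c)) ->
  (forall N a, (supn a <= N)%N -> normc (e a N) <=
     B * (supn a).+1%:R ^+ (j - 2) / (N - supn a).+1%:R) ->
  ccvg (fun N => \sum_(a <- box N) (p a ^+ j)^-1 * e a N) 0.
Proof.
move=> j2 B0 k0 kP eB; pose D := 12 * (k^-1 ^+ j * B).
have h : (fun N : nat => D * \sum_(0 <= i < N.+1) (i.+1%:R * (N - i).+1%:R)^-1)
    @ \oo --> (0 : R).
  rewrite -[X in _ --> X](mulr0 D); apply: cvgM; first exact: cvg_cst.
  exact: harmonic_convolution_cvg.
apply: ccvg_norm_le h; apply: nearW => N; rewrite subr0; apply: le_trans (ler_normc_sum _ _ _) _.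
pose g i := k^-1 ^+ j * B * (i.+1%:R ^+ 2 * (N - i).+1%:R)^-1.
have kj0 : 0 <= k^-1 ^+ j by rewrite exprn_ge0// invr_ge0 ltW.
apply: (@le_trans _ _ (\sum_(0 <= i < N.+1) 12 * i.+1%:R * g i)).
  apply: box_sum_le0 => [i|c cN _].
    by rewrite /g !mulr_ge0 ?invr_ge0 ?mulr_ge0 ?exprn_ge0 ?invr_ge0 ?(ltW k0).
  rewrite normcM -exprVn normcX normcV.
  have s0 : 0 < (supn c).+1%:R :> R by [].
  have h1 : (normc (p c))^-1 ^+ j <= (k * (supn c).+1%:R)^-1 ^+ j.
    have ks : 0 < k * (supn c).+1%:R by rewrite mulr_gt0.
    have pc : 0 < normc (p c) by rewrite normc_gt0.
    by rewrite lerXn2r ?nnegrE ?invr_ge0 ?(ltW ks) ?(ltW pc)// lef_pV2.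
  apply: le_trans (ler_pM _ _ h1 (eB _ _ cN)) _; rewrite ?exprn_ge0 ?invr_ge0 ?normc_ge0//.
  rewrite /g le_eqVlt; apply/orP; left; apply/eqP.
  have sn : (supn c).+1%:R != 0 :> R by rewrite gt_eqF.
  have mn : (N - supn c).+1%:R != 0 :> R by rewrite pnatr_eq0.
  have kn : k ^+ j != 0 by rewrite expf_neq0// gt_eqF.
  have tn : (supn c).+1%:R ^+ (j - 2) != 0 :> R by rewrite expf_neq0.
  have E : (supn c).+1%:R ^+ j = (supn c).+1%:R ^+ (j - 2) * (supn c).+1%:R ^+ 2 :> R.
    by rewrite -exprD subnK.
  rewrite !exprVn exprMn E; move: (k ^+ j) (_ ^+ (j - 2)) kn tn sn mn.
  move: ((supn c).+1%:R : R) ((N - supn c).+1%:R : R) => u v x y x0 y0 u0 v0.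
  by field; rewrite x0 y0 u0 v0.
rewrite mulr_sumr; apply: ler_sum => i _; rewrite /g /D.
have sn : i.+1%:R != 0 :> R by rewrite pnatr_eq0.
have mn : (N - i).+1%:R != 0 :> R by rewrite pnatr_eq0.
move: (i.+1%:R : R) ((N - i).+1%:R : R) sn mn => x y x0 y0.
rewrite le_eqVlt; apply/orP; left; apply/eqP.
by move: (_ ^+ j) => t; field; rewrite x0 y0.
Qed.

(** Since wp' = -2 [epole 3] and wp''' = -24 [epole 5], this is wp''' = 12 wp wp'. Both expressions
    of [conv] are passed to the limit, and both error sums tend to 0. *)
Lemma epole5E : epole 5 z = wp z * epole 3 z.
Proof.
have [k k0 kP] := offlattice_dist z0 rz.
have [B2 B20 B2P] := shifted_sum2_le; have [B3 B30 B3P] := shifted_sum3_le.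
have h3 : ccvg (fun N => \sum_(a <- box N) (p a ^+ 3)^-1 *
    (bsum (fun c => (lat c ^+ 2)^-1) N - shifted_sum 2 N a)) 0.
  apply: (convolution_error (j := 3) isT B20 k0 kP) => N a aN.
  apply: le_trans (B2P _ _ aN) _; rewrite expr1 ler_wpM2r ?invr_ge0//.
  by rewrite ler_wpM2l// ler_nat.
have h2 : ccvg conv 0.
  have h : ccvg (fun N => \sum_(b <- box N) (p b ^+ 2)^-1 *
      \sum_(a <- box N | a != b) ((lat b - lat a) ^+ 3)^-1) 0.
    apply: (convolution_error (j := 2) isT B30 k0 kP) => N a aN.
    by rewrite expr0 mulr1; exact: B3P.
  have := ccvgM (ccvg_cst (-1)) h; rewrite mulr0; apply: ccvg_eq => N.
  by rewrite conv_symmetrized mulN1r.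
have hE := ccvgD (ccvgB (ccvgM (epole_cvg (k := 3) isT rz) (wpbox_cvg rz))
   (epole_cvg (k := 5) isT rz)) h3.
have := ccvg_unique h2 (ccvg_eq (fun N => esym (conv_expand N)) hE).
rewrite addr0 => /esym/eqP; rewrite subr_eq0 => /eqP <-.
by rewrite mulrC.
Qed.

End Convolution.
End WeierstrassIdentity.

(** * Derivatives of complex functions of a real parameter *)

Section PathDerivative.
Context {R : realType}.
Local Notation C := R[i].

Definition pder (Y : R -> C) (t : R) (v : C) : Prop :=
  forall eps : R, 0 < eps -> exists2 d : R, 0 < d & forall h : R, `|h| < d ->
    normc (Y (t + h) - Y t - h%:C * v) <= eps * `|h|.

Lemma is_derive_eps (g : R -> R) t v :
  (forall eps : R, 0 < eps -> exists2 d : R, 0 < d & forall h : R, `|h| < d ->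
    `|g (t + h) - g t - h * v| <= eps * `|h|) -> is_derive t (1 : R) g v.
Proof.
move=> H.
have L : h^-1 *: (g (h *: 1 + t) - g t) @[h --> 0^'] --> v.
  apply/cvgrPdist_le => /= eps eps0; have [d d0 dH] := H _ eps0.
  exists d => //= h /=; rewrite sub0r normrN => hd h0.
  have hn : 0 < `|h| by rewrite normr_gt0.
  have := dH _ hd; rewrite -[h *: 1]/(h * 1) mulr1 (addrC h) => dh.
  rewrite -[_ *: _]/(_ * _) (_ : v - _ = - (h^-1 * (g (t + h) - g t - h * v))); last by field.
  by rewrite normrN normrM normfV mulrC ler_pdivrMr.
apply: DeriveDef; first by apply/cvg_ex; exists v.
exact: cvg_lim L.
Qed.

Lemma eps_is_derive (g : R -> R) t v : is_derive t (1 : R) g v ->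
  (forall eps : R, 0 < eps -> exists2 d : R, 0 < d & forall h : R, `|h| < d ->
    `|g (t + h) - g t - h * v| <= eps * `|h|).
Proof.
move=> [/cvg_ex[w Hw] E] eps eps0.
have ew : w = v by rewrite -E; symmetry; exact: cvg_lim Hw.
move: Hw; rewrite ew => /cvgrPdist_le/(_ _ eps0)[d /= d0 dH]; exists d => // h hd.
have [->|h0] := eqVneq h 0; first by rewrite addr0 mul0r subrr subr0 normr0 mulr0.
have := dH h; rewrite /= sub0r normrN => /(_ hd h0).
have hn : 0 < `|h| by rewrite normr_gt0.
rewrite -[h *: 1]/(h * 1) mulr1 (addrC h) -[_ *: _]/(_ * _).
rewrite (_ : v - _ = - (h^-1 * (g (t + h) - g t - h * v))); last by field.
by rewrite normrN normrM normfV mulrC ler_pdivrMr.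
Qed.

Lemma pder_Re (Y : R -> C) t v : pder Y t v -> is_derive t (1 : R) (Re \o Y) (Re v).
Proof.
move=> H; apply: is_derive_eps => eps /H[d d0 dH]; exists d => // h /dH.
apply: le_trans; rewrite (_ : _ - _ = Re (Y (t + h) - Y t - h%:C * v)).
  exact: normc_Re.
by rewrite /= !ReB ReM /= mul0r subr0.
Qed.

Lemma pder_Im (Y : R -> C) t v : pder Y t v -> is_derive t (1 : R) (Im \o Y) (Im v).
Proof.
move=> H; apply: is_derive_eps => eps /H[d d0 dH]; exists d => // h /dH.
apply: le_trans; rewrite (_ : _ - _ = Im (Y (t + h) - Y t - h%:C * v)).
  exact: normc_Im.
by rewrite /= !ImB ImM /= mul0r addr0.
Qed.

Lemma pderP (Y : R -> C) t v : is_derive t (1 : R) (Re \o Y) (Re v) ->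
  is_derive t (1 : R) (Im \o Y) (Im v) -> pder Y t v.
Proof.
move=> /eps_is_derive hr /eps_is_derive hi eps eps0.
have e2 : 0 < eps / 2 by rewrite divr_gt0.
have [d d0 dH] := hr _ e2; have [d' d'0 dH'] := hi _ e2.
exists (Num.min d d'); first by rewrite lt_min d0.
move=> h; rewrite lt_min => /andP[/dH h1 /dH' h2].
apply: le_trans (normc_ReIm _) _; rewrite !ReB !ImB ReM ImM /= !mul0r subr0 addr0.
rewrite (_ : eps * `|h| = eps / 2 * `|h| + eps / 2 * `|h|); last by field.
exact: lerD.
Qed.

Lemma pderR (g : R -> R) t v : is_derive t (1 : R) g v ->
  pder (fun u => (g u)%:C) t v%:C.
Proof.
move=> h; apply: pderP.
have -> : Im \o (fun u => (g u)%:C) = cst 0 by apply/funext.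
exact: is_derive_cst.
Qed.

Lemma pder_cst (c : C) t : pder (fun=> c) t 0.
Proof.
by move=> eps e0; exists 1 => // h _; rewrite subrr mulr0 subr0 normc0 mulr_ge0// ltW.
Qed.

Lemma pderD (Y Y' : R -> C) t v v' : pder Y t v -> pder Y' t v' ->
  pder (fun u => Y u + Y' u) t (v + v').
Proof.
move=> hY hY' eps eps0; have e2 : 0 < eps / 2 by rewrite divr_gt0.
have [d d0 dH] := hY _ e2; have [d' d'0 dH'] := hY' _ e2.
exists (Num.min d d'); first by rewrite lt_min d0.
move=> h; rewrite lt_min => /andP[/dH h1 /dH' h2].
rewrite (_ : _ - _ = (Y (t + h) - Y t - h%:C * v) +
  (Y' (t + h) - Y' t - h%:C * v')); last by ring.
rewrite (_ : eps * `|h| = eps / 2 * `|h| + eps / 2 * `|h|); last by field.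
by apply: le_trans (ler_normcD _ _) _; exact: lerD.
Qed.

Lemma pder_line (z0 z : C) t : pder (fun u => z0 + u%:C * z) t z.
Proof.
move=> eps eps0; exists 1 => // h _.
rewrite (_ : _ - _ = 0); first by rewrite normc0 mulr_ge0// ltW.
by rewrite rmorphD /=; ring.
Qed.

Lemma pderZ (Y : R -> C) (c : C) t v : pder Y t v -> pder (fun u => c * Y u) t (c * v).
Proof.
move=> hY eps eps0; have n0 := @normc_ge0 R c.
have e2 : 0 < eps / (normc c + 1) by rewrite divr_gt0// ltr_wpDl.
have [d d0 dH] := hY _ e2; exists d => // h /dH h1.
rewrite (_ : _ - _ = c * (Y (t + h) - Y t - h%:C * v)); last by ring.
rewrite normcM; apply: le_trans (ler_wpM2l n0 h1) _.
rewrite mulrA ler_wpM2r// mulrCA ler_piMr ?(ltW eps0)//.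
by rewrite ler_pdivrMr ?mul1r ?lerDl// ltr_wpDl.
Qed.

Lemma pderB (Y Y' : R -> C) t v v' : pder Y t v -> pder Y' t v' ->
  pder (fun u => Y u - Y' u) t (v - v').
Proof.
move=> hY /(pderZ (-1)) hY'; have := pderD hY hY'; rewrite mulN1r.
by under eq_fun do rewrite mulN1r.
Qed.

Lemma pder_comp (f : C -> C) (Z : R -> C) t l v :
  pder Z t v -> cder f (Z t) l -> pder (f \o Z) t (l * v).
Proof.
move=> hZ /cder_bound[K [d [K0 d0 d1 H]]] eps eps0.
have N0 := @normc_ge0 R; pose B := normc v + 1.
have B0 : 0 < B by rewrite ltr_wpDl.
have nl : 0 < normc l + 1 by rewrite ltr_wpDl.
pose e1 := Num.min 1 (eps / 2 / (normc l + 1)).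
have e10 : 0 < e1 by rewrite lt_min ltr01 !divr_gt0.
have [d2 d20 dH] := hZ _ e10.
pose d3 := Num.min d2 (Num.min (d / B) (eps / 2 / (K * B ^+ 2))).
exists d3; first by rewrite !lt_min d20 !divr_gt0// mulr_gt0// exprn_gt0.
move=> h; rewrite !lt_min => /and3P[/dH h1]; rewrite !ltr_pdivlMr ?mulr_gt0 ?exprn_gt0//.
move=> h2 h3; pose D := Z (t + h) - Z t.
have DB : normc D <= B * `|h|.
  rewrite (_ : D = D - h%:C * v + h%:C * v); last by ring.
  apply: le_trans (ler_normcD _ _) _; rewrite normcM normcR /B mulrDl mul1r addrC mulrC.
  rewrite lerD2l; apply: le_trans h1 _.
  by rewrite ler_piMl// ge_min lexx.
have Dd : normc D <= d by apply: le_trans DB _; rewrite mulrC ltW.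
have [e He] := H _ Dd; rewrite {1}/D addrC subrK => E.
rewrite /= E (_ : _ - _ = l * (D - h%:C * v) + D ^+ 2 * e); last by ring.
rewrite (_ : eps * `|h| = eps / 2 * `|h| + eps / 2 * `|h|); last by field.
apply: le_trans (ler_normcD _ _) _; apply: lerD.
  rewrite normcM; apply: (@le_trans _ _ ((normc l + 1) * (e1 * `|h|))).
    by apply: ler_pM => //; rewrite lerDl.
  rewrite mulrA ler_wpM2r// mulrC -ler_pdivlMr// ge_min lexx orbT//.
rewrite normcM normcX; apply: (@le_trans _ _ ((B * `|h|) ^+ 2 * K)).
  by apply: ler_pM; rewrite ?exprn_ge0// lerXn2r ?nnegrE// mulr_ge0// ltW.
rewrite (_ : _ * K = `|h| * (K * B ^+ 2) * `|h|); last by ring.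
by apply: ler_wpM2r => //; rewrite ltW// ltr_pdivlMr.
Qed.

Lemma is_derive_itv_cst (g : R -> R) (a b : R) : a < b ->
  (forall x, a <= x <= b -> is_derive x (1 : R) g 0) -> g a = g b.
Proof.
move=> ab H.
have [||x _] := @MVT R g (fun=> 0) a b ab.
- by move=> x; rewrite in_itv /= => /andP[/ltW h1 /ltW h2]; apply: H; rewrite h1.
- apply: derivable_within_continuous => x; rewrite in_itv /= => xab.
  by have [] := H _ xab.
by rewrite mul0r => /eqP; rewrite subr_eq0 => /eqP.
Qed.

(** The derivative vanishes on the segment from 0, excluded, to z. The bound near 0 identifies the
    constant without involving the value of f at 0. *)
Lemma ray_constant (f : C -> C) (z l : C) (K : R) :
  (forall t : R, 0 < t <= 1 -> cder f (t%:C * z) 0) ->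
  (exists2 d : R, 0 < d & forall t, 0 < t < d ->
     normc (f (t%:C * z) - l) <= K * t) -> f z = l.
Proof.
move=> H [d d0 dH].
have cst t : 0 < t <= 1 -> f (t%:C * z) = f z.
  move=> /andP[t0]; rewrite le_eqVlt => /predU1P[->|t1]; first by rewrite mul1r.
  have P u : 0 < u <= 1 -> pder (fun u => f (u%:C * z)) u 0.
    move=> /H h; rewrite -(mul0r z).
    apply: (pder_comp (f := f) (Z := fun u => u%:C * z)) => //.
    by have := @pder_line 0 z u; under eq_fun do rewrite add0r.
  apply/eqP; rewrite -{2}(mul1r z) eq_complex; apply/andP; split; apply/eqP.
    apply: (is_derive_itv_cst (g := fun u => Re (f (u%:C * z))) t1) => x /andP[tx x1].
    by apply: (pder_Re (v := 0)); apply: P; rewrite x1 (lt_le_trans t0).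
  apply: (is_derive_itv_cst (g := fun u => Im (f (u%:C * z))) t1) => x /andP[tx x1].
  by apply: (pder_Im (v := 0)); apply: P; rewrite x1 (lt_le_trans t0).
apply/eqP; rewrite -subr_eq0 -normc_eq0 eq_le normc_ge0 andbT.
apply/ler_addgt0Pl => eps eps0; rewrite addr0.
pose K1 := `|K| + 1; have K10 : 0 < K1 by rewrite ltr_wpDl.
pose t := Num.min (Num.min 1 (d / 2)) (eps / K1).
have t0 : 0 < t by rewrite !lt_min ltr01 !divr_gt0.
have t1 : t <= 1 by rewrite !ge_min lexx.
have td : t < d.
  by apply: (@le_lt_trans _ _ (d / 2)); rewrite ?ge_min ?lexx ?orbT//; lra.
rewrite -(cst t) ?t0// (le_trans (dH t _)) ?t0//.
apply: (@le_trans _ _ (K1 * t)).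
  by rewrite ler_wpM2r ?(ltW t0)// (le_trans (ler_norm _))// lerDl.
by rewrite mulrC -ler_pdivlMr// ge_min lexx orbT.
Qed.

End PathDerivative.

(** * Periodicity, and expansions at the origin *)

Section WeierstrassODE.
Context {R : realType} (w1 w2 : R[i]).
Local Notation C := R[i].
Local Notation idx := (int * int)%type.
Local Notation lat := (lat w1 w2).
Local Notation regular := (regular w1 w2).
Local Notation wp := (wp w1 w2).
Local Notation epole := (epole w1 w2).
Local Notation eis := (eis w1 w2).
Local Notation wpreg := (wpreg w1 w2).
Implicit Types (a b c : idx) (z : C).

Hypothesis hw : real_independent w1 w2.

Definition offlat z : Prop := forall c, z <> lat c.

Lemma offlat_neq0 z : offlat z -> z != 0.
Proof. by move=> oz; apply/eqP; rewrite -(lat0 w1 w2). Qed.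

Lemma offlat_regular z : offlat z -> regular z.
Proof. by move=> oz c /oz. Qed.

Lemma offlatP z : ~ lattice w1 w2 z <-> offlat z.
Proof.
split => [H c zc|oz /latticeP[c /oz//]].
by apply: H; apply/latticeP; exists c.
Qed.

Lemma offlat_add z c : offlat z -> offlat (z + lat c).
Proof.
move=> oz b E; apply: (oz (b - c)); rewrite latB -E; ring.
Qed.

(** Source of the periodicity of [wp] and [epole]: already under quadratic decay, translating the
    index changes a box sum by a boundary term that tends to 0. *)
Lemma fsum_shift_cvg (F : idx -> C) (B : R) a :
  (forall c, c != 0 -> normc (F c) <= B / (supn c)%:R ^+ 2) ->
  ccvg (fun N => fsum F N - fsum (fun c => F (c - a)) N) 0.
Proof.
move=> FB; pose e (N : nat) := 24 * B * (supn a)%:R / (N - supn a).+1%:R : R.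
apply: (@ccvg_norm_le _ _ _ e); last first.
  rewrite -(cvg_shiftn (supn a)).
  rewrite (_ : [sequence _]_n = fun n => 24 * B * (supn a)%:R / n.+1%:R).
    exact: cvg_inv_succ.
  by apply/funext => n; rewrite /e /= addnK.
exists (supn a) => // N /= aN; rewrite subr0.
rewrite /fsum (box_widen _ _ (leq_addr (supn a) N)) (box_translate N a) /=.
apply: le_trans (box_shift_le aN FB); rewrite le_eqVlt; apply/orP; left.
apply/eqP; congr (normc (_ - _)).
by apply: eq_bigr => c _; rewrite addrK.
Qed.

Lemma inv_pow_bound k z : (2 <= k)%N -> offlat z -> exists B : R, forall c, c != 0 ->
  normc (((z - lat c) ^+ k)^-1) <= B / (supn c)%:R ^+ 2.
Proof.
move=> k2 /offlat_regular/(regular_dist hw)[q q0 qP].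
exists (q^-1 ^+ k) => c c0; rewrite -(exprVn (z - lat c)) normcX.
have h := inv_boundedP q0 c0 (qP _ c0); have s1 := @supn_ge1 R _ c0.
apply: (@le_trans _ _ ((q * (supn c)%:R)^-1 ^+ k)).
  by apply: lerXn2r => //; rewrite nnegrE ?normc_ge0// (le_trans _ h)// normc_ge0.
rewrite invfM exprMn ler_wpM2l ?exprn_ge0 ?invr_ge0 ?(ltW q0)//.
rewrite -(exprVn (supn c)%:R) -[in leLHS](subnK k2) exprD ler_piMl ?exprn_ge0 ?invr_ge0//.
by rewrite exprn_ile1 ?invr_ge0// invf_le1// (lt_le_trans _ s1).
Qed.

Lemma wp_periodic z a : offlat z -> wp (z + lat a) = wp z.
Proof.
move=> oz; have oz' := offlat_add (c := a) oz.
have [B HB] := @inv_pow_bound 2 z isT oz.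
suff /eqP : wp z - wp (z + lat a) = 0 by rewrite subr_eq0 => /eqP ->.
apply/esym/(ccvg_unique (fsum_shift_cvg a HB)).
apply: ccvg_eq (ccvgB (wpbox_cvg hw (offlat_regular oz)) (wpbox_cvg hw (offlat_regular oz'))).
(* The sums of [(lat c ^+ 2)^-1] are the same for both points and cancel. *)
move=> N; rewrite /wpbox opprB addrA subrK; congr (_ - _); apply: eq_bigr => c _.
by congr (_ ^+ _)^-1; rewrite latB; ring.
Qed.

Lemma epole_periodic k z a : (3 <= k)%N -> offlat z ->
  epole k (z + lat a) = epole k z.
Proof.
move=> k3 oz; have oz' := offlat_add (c := a) oz.
have [B HB] := inv_pow_bound (ltnW k3) oz.
suff /eqP : epole k z - epole k (z + lat a) = 0 by rewrite subr_eq0 => /eqP ->.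
apply/esym/(ccvg_unique (fsum_shift_cvg a HB)).
apply: ccvg_eq (ccvgB (epole_cvg hw k3 (offlat_regular oz)) (epole_cvg hw k3 (offlat_regular oz'))).
move=> N; congr (_ - _); apply: eq_bigr => c _.
by congr (_ ^+ _)^-1; rewrite latB; ring.
Qed.

Definition G4 : C := csum (fun c => (lat c ^+ 4)^-1).
Definition G6 : C := csum (fun c => (lat c ^+ 6)^-1).

Lemma csum_odd (j : nat) : odd j -> (3 <= j)%N -> csum (fun c => (lat c ^+ j)^-1) = 0.
Proof.
move=> oj j3; have [K D] := lat_dominated hw j3; set s := LHS.
have E : s = - s.
  rewrite -[RHS]mulN1r -(csumZ _ D) /s csumN; apply: eq_csum => c _.
  by rewrite latN exprNn -signr_odd oj expr1 mulN1r invrN mulN1r.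
by have := mulrn_eq0 s 2; rewrite mulr2n {1}E addNr eqxx /= => /esym/eqP.
Qed.

(** The remainders O(1) of the Laurent expansions at 0, the origin itself being excluded. *)
Definition bounded0 (f : C -> C) : Prop := exists K d : R, 0 < d /\
  forall z, z != 0 -> normc z <= d -> normc (f z) <= K.

Lemma bounded0_cst (a : C) : bounded0 (fun=> a).
Proof. by exists (normc a), 1. Qed.

Lemma bounded0_id : bounded0 id.
Proof. by exists 1, 1. Qed.

Lemma bounded0D f g : bounded0 f -> bounded0 g -> bounded0 (fun z => f z + g z).
Proof.
move=> [K [d [d0 H]]] [K' [d' [d'0 H']]]; exists (K + K'), (Num.min d d').
split; first by rewrite lt_min d0.
by move=> z z0; rewrite le_min => /andP[h h']; apply: normc_add_le; [exact: H|exact: H'].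
Qed.

Lemma bounded0M f g : bounded0 f -> bounded0 g -> bounded0 (fun z => f z * g z).
Proof.
move=> [K [d [d0 H]]] [K' [d' [d'0 H']]]; exists (K * K'), (Num.min d d').
split; first by rewrite lt_min d0.
by move=> z z0; rewrite le_min => /andP[h h']; apply: normc_prod_le; [exact: H|exact: H'].
Qed.

Lemma bounded0B f g : bounded0 f -> bounded0 g -> bounded0 (fun z => f z - g z).
Proof.
move=> hf hg; have := bounded0D hf (bounded0M (bounded0_cst (-1)) hg).
by under eq_fun do rewrite mulN1r.
Qed.

Lemma bounded0X f n : bounded0 f -> bounded0 (fun z => f z ^+ n).
Proof.
move=> [K [d [d0 H]]]; exists (K ^+ n), d; split => // z z0 zd.
exact/normc_pow_le/H.
Qed.

Lemma bounded0_csum (f : C -> idx -> C) (K d : R) : 0 < d ->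
  (forall z, normc z <= d -> dominated K (f z)) -> bounded0 (fun z => csum (f z)).
Proof. by move=> d0 H; exists (48 * K), d; split => // z _ /H; exact: csum_le. Qed.

Lemma near0_inv : exists k d : R, [/\ 0 < k, 0 < d, d <= 1 & forall z c,
  normc z <= d -> c != 0 -> [/\ z - lat c != 0, lat c != 0,
    normc (z - lat c)^-1 <= (k * (supn c)%:R)^-1 &
    normc (lat c)^-1 <= (k * (supn c)%:R)^-1]].
Proof.
have [k [d [k0 d0 H]]] := regular_inv hw (regular0 hw).
exists k, (Num.min d 1); split; rewrite ?lt_min ?d0 ?ltr01 ?ge_min ?lexx ?orbT//.
move=> z c; rewrite le_min => /andP[zd _] c0; have [] := H z c zd c0.
rewrite sub0r addrC => h1 h2 h3 h4; split => //; first by rewrite -oppr_eq0.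
by rewrite -normcN -invrN.
Qed.

Lemma dominated_deg (f : C -> idx -> C) (k A d : R) (j : nat) : 0 < k -> 0 <= A -> (3 <= j)%N ->
  (forall z c, normc z <= d -> c != 0 ->
     normc (f z c) <= A * (k * (supn c)%:R)^-1 ^+ j) ->
  forall z, normc z <= d -> dominated (A * k^-1 ^+ j) (f z).
Proof.
move=> k0 A0 j3 H z zd c c0; apply: le_trans (H _ _ zd c0) _.
by rewrite -mulrA ler_wpM2l//; exact: pow_bound.
Qed.

Lemma inv_le_kinv (k : R) c : 0 < k -> c != 0 -> (k * (supn c)%:R)^-1 <= k^-1.
Proof.
move=> k0 c0; have s1 := @supn_ge1 R _ c0.
rewrite lef_pV2 ?posrE ?mulr_gt0 ?(lt_le_trans _ s1)//.
by rewrite ler_peMr// ltW.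
Qed.

Lemma csum_comb5 (F1 F2 F3 F4 F5 : idx -> C) (K1 K2 K3 K4 K5 : R)
    (a1 a2 a3 a4 a5 : C) :
  dominated K1 F1 -> dominated K2 F2 -> dominated K3 F3 -> dominated K4 F4 ->
  dominated K5 F5 ->
  csum (fun c => a1 * F1 c + (a2 * F2 c + (a3 * F3 c + (a4 * F4 c + a5 * F5 c)))) =
  a1 * csum F1 + (a2 * csum F2 + (a3 * csum F3 + (a4 * csum F4 + a5 * csum F5))).
Proof.
move=> /[dup] D1 /(dominatedZ a1) Z1 /[dup] D2 /(dominatedZ a2) Z2.
move=> /[dup] D3 /(dominatedZ a3) Z3 /[dup] D4 /(dominatedZ a4) Z4.
move=> /[dup] D5 /(dominatedZ a5) Z5.
have Z45 := dominatedD Z4 Z5; have Z35 := dominatedD Z3 Z45.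
have Z25 := dominatedD Z2 Z35.
rewrite (csumD Z1 Z25) (csumD Z2 Z35) (csumD Z3 Z45) (csumD Z4 Z5).
by rewrite (csumZ _ D1) (csumZ _ D2) (csumZ _ D3) (csumZ _ D4) (csumZ _ D5).
Qed.

Lemma eis4_expand : exists2 rho : C -> C, bounded0 rho &
  exists2 d : R, 0 < d & forall z, normc z <= d -> eis 4 z = G4 + z * rho z.
Proof.
have [k [d [k0 d0 d1 H]]] := near0_inv.
(* This is (x^-4 - w^-4) / z with w = [lat c] and x = z - w, factored by means of x^-1 + w^-1 = z /
   (x w). *)
pose f z c := - ((z - lat c)^-1 * (lat c)^-1 * ((lat c)^-1 - (z - lat c)^-1) *
   ((z - lat c)^-1 ^+ 2 + (lat c)^-1 ^+ 2)) : C.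
have D z : normc z <= d -> dominated (4 * k^-1 ^+ 5) (f z).
  apply: dominated_deg => // {}z c zd c0; have [_ _ h1 h2] := H z c zd c0.
  rewrite /f normcN; set u := (k * _)^-1 in h1 h2 *.
  rewrite (_ : 4 * u ^+ 5 = u * u * (u + u) * (u ^+ 2 + u ^+ 2)); last by ring.
  by normc_bound; rewrite normcN.
exists (fun z => csum (f z)); first exact: bounded0_csum d0 D.
exists d => // z zd; have [K4 D4] := @lat_dominated _ _ _ hw 4 isT.
rewrite /G4 -(csumZ _ (D _ zd)) -(csumD D4 (dominatedZ _ (D _ zd))).
apply: eq_csum => c c0; have [h1 h2 _ _] := H z c zd c0.
by rewrite /f; field; rewrite h1 h2.
Qed.

Lemma eis3_expand : exists2 rho : C -> C, bounded0 rho &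
  exists2 d : R, 0 < d & forall z, normc z <= d ->
    eis 3 z = - (3 * G4 * z) - 10 * G6 * z ^+ 3 + z ^+ 4 * rho z.
Proof.
have [k [d [k0 d0 d1 H]]] := near0_inv.
(* The exact remainder of (z - w)^-3 after the term in z^3, divided by z^4; it comes from (1 - u)^-3
   = 1 + 3 u + 6 u^2 + 10 u^3 + u^4 (15 - 24 u + 10 u^2) / (1 - u)^3 at u = z / w. *)
pose f z c := (z - lat c)^-1 ^+ 3 * ((lat c)^-1 ^+ 4 *
   ((15%:R + - (24%:R * (z * (lat c)^-1))) + 10%:R * (z * (lat c)^-1) ^+ 2)) : C.
pose A : R := 15 + 24 * (1 * k^-1) + 10 * (1 * k^-1) ^+ 2.
have D z : normc z <= d -> dominated (A * k^-1 ^+ 7) (f z).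
  apply: dominated_deg => //.
    by rewrite /A !addr_ge0 ?mulr_ge0 ?exprn_ge0 ?invr_ge0 ?mulr_ge0 ?invr_ge0 ?(ltW k0).
  move=> {}z c zd c0; have [_ _ h1 h2] := H z c zd c0.
  have z1 : normc z <= 1 by exact: le_trans d1.
  have h3 : normc (lat c)^-1 <= k^-1 by exact: le_trans (inv_le_kinv k0 c0).
  rewrite /f; set u := (k * _)^-1 in h1 h2 *.
  rewrite (_ : A * u ^+ 7 = u ^+ 3 * (u ^+ 4 * A)); last by ring.
  rewrite /A; apply: normc_prod_le; first by normc_bound.
  apply: normc_prod_le; first by normc_bound.
  apply: normc_add_le; last by normc_bound.
  apply: normc_add_le; first by rewrite normc_nat.
  by rewrite normcN; normc_bound.
exists (fun z => csum (f z)); first exact: bounded0_csum d0 D.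
exists d => // z zd; have [K3 D3] := @lat_dominated _ _ _ hw 3 isT.
have [K4 D4] := @lat_dominated _ _ _ hw 4 isT.
have [K5 D5] := @lat_dominated _ _ _ hw 5 isT.
have [K6 D6] := @lat_dominated _ _ _ hw 6 isT.
have := @csum_odd 3 isT isT; have := @csum_odd 5 isT isT => E5 E3.
have -> : - (3 * G4 * z) - 10 * G6 * z ^+ 3 + z ^+ 4 * csum (f z) =
  (-1) * csum (fun c => (lat c ^+ 3)^-1) + ((- 3 * z) * G4 +
    ((- 6 * z ^+ 2) * csum (fun c => (lat c ^+ 5)^-1) + ((- 10 * z ^+ 3) * G6 +
     z ^+ 4 * csum (f z)))) by rewrite E3 E5; ring.
rewrite /G4 /G6 -(csum_comb5 _ _ _ _ _ D3 D4 D5 D6 (D _ zd)).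
apply: eq_csum => c c0; have [h1 h2 _ _] := H z c zd c0.
by rewrite /f; field; rewrite h1 h2.
Qed.

Lemma wpreg_expand : exists2 rho : C -> C, bounded0 rho &
  exists2 d : R, 0 < d & forall z, normc z <= d ->
    wpreg z = 3 * G4 * z ^+ 2 + 5 * G6 * z ^+ 4 + z ^+ 5 * rho z.
Proof.
have [k [d [k0 d0 d1 H]]] := near0_inv.
(* The exact remainder of (z - w)^-2 after the term in z^4, divided by z^5. *)
pose f z c := (z - lat c)^-1 ^+ 2 * ((lat c)^-1 ^+ 5 *
   (6%:R + - (5%:R * (z * (lat c)^-1)))) : C.
pose A : R := 6 + 5 * (1 * k^-1).
have D z : normc z <= d -> dominated (A * k^-1 ^+ 7) (f z).
  apply: dominated_deg => //; first by rewrite /A !addr_ge0 ?mulr_ge0 ?invr_ge0 ?(ltW k0).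
  move=> {}z c zd c0; have [_ _ h1 h2] := H z c zd c0.
  have z1 : normc z <= 1 by exact: le_trans d1.
  have h3 : normc (lat c)^-1 <= k^-1 by exact: le_trans (inv_le_kinv k0 c0).
  rewrite /f; set u := (k * _)^-1 in h1 h2 *.
  rewrite (_ : A * u ^+ 7 = u ^+ 2 * (u ^+ 5 * A)); last by ring.
  rewrite /A; apply: normc_prod_le; first by normc_bound.
  apply: normc_prod_le; first by normc_bound.
  apply: normc_add_le; first by rewrite normc_nat.
  by rewrite normcN; normc_bound.
exists (fun z => csum (f z)); first exact: bounded0_csum d0 D.
exists d => // z zd; have [K3 D3] := @lat_dominated _ _ _ hw 3 isT.
have [K4 D4] := @lat_dominated _ _ _ hw 4 isT.
have [K5 D5] := @lat_dominated _ _ _ hw 5 isT.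
have [K6 D6] := @lat_dominated _ _ _ hw 6 isT.
have := @csum_odd 3 isT isT; have := @csum_odd 5 isT isT => E5 E3.
have -> : 3 * G4 * z ^+ 2 + 5 * G6 * z ^+ 4 + z ^+ 5 * csum (f z) =
  (2 * z) * csum (fun c => (lat c ^+ 3)^-1) + ((3 * z ^+ 2) * G4 +
    ((4 * z ^+ 3) * csum (fun c => (lat c ^+ 5)^-1) + ((5 * z ^+ 4) * G6 +
     z ^+ 5 * csum (f z)))) by rewrite E3 E5; ring.
rewrite /G4 /G6 -(csum_comb5 _ _ _ _ _ D3 D4 D5 D6 (D _ zd)).
apply: eq_csum => c c0; have [h1 h2 _ _] := H z c zd c0.
by rewrite /f; field; rewrite h1 h2.
Qed.

End WeierstrassODE.

Ltac bounded0_split := repeat match goal with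
  | |- bounded0 (fun=> ?c) => exact: bounded0_cst
  | |- bounded0 (fun z => z) => exact: bounded0_id
  | |- bounded0 (fun z => @?f z - @?g z) => apply: (@bounded0B _ f g)
  | |- bounded0 (fun z => @?f z + @?g z) => apply: (@bounded0D _ f g)
  | |- bounded0 (fun z => @?f z * @?g z) => apply: (@bounded0M _ f g)
  | |- bounded0 (fun z => @?f z ^+ ?n) => apply: (@bounded0X _ f n)
  | |- bounded0 (fun z => ?f z) => assumption
  end.

(** * The second and first order equations of the Weierstrass function *)

Section WeierstrassEquation.
Context {R : realType} (w1 w2 : R[i]).
Local Notation C := R[i].
Local Notation lat := (lat w1 w2).
Local Notation offlat := (offlat w1 w2).
Local Notation wp := (wp w1 w2).
Local Notation epole := (epole w1 w2).
Local Notation G4 := (G4 w1 w2).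
Local Notation G6 := (G6 w1 w2).
Implicit Types z : C.

Hypothesis hw : real_independent w1 w2.

(** Rounding both coordinates to the nearest integer leaves them at most 1 / 2 in absolute value.
    For 0 < t <= 1 a multiple by t can then be an integer only if the coordinate is 0. *)
Lemma cell_reduction z : offlat z -> exists c z',
  z = z' + lat c /\ forall t : R, 0 < t <= 1 -> offlat (t%:C * z').
Proof.
move=> oz; have [a [b zE]] := coordP hw z.
pose m := Num.floor (a + 1 / 2); pose n := Num.floor (b + 1 / 2).
exists (m, n), ((a - m%:~R)%:C * w1 + (b - n%:~R)%:C * w2); split.
  by rewrite zE /lat /= !rmorphB /= !rmorph_int; ring.
have small (x : R) : `|x - (Num.floor (x + 1 / 2))%:~R| <= 1 / 2.
  have := floor_le (x + 1 / 2); have := floorD1_gt (x + 1 / 2).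
  rewrite intrD; move: (Num.floor _)%:~R => f h1 h2.
  by rewrite ler_norml; apply/andP; split; lra.
have int0 (t x : R) (k : int) : 0 < t <= 1 -> `|x| <= 1 / 2 -> t * x = k%:~R -> x = 0.
  move=> /andP[t0 t1] x2 E; have : `|k%:~R| < 1 :> R.
    rewrite -E normrM gtr0_norm//; apply: (@le_lt_trans _ _ (1 * (1 / 2))); last by lra.
    by apply: ler_pM => //; exact: ltW.
  rewrite -intr_norm -[1]/(1%:~R) ltr_int => k0.
  have k00 : k = 0 by lia.
  by move: E; rewrite k00 => /eqP; rewrite mulf_eq0 gt_eqF//= => /eqP.
move=> t t01 [k l]; rewrite /lat /= => E.
have [] := @hw (t * (a - m%:~R) - k%:~R) (t * (b - n%:~R) - l%:~R).
  rewrite !rmorphB !rmorphM /= !rmorph_int.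
  by move/eqP: E; rewrite -subr_eq0 => /eqP <-; rewrite !rmorphB /= !rmorph_int; ring.
move=> /subr0_eq/(int0 _ _ _ t01 (small a))/subr0_eq am.
move=> /subr0_eq/(int0 _ _ _ t01 (small b))/subr0_eq bn.
by apply: (oz (m, n)); rewrite zE /lat /= am bn !rmorph_int.
Qed.

(** Stands in for Liouville's theorem: periodicity moves the point to a cell from which the segment
    to the origin avoids the lattice, and the constant is the limit of f at 0. *)
Lemma elliptic_constant (f : C -> C) (l : C) :
  (forall z c, offlat z -> f (z + lat c) = f z) ->
  (forall z, offlat z -> cder f z 0) ->
  (exists2 rho : C -> C, bounded0 rho & exists2 d : R, 0 < d &
    forall z, z != 0 -> normc z <= d -> f z = l + z * rho z) ->
  forall z, offlat z -> f z = l.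
Proof.
move=> fP fD [rho [K [d' [d'0 rhoK]]] [d d0 fE]] z /cell_reduction[c [z' [zE H]]].
have oz' : offlat z' by rewrite -(mul1r z'); apply: H; rewrite ltr01 lexx.
have nz' : 0 < normc z' by rewrite normc_gt0 (offlat_neq0 oz').
rewrite zE fP//; apply: (@ray_constant _ f z' l (normc z' * K)) => [t /H/fD//|].
exists (Num.min d d' / normc z'); first by rewrite divr_gt0// lt_min d0.
move=> t /andP[t0]; rewrite ltr_pdivlMr// lt_min => /andP[td td'].
have tz0 : t%:C * z' != 0.
  by rewrite -normc_gt0 normcM normcR mulr_gt0// normr_gt0 gt_eqF.
have ntz : normc (t%:C * z') = t * normc z' by rewrite normcM normcR gtr0_norm.
rewrite fE ?ntz ?(ltW td)// addrAC subrr add0r normcM ntz.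
have -> : normc z' * K * t = t * normc z' * K by ring.
rewrite ler_wpM2l ?mulr_ge0 ?normc_ge0 ?(ltW t0)//.
by apply: rhoK => //; rewrite ntz ltW.
Qed.

(** As wp'' = 6 [epole 4], this is wp'' = 6 wp^2 - 30 G4, a first integral of [epole5E]. At 0 the
    constant term of [epole 4] is G4 and that of wp^2 is 6 G4. *)
Lemma epole4E z : offlat z -> epole 4 z = wp z ^+ 2 - 5 * G4.
Proof.
suff h : forall z, offlat z -> epole 4 z - wp z ^+ 2 = - 5 * G4.
  by move=> /h/eqP; rewrite subr_eq => /eqP ->; rewrite addrC mulNr.
apply: (@elliptic_constant (fun z => epole 4 z - wp z ^+ 2)).
- by move=> {}z c oz; rewrite (epole_periodic hw)// (wp_periodic hw).
- move=> {}z oz; have z0 := offlat_neq0 oz; have rz := offlat_regular oz.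
  apply: cder_eq (cderB (epole4_cder hw z0 rz) (cderX 1 (wp_cder hw z0 rz))) _.
  by rewrite expr1 (epole5E hw z0 rz); ring.
have [rho1 b1 [d1 d10 E1]] := wpreg_expand hw.
have [rho3 b3 [d3 d30 E3]] := eis4_expand hw.
pose v (z : C) := 3 * G4 + 5 * G6 * z ^+ 2 + z ^+ 3 * rho1 z.
exists (fun z => rho3 z - 10 * G6 * z - 2 * (z ^+ 2 * rho1 z) - z ^+ 3 * v z ^+ 2).
  have bv : bounded0 v by rewrite /v; bounded0_split.
  bounded0_split.
exists (Num.min d1 d3); first by rewrite lt_min d10.
move=> {}z z0; rewrite le_min => /andP[/E1 h1 /E3 h3].
by rewrite /epole /wp h1 h3 /v; field.
Qed.

(** The left side is wp'^2. By [epole4E] the difference with the terms in wp has zero derivative;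
    its constant term at 0 is -80 G6 - 60 G6, while the poles cancel. *)
Lemma wp_cubic z : offlat z ->
  4 * epole 3 z ^+ 2 = 4 * wp z ^+ 3 - 60 * G4 * wp z - 140 * G6.
Proof.
move=> oz; suff h : 4 * epole 3 z ^+ 2 - (4 * wp z ^+ 3 - 60 * G4 * wp z) = - 140 * G6.
  by apply/eqP; rewrite -subr_eq0 -(subrr (- 140 * G6)) -{1}h; apply/eqP; ring.
move: z oz.
apply: (@elliptic_constant (fun z => 4 * epole 3 z ^+ 2 - (4 * wp z ^+ 3 - 60 * G4 * wp z))).
- by move=> z c oz; rewrite (epole_periodic hw)// (wp_periodic hw).
- move=> z oz; have z0 := offlat_neq0 oz; have rz := offlat_regular oz.
  have hwp := wp_cder hw z0 rz.
  apply: cder_eq (cderB (cderZ 4 (cderX 1 (epole3_cder hw z0 rz)))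
    (cderB (cderZ 4 (cderX 2 hwp)) (cderZ (60 * G4) hwp))) _.
  by rewrite expr1 (epole4E oz); ring.
have [rho1 b1 [d1 d10 E1]] := wpreg_expand hw.
have [rho2 b2 [d2 d20 E2]] := eis3_expand hw.
pose v (z : C) := 3 * G4 + 5 * G6 * z ^+ 2 + z ^+ 3 * rho1 z.
pose t z := z ^+ 3 * rho2 z - 3 * G4 - 10 * G6 * z ^+ 2.
exists (fun z => 4 * (2 * rho2 z - 3 * rho1 z) +
  (4 * (z * (t z ^+ 2 - 3 * v z ^+ 2 - z ^+ 4 * v z ^+ 3)) + 60 * G4 * (z * v z))).
  have bv : bounded0 v by rewrite /v; bounded0_split.
  have bt : bounded0 t by rewrite /t; bounded0_split.
  bounded0_split.
exists (Num.min d1 d2); first by rewrite lt_min d10.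
move=> z z0; rewrite le_min => /andP[/E1 h1 /E2 h2].
by rewrite /epole /wp h1 h2 /v /t; field.
Qed.

End WeierstrassEquation.

(** * The Weierstrass equation along a path *)

Section PoleChart.
Context {R : realType} (w1 w2 k : R[i]).
Local Notation C := R[i].
Local Notation lat := (lat w1 w2).
Local Notation offlat := (offlat w1 w2).
Local Notation wp := (wp w1 w2).
Local Notation epole := (epole w1 w2).
Local Notation G4 := (G4 w1 w2).
Local Notation G6 := (G6 w1 w2).
Implicit Types z h : C.

(* The coordinate 1 / (wp - k), in which the poles of wp are ordinary zeros,
   and its derivative. *)
Definition chart z : C :=
  if `[< lattice w1 w2 z >] then 0 else (wp z - k)^-1.

Definition dchart z : C :=
  if `[< lattice w1 w2 z >] then 0 else 2 * epole 3 z * ((wp z - k)^-1) ^+ 2.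

Definition chartdom z : Prop := lattice w1 w2 z \/ wp z != k.

(* Half the derivative of the quartic q with (chart')^2 = q(chart). *)
Definition chart_force (s : C) : C :=
  2 + 12 * k * s + 3 / 2 * (12 * k ^+ 2 - 60 * G4) * s ^+ 2 +
  2 * (4 * k ^+ 3 - 60 * G4 * k - 140 * G6) * s ^+ 3.

Lemma chart_lat z : lattice w1 w2 z -> chart z = 0.
Proof. by move=> Lz; rewrite /chart asboolT. Qed.

Lemma dchart_lat z : lattice w1 w2 z -> dchart z = 0.
Proof. by move=> Lz; rewrite /dchart asboolT. Qed.

Lemma chart_off z : offlat z -> chart z = (wp z - k)^-1.
Proof. by move=> /offlatP Lz; rewrite /chart asboolF. Qed.

Lemma dchart_off z : offlat z -> dchart z = 2 * epole 3 z * ((wp z - k)^-1) ^+ 2.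
Proof. by move=> /offlatP Lz; rewrite /dchart asboolF. Qed.

Hypothesis hw : real_independent w1 w2.

Lemma lattice_add z c : lattice w1 w2 (z + lat c) <-> lattice w1 w2 z.
Proof.
split => /latticeP[b E]; apply/latticeP.
  by exists (b - c); rewrite latB -E addrK.
by exists (b + c); rewrite latD -E.
Qed.

Lemma chart_periodic z c : chart (z + lat c) = chart z.
Proof.
have [Lz|/offlatP oz] := pselect (lattice w1 w2 z).
  by rewrite !chart_lat//; apply/lattice_add.
by rewrite !chart_off ?(wp_periodic hw)//; exact: offlat_add.
Qed.

Lemma dchart_periodic z c : dchart (z + lat c) = dchart z.
Proof.
have [Lz|/offlatP oz] := pselect (lattice w1 w2 z).
  by rewrite !dchart_lat//; apply/lattice_add.
by rewrite !dchart_off ?(wp_periodic hw) ?(epole_periodic hw)//; exact: offlat_add.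
Qed.

Lemma offlat_near z : offlat z -> exists2 d : R, 0 < d &
  forall h, normc h <= d -> offlat (z + h).
Proof.
move=> oz; have [q q0 qP] := offlattice_dist hw (offlat_neq0 oz) (offlat_regular oz).
exists (q / 2); first by rewrite divr_gt0.
move=> h hq c E; have := qP c; have -> : z - lat c = - h by rewrite -E; ring.
rewrite normcN => h1; have : q <= q * (supn c).+1%:R by rewrite ler_peMr ?ler1n// ltW.
by move: (q * _) h1 => y; lra.
Qed.

Lemma offlat_punctured : exists2 d : R, 0 < d &
  forall h, h != 0 -> normc h <= d -> offlat h.
Proof.
have [q [d [q0 d0 d1 H]]] := near0_inv hw; exists d => // h h0 hd c E.
have [c0|c0] := eqVneq c 0; first by move: h0; rewrite E c0 lat0 eqxx.
by have [] := H h c hd c0; rewrite E subrr eqxx.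
Qed.

Lemma chart_cder_off z : offlat z -> wp z != k -> cder chart z (dchart z).
Proof.
move=> oz zk; have [d d0 dH] := offlat_near oz.
apply: (@cder_near _ (fun z => (wp z - k)^-1) chart z _ d) => // [h /dH|].
  by move=> oh; rewrite chart_off.
have hn : wp z - k != 0 by rewrite subr_eq0.
apply: cder_eq (cderV (f := fun z => wp z - k) hn (cderB (wp_cder hw (offlat_neq0 oz)
  (offlat_regular oz)) (cder_cst k z))) _.
by rewrite dchart_off//; field.
Qed.

Lemma dchart_cder_off z : offlat z -> wp z != k ->
  cder dchart z (chart_force (chart z)).
Proof.
move=> oz zk; have [d d0 dH] := offlat_near oz.
apply: (@cder_near _ (fun z => 2 * epole 3 z * ((wp z - k)^-1) ^+ 2) dchart z _ d) => // [h /dH|].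
  by move=> oh; rewrite dchart_off.
have hn : wp z - k != 0 by rewrite subr_eq0.
have z0 := offlat_neq0 oz; have rz := offlat_regular oz.
have D1 := cderV (f := fun z => wp z - k) hn (cderB (wp_cder hw z0 rz) (cder_cst k z)).
apply: cder_eq (cderM (cderZ 2 (epole3_cder hw z0 rz)) (cderX 1 D1)) _.
have E3 := wp_cubic hw oz.
rewrite (epole4E hw oz) chart_off// /chart_force expr1 subr0.
rewrite (_ : 2 * epole 3 z * _ = 8 * epole 3 z ^+ 2 / (wp z - k) ^+ 3); last by field.
rewrite (_ : 8 * _ = 2 * (4 * epole 3 z ^+ 2)); last by ring.
rewrite E3; field; exact: hn.
Qed.

(** This is h^2 (wp h - k) with the pole cancelled; hence 1 / (wp - k) = h^2 / N1 has a double zero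
    at 0. *)
Let N1 h : C := 1 + h ^+ 2 * (wpreg w1 w2 h - k).

Let N1_cder : exists l, cder N1 0 l.
Proof.
have D := cderD (cder_cst 1 0) (cderM (cderX 1 (@cder_id R 0))
  (cderB (wpreg_cder hw (regular0 hw)) (cder_cst k 0))).
by eexists; exact: D.
Qed.

Let N10 : N1 0 = 1.
Proof. by rewrite /N1 expr0n mul0r addr0. Qed.

Let wpkE h : h != 0 -> (wp h - k)^-1 = h ^+ 2 * (N1 h)^-1.
Proof.
move=> h0; have -> : wp h - k = (h ^+ 2)^-1 * N1 h by rewrite /wp /N1; field.
by rewrite invfM invrK.
Qed.

Lemma lattice0 : lattice w1 w2 0.
Proof. by apply/latticeP; exists 0; rewrite lat0. Qed.

Lemma chart_cder0 : cder chart 0 0.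
Proof.
have [d d0 dH] := offlat_punctured; have [l hl] := N1_cder.
apply: (@cder_near _ (fun h => h ^+ 2 * (N1 h)^-1) chart 0 _ d) => // [h hd|].
  rewrite add0r; have [->|h0] := eqVneq h 0.
    by rewrite expr0n mul0r chart_lat//; exact: lattice0.
  by rewrite chart_off ?wpkE//; exact: dH.
have hN : N1 0 != 0 by rewrite N10 oner_eq0.
apply: cder_eq (cderM (cderX 1 (@cder_id R 0)) (cderV hN hl)) _.
by rewrite expr1 expr0n /= !mulr0 !mul0r addr0.
Qed.

Lemma dchart_cder0 : cder dchart 0 2.
Proof.
have [d d0 dH] := offlat_punctured; have [l hl] := N1_cder.
pose f h := 2 * (h * (1 + h ^+ 3 * eis w1 w2 3 h)) * ((N1 h)^-1) ^+ 2 : C.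
apply: (@cder_near _ f dchart 0 _ d) => // [h hd|].
  rewrite /f add0r; have [->|h0] := eqVneq h 0.
    by rewrite !mul0r mulr0 mul0r dchart_lat//; exact: lattice0.
  rewrite dchart_off ?wpkE//; last exact: dH.
  rewrite /epole exprMn; move: (_^-1) => x; by field.
have hN : N1 0 != 0 by rewrite N10 oner_eq0.
have D := cderM (cderZ 2 (cderM (@cder_id R 0) (cderD (cder_cst 1 0)
  (cderM (cderX 2 (@cder_id R 0)) (eis3_cder hw (regular0 hw)))))) (cderX 1 (cderV hN hl)).
apply: cder_eq D _.
by rewrite N10 !expr0n /= !mul0r !mulr0 !mul0r !addr0 invr1 expr1n !mulr1.
Qed.

Lemma chart_cder z : chartdom z -> cder chart z (dchart z).
Proof.
have [/[dup] Lz /latticeP[c zc] _|nL [//|]] := pselect (lattice w1 w2 z).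
  rewrite dchart_lat// (_ : chart = fun x => chart (x + lat (- c))).
    by apply: cder_translate; rewrite zc latN subrr; exact: chart_cder0.
  by apply/funext => x; rewrite chart_periodic.
by apply: chart_cder_off; apply/offlatP.
Qed.

Lemma dchart_cder z : chartdom z -> cder dchart z (chart_force (chart z)).
Proof.
have [/[dup] Lz /latticeP[c zc] _|nL [//|]] := pselect (lattice w1 w2 z).
  rewrite chart_lat// (_ : dchart = fun x => dchart (x + lat (- c))).
    apply: cder_translate; rewrite zc latN subrr.
    by apply: cder_eq dchart_cder0 _; rewrite /chart_force !expr0n /= !mulr0 !addr0.
  by apply/funext => x; rewrite dchart_periodic.
by apply: dchart_cder_off; apply/offlatP.
Qed.

End PoleChart.

(** * Induction along an interval and the Gronwall estimate *)

Section RealLine.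
Context {R : realType}.
Local Notation C := R[i].

(** Let T be the supremum of the t such that P holds on [a, t]. Closedness from the left gives P at
    T, and the step to the right rules out T < b. *)
Lemma real_induction (P : R -> Prop) (a b : R) : P a ->
  (forall t, a <= t < b -> P t ->
     exists2 d, 0 < d & forall u, t < u < t + d -> u <= b -> P u) ->
  (forall t, a < t <= b -> (forall u, a <= u < t -> P u) -> P t) ->
  forall t, a <= t <= b -> P t.
Proof.
move=> Pa step lim t0 /andP[at0 t0b].
pose S := [set t | a <= t <= b /\ forall u, a <= u <= t -> P u].
have ab : a <= b by exact: le_trans t0b.
have Sa : S a.
  by split; [rewrite lexx|move=> u /le_anti <-].
have Sub : ubound S b by move=> t [/andP[]].
have hS : has_sup S by split; [exists a|exists b].
pose T := sup S.
have aT : a <= T by apply: ub_le_sup => //; exists b.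
have Tb : T <= b by apply: ge_sup => //; exists a.
have PT u : a <= u < T -> P u.
  move=> /andP[au uT]; have [t [tab tP] ut] := sup_gt (proj1 hS) uT.
  by apply: tP; rewrite au ltW.
have PTT : P T.
  by move: aT; rewrite le_eqVlt => /predU1P[<-//|aT]; apply: lim; rewrite ?aT.
have TE : T = b.
  apply/eqP; rewrite eq_le Tb leNgt; apply/negP => Tltb.
  have [|d d0 dP] := step T _ PTT; first by rewrite aT.
  pose T' := Num.min (T + d / 2) b.
  have TT' : T < T' by rewrite lt_min Tltb andbT ltrDl divr_gt0.
  suff ST' : S T' by have := ub_le_sup (proj2 hS) ST'; rewrite leNgt TT'.
  split; first by rewrite ge_min lexx orbT andbT (le_trans aT)// ltW.
  move=> u /andP[au uT']; have [uT|] := ltP u T; first by apply: PT; rewrite au.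
  rewrite le_eqVlt => /predU1P[<-//|Tu]; apply: dP.
    rewrite Tu (le_lt_trans uT')// gt_min; apply/orP; left; lra.
  by rewrite (le_trans uT')// ge_min lexx orbT.
have [t0T|] := ltP t0 T; first by apply: PT; rewrite at0.
by rewrite TE => bt0; have -> : t0 = T by rewrite TE; apply: le_anti; rewrite t0b bt0.
Qed.

(** The product e exp(- K th) is nonincreasing on ]t, c] and tends to 0 at t, since th is bounded
    below by m. No derivative is taken at t itself, near which [dth] may be unbounded. *)
Lemma gronwall_zero (e th de dth : R -> R) (K t c m : R) : t < c -> 0 <= K ->
  (forall u, 0 <= e u) ->
  (forall u, t < u <= c -> [/\ is_derive u (1 : R) e (de u),
     is_derive u (1 : R) th (dth u), de u <= K * dth u * e u & m <= th u]) ->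
  (forall eps : R, 0 < eps -> exists2 d : R, 0 < d &
     forall u, t < u < t + d -> u <= c -> e u <= eps) ->
  e c = 0.
Proof.
move=> tc K0 e0 H lim.
pose F u := e u * expR (- K * th u).
have F0 u : 0 <= F u by rewrite mulr_ge0// expR_ge0.
have dF u : t < u <= c -> is_derive u (1 : R) F
    ((de u - K * dth u * e u) * expR (- K * th u)).
  move=> /H[D1 D2 _ _].
  have D3 : is_derive u (1 : R) (fun x => - K * th x) (- K * dth u).
    exact: is_deriveZ.
  have D4 := @is_derive1_comp _ expR (fun x => - K * th x) u _ _ (is_derive_expR _) D3.
  have -> : F = e * (expR \o (fun x => - K * th x)) by [].
  apply: is_derive_eq (is_deriveM D1 D4) _.
  by rewrite /GRing.scale /=; ring.
have Fle u : t < u < c -> F c <= F u.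
  move=> /andP[tu uc].
  have [||z] := @MVT R F (fun u => (de u - K * dth u * e u) * expR (- K * th u)) u c uc.
  - move=> x; rewrite in_itv /= => /andP[ux xc]; by apply: dF; rewrite (lt_trans tu ux) ltW.
  - apply: derivable_within_continuous => x; rewrite in_itv /= => /andP[ux xc].
    by have [] := dF x; rewrite ?xc ?(lt_le_trans tu ux).
  rewrite in_itv /= => /andP[uz zc] E; rewrite -subr_le0 E.
  rewrite mulr_le0_ge0 ?subr_ge0 ?(ltW uc)// mulr_le0_ge0 ?expR_ge0// subr_le0.
  by have [] := H z; rewrite ?(lt_trans tu uz) ?(ltW zc).
have FB u : t < u < c -> F c <= e u * expR (- K * m).
  move=> tuc; apply: le_trans (Fle u tuc) _; rewrite ler_wpM2l// ler_expR.
  rewrite !mulNr lerN2 ler_wpM2l//; have [] := H u => //.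
  by case/andP: tuc => -> /ltW ->.
have Fc : F c <= 0.
  apply/ler_addgt0Pl => eps eps0; rewrite addr0.
  have B0 := expR_gt0 (- K * m).
  have [|d d0 dH] := lim (eps / expR (- K * m)); first by rewrite divr_gt0.
  pose u := Num.min (t + d / 2) ((t + c) / 2).
  have tu : t < u by rewrite lt_min ltrDl divr_gt0//=; lra.
  have uc : u < c by rewrite gt_min; apply/orP; right; lra.
  have ud : u < t + d by rewrite gt_min; apply/orP; left; lra.
  apply: le_trans (FB u _) _; first by rewrite tu.
  by rewrite -ler_pdivlMr//; apply: dH; rewrite ?tu ?ltW.
have : F c = 0 by apply: le_anti; rewrite Fc F0.
by move/eqP; rewrite mulf_eq0 (gt_eqF (expR_gt0 _)) orbF => /eqP.
Qed.

Definition pcont (Y : R -> C) (a b t : R) : Prop :=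
  forall eps : R, 0 < eps -> exists2 d : R, 0 < d &
    forall u, a <= u <= b -> `|u - t| < d -> normc (Y u - Y t) <= eps.

End RealLine.

(** * Comparison with the chart along a path *)

Section ChartFlow.
Context {R : realType} (w1 w2 k : R[i]).
Local Notation C := R[i].
Local Notation offlat := (offlat w1 w2).
Local Notation wp := (wp w1 w2).
Local Notation chart := (chart w1 w2 k).
Local Notation dchart := (dchart w1 w2 k).
Local Notation chartdom := (chartdom w1 w2 k).
Local Notation chart_force := (chart_force w1 w2 k).

Hypothesis hw : real_independent w1 w2.

Lemma cder_cont (f : C -> C) z l : cder f z l -> forall eps : R, 0 < eps ->
  exists2 d : R, 0 < d & forall h, normc h <= d -> normc (f (z + h) - f z) <= eps.
Proof.
move=> /cder_lip[K [d [K0 d0 H]]] eps eps0.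
exists (Num.min d (eps / K)); first by rewrite lt_min d0 divr_gt0.
move=> h; rewrite le_min ler_pdivlMr// => /andP[/H h1 h2].
by rewrite (le_trans h1)// mulrC.
Qed.

Lemma chartdom_open z : chartdom z -> exists2 d : R, 0 < d &
  forall h, normc h <= d -> chartdom (z + h).
Proof.
move=> gz; have [Lz|nL] := pselect (lattice w1 w2 z).
  have [K [d [K0 d0 d1 H]]] := cder_bound (dchart_cder hw gz).
  exists (Num.min d K^-1); first by rewrite lt_min d0 invr_gt0.
  move=> h; rewrite le_min => /andP[hd hK].
  have [L|nL] := pselect (lattice w1 w2 (z + h)); first by left.
  right; apply/eqP => E; have [e He] := H h hd.
  have oh : offlat (z + h) by apply/offlatP.
  (* Off the lattice, wp = k would make [dchart] vanish by the convention 0^-1 = 0. Its expansion at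
     the lattice point z reads h (2 + h e) with |h e| <= 1, which is nonzero. *)
  rewrite dchart_off// E subrr invr0 expr0n mulr0 dchart_lat// add0r chart_lat//.
  rewrite /chart_force !expr0n /= !mulr0 !addr0 => E2.
  have h0 : h != 0 by apply/eqP => h0; apply: nL; rewrite h0 addr0.
  have : 2 + h * e = 0.
    by apply: (mulfI h0); rewrite mulr0 mulrDr mulrA -expr2 -E2.
  move=> /eqP; rewrite addr_eq0 => /eqP/(congr1 (@normc R)).
  rewrite normcN normcM normc_nat => E3.
  have : normc h * normc e <= 1.
    rewrite -(mulVf (_ : K != 0)); last by rewrite gt_eqF.
    by apply: ler_pM; rewrite ?normc_ge0.
  by rewrite -E3 (ler_nat _ 2 1).
have zk : wp z != k by case: gz.
have oz : offlat z by apply/offlatP.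
have nk : 0 < normc (wp z - k) by rewrite normc_gt0 subr_eq0.
have n2 : 0 < normc (wp z - k) / 2 by rewrite divr_gt0.
have [d d0 dH] := offlat_near hw oz.
have [d' d'0 dH'] := cder_cont (wp_cder hw (offlat_neq0 oz) (offlat_regular oz)) n2.
exists (Num.min d d'); first by rewrite lt_min d0.
move=> h; rewrite le_min => /andP[/dH oh /dH' h']; right; apply/eqP => E.
by move: h'; rewrite E normcB; lra.
Qed.

Lemma chart_force_diff s1 s2 : chart_force s1 - chart_force s2 =
  (s1 - s2) * (12 * k + 3 / 2 * (12 * k ^+ 2 - 60 * G4 w1 w2) * (s1 + s2) +
    2 * (4 * k ^+ 3 - 60 * G4 w1 w2 * k - 140 * G6 w1 w2) *
      (s1 ^+ 2 + s1 * s2 + s2 ^+ 2)).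
Proof. by rewrite /chart_force; field. Qed.

Lemma chart_force_lip (B : R) : exists2 M : R, 0 <= M & forall s1 s2,
  normc s1 <= B -> normc s2 <= B ->
  normc (chart_force s1 - chart_force s2) <= normc (s1 - s2) * M.
Proof.
exists (`|normc (12 * k) + normc (3 / 2 * (12 * k ^+ 2 - 60 * G4 w1 w2)) * (B + B) +
  normc (2 * (4 * k ^+ 3 - 60 * G4 w1 w2 * k - 140 * G6 w1 w2)) *
  (B ^+ 2 + B * B + B ^+ 2)|) => // s1 s2 h1 h2.
rewrite chart_force_diff normcM ler_wpM2l ?normc_ge0//.
apply: le_trans (ler_norm _); apply: normc_add_le.
  apply: normc_add_le => //; apply: normc_prod_le => //; exact: normc_add_le.
apply: normc_prod_le => //; apply: normc_add_le; last exact: normc_pow_le.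
by apply: normc_add_le; [exact: normc_pow_le|exact: normc_prod_le].
Qed.

Definition on_chart (Z s sg : R -> C) (t : R) : Prop :=
  [/\ chartdom (Z t), s t = chart (Z t) & sg t = dchart (Z t)].

Variables (Z s sg rho : R -> C) (th dth : R -> R) (a b : R).
Hypothesis Zc : forall t, a <= t <= b -> pcont Z a b t.
Hypothesis sc : forall t, a <= t <= b -> pcont s a b t.
Hypothesis sgc : forall t, a <= t <= b -> pcont sg a b t.
Hypothesis thm : forall t u, a <= t -> t <= u -> u <= b -> th t <= th u.

(** Near t the function s is bounded, so wp - k = 1 / s cannot tend to 0 and Z t remains in the
    domain of the chart. Both equalities then pass to the limit by continuity. *)
Lemma on_chart_closed t : a < t <= b -> (forall u, a <= u < t -> on_chart Z s sg u) ->
  on_chart Z s sg t.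
Proof.
move=> /andP[ta tb] H; have tab : a <= t <= b by rewrite ltW.
have left_pt (d : R) : 0 < d -> exists u, [/\ a <= u < t, a <= u <= b & `|u - t| < d].
  move=> d0; exists (Num.max a (t - d / 2)).
  have h1 : Num.max a (t - d / 2) < t by rewrite gt_max ta; lra.
  have h2 : a <= Num.max a (t - d / 2) by rewrite le_max lexx.
  have h3 : t - d / 2 <= Num.max a (t - d / 2) by rewrite le_max lexx orbT.
  move: (Num.max _ _) h1 h2 h3 => u *; split; [by apply/andP; split|apply/andP; split; lra|].
  by rewrite ltr_norml; apply/andP; split; lra.
have [M [u0 [d0 d0p MP]]] : exists M u0, exists2 d : R, 0 < d & forall u, a <= u <= b ->
    `|u - t| < d -> u0 = u0 :> R -> normc (s u) <= M.
  have [d d0 dH] := sc tab ltr01; exists (normc (s t) + 1), 0, d => // u uab ud _.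
  rewrite -(subrK (s t) (s u)) addrC; apply: normc_add_le => //; exact: dH.
have gt : chartdom (Z t).
  have [L|nL] := pselect (lattice w1 w2 (Z t)); first by left.
  right; apply/eqP => E; have oz : offlat (Z t) by apply/offlatP.
  have [d1 d10 H1] := offlat_near hw oz.
  have M1 : 0 < (`|M| + 2)^-1 by rewrite invr_gt0 ltr_wpDl.
  have [d2 d20 H2] := cder_cont (wp_cder hw (offlat_neq0 oz) (offlat_regular oz)) M1.
  have d12 : 0 < Num.min d1 d2 by rewrite lt_min d10.
  have [d3 d30 H3] := Zc tab d12.
  have [|u [u1 u2 u3]] := left_pt (Num.min d0 d3); first by rewrite lt_min d0p.
  move: u3; rewrite lt_min => /andP[/(MP u u2)/(_ erefl) sM /(H3 u u2)].
  rewrite le_min => /andP[/H1 + /H2]; rewrite subrKC => ou.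
  rewrite E => wu; have [gu su _] := H u u1.
  have uk : wp (Z u) != k by case: gu => // /latticeP[c /ou].
  have nk : 0 < normc (wp (Z u) - k) by rewrite normc_gt0 subr_eq0.
  move: sM; rewrite su chart_off// normcV.
  rewrite leNgt => /negP; apply; apply: (@lt_le_trans _ _ (`|M| + 2)).
    by rewrite (le_lt_trans (ler_norm _))// ltrDl.
  by rewrite -(invrK (_ + 2)) lef_pV2 ?posrE.
have key (f : C -> C) (Y : R -> C) l : cder f (Z t) l -> pcont Y a b t ->
    (forall u, a <= u < t -> Y u = f (Z u)) -> Y t = f (Z t).
  move=> fD Yc YE; apply/eqP; rewrite -subr_eq0 -normc_eq0 eq_le normc_ge0 andbT.
  apply/ler_addgt0Pl => eps eps0; rewrite addr0.
  have e2 : 0 < eps / 2 by rewrite divr_gt0.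
  have [d1 d10 H1] := cder_cont fD e2; have [d2 d20 H2] := Yc _ e2.
  have [d3 d30 H3] := Zc tab d10.
  have [|u [u1 u2]] := left_pt (Num.min d2 d3); first by rewrite lt_min d20.
  rewrite lt_min => /andP[/(H2 u u2) h2 /(H3 u u2)/H1]; rewrite subrKC => h1.
  rewrite (_ : _ - _ = (f (Z u) - f (Z t)) - (Y u - Y t)); last by rewrite (YE u u1); ring.
  rewrite (_ : eps = eps / 2 + eps / 2); last by field.
  by apply: normc_add_le; rewrite ?normcN.
split => //.
  by apply: key (chart_cder hw gt) (sc tab) _ => u /H[].
by apply: key (dchart_cder hw gt) (sgc tab) _ => u /H[].
Qed.

(** With A = s - chart and A' = sg - dchart, the Lipschitz bound M of [chart_force] gives (|A|^2 +
    |A'|^2)' <= (1 + M) |rho| (|A|^2 + |A'|^2), and |rho| <= th'. The equations are asked only to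
    the right of t, so rho may be infinite at t. *)
Lemma on_chart_step t (eta : R) : a <= t < b -> 0 < eta -> on_chart Z s sg t ->
  (forall u, t < u < t + eta -> u < b -> [/\ pder Z u (rho u), pder s u (sg u * rho u),
     pder sg u (chart_force (s u) * rho u), is_derive u (1 : R) th (dth u) &
     normc (rho u) <= dth u]) ->
  exists2 d, 0 < d & forall u, t < u < t + d -> u < b -> on_chart Z s sg u.
Proof.
move=> /andP[ta tb] eta0 [gt st sgt] H; have tab : a <= t <= b by rewrite ta ltW.
have [d1 d10 H1] := chartdom_open gt.
have [d2 d20 H2] := Zc tab d10.
have [d3 d30 H3] := cder_cont (chart_cder hw gt) (@ltr01 R).
have [d4 d40 H4] := Zc tab d30.
have [d5 d50 H5] := sc tab (@ltr01 R).
pose B := normc (s t) + 1; have [M M0 MP] := chart_force_lip B.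
pose d := Num.min eta (Num.min d2 (Num.min d4 d5)).
exists d; first by rewrite !lt_min eta0 d20 d40.
pose A u := s u - chart (Z u); pose A' u := sg u - dchart (Z u).
have loc u : t < u < t + d -> u < b ->
    [/\ chartdom (Z u), normc (s u) <= B, normc (chart (Z u)) <= B & u < t + eta].
  move=> /andP[tu]; rewrite -ltrBlDl !lt_min => /and4P[ueta ud2 ud4 ud5] ub.
  have uab : a <= u <= b by rewrite (le_trans ta) ?ltW.
  have ut : `|u - t| = u - t by rewrite ger0_norm// subr_ge0 ltW.
  split.
  - have := H1 _ (H2 u uab _); rewrite ut subrKC; exact.
  - rewrite -(subrK (s t) (s u)) addrC /B; apply: normc_add_le => //.
    by apply: H5; rewrite ?ut.
  - have := H3 _ (H4 u uab _); rewrite ut subrKC => /(_ ud4) h.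
    rewrite -(subrK (chart (Z t)) (chart (Z u))) addrC /B st.
    exact: normc_add_le.
  - by rewrite -ltrBlDl.
move=> c tcd cb.
have tc : t < c by case/andP: tcd.
have cd : c < t + d by case/andP: tcd.
pose e u := Re (A u) ^+ 2 + Im (A u) ^+ 2 + (Re (A' u) ^+ 2 + Im (A' u) ^+ 2).
pose L u := chart_force (s u) - chart_force (chart (Z u)).
have Ader u : t < u < t + d -> u < b ->
    pder A u (A' u * rho u) /\ pder A' u (L u * rho u).
  move=> utd ub; have [gu _ _ ueta] := loc u utd ub.
  have tue : t < u < t + eta by case/andP: utd => -> _.
  have [DZ Ds Dsg _ _] := H u tue ub; split.
    by rewrite /A' mulrBl; apply: pderB Ds (pder_comp DZ (chart_cder hw gu)).
  by rewrite /L mulrBl; apply: pderB Dsg (pder_comp DZ (dchart_cder hw gu)).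
pose de u := 2 * (Re (A u) * Re (A' u * rho u) + Im (A u) * Im (A' u * rho u) +
  (Re (A' u) * Re (L u * rho u) + Im (A' u) * Im (L u * rho u))).
have eE u : e u = normc (A u) ^+ 2 + normc (A' u) ^+ 2.
  rewrite /e; case: (A u) (A' u) => [x y] [x' y'] /=.
  by rewrite !sqr_sqrtr// addr_ge0 ?sqr_ge0.
have dot (x y : C) : Re x * Re y + Im x * Im y <= normc x * normc y.
  have -> : Re x * Re y + Im x * Im y = Re (x * conjc y).
    by case: x y => p q [p' q'] /=; ring.
  have -> : normc y = normc (conjc y) by case: y => p q /=; rewrite sqrrN.
  by rewrite -normcM (le_trans (ler_norm _))// normc_Re.
have ec0 : e c = 0.
  apply: (@gronwall_zero R e th de dth (1 + M) t c (th t) tc).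
  - by rewrite addr_ge0.
  - by move=> u; rewrite /e !addr_ge0 ?sqr_ge0.
  - move=> u /andP[tu uc]; have utd : t < u < t + d by rewrite tu (le_lt_trans uc).
    have ub : u < b by exact: le_lt_trans cb.
    have [DA DA'] := Ader u utd ub; have [gu sB cB ueta] := loc u utd ub.
    have tue : t < u < t + eta by rewrite tu.
    have [_ _ _ Dth rdth] := H u tue ub.
    split => //.
    + have D1 := pder_Re DA; have D2 := pder_Im DA.
      have D3 := pder_Re DA'; have D4 := pder_Im DA'.
      have -> : e = ((Re \o A) * (Re \o A) + (Im \o A) * (Im \o A)) +
        ((Re \o A') * (Re \o A') + (Im \o A') * (Im \o A')).
        by apply/funext => x; rewrite /e !expr2.
      apply: is_derive_eq (is_deriveD (is_deriveD (is_deriveM D1 D1) (is_deriveM D2 D2))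
        (is_deriveD (is_deriveM D3 D3) (is_deriveM D4 D4))) _.
      by rewrite /de /GRing.scale /=; ring.
    + have hL := MP _ _ sB cB; rewrite -/(L u) -/(A u) in hL.
      have N0 := @normc_ge0 R.
      have h1 := dot (A u) (A' u * rho u); have h2 := dot (A' u) (L u * rho u).
      rewrite !normcM in h1 h2.
      have h3 : normc (A' u) * (normc (L u) * normc (rho u)) <=
          normc (A' u) * (normc (A u) * M * normc (rho u)).
        by rewrite ler_wpM2l// ler_wpM2r.
      apply: (@le_trans _ _ (2 * (normc (A u) * normc (A' u)) * ((1 + M) * normc (rho u)))).
        rewrite /de; move: h1 h2 h3; rewrite !ReM !ImM; lra.
      rewrite [leRHS]mulrC; apply: ler_pM; rewrite ?mulr_ge0 ?addr_ge0//.
        rewrite eE -subr_ge0 (_ : _ - _ = (normc (A u) - normc (A' u)) ^+ 2); last by ring.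
        exact: sqr_ge0.
      by rewrite ler_wpM2l// addr_ge0.
    + by apply: thm => //; rewrite ltW.
  - have Ac (f : C -> C) (Y : R -> C) l : cder f (Z t) l -> pcont Y a b t -> Y t = f (Z t) ->
      forall eps : R, 0 < eps -> exists2 d' : R, 0 < d' &
        forall u, t < u < t + d' -> u <= c -> normc (Y u - f (Z u)) ^+ 2 <= eps.
      move=> fD Yc YE eps eps0.
      pose e1 := Num.min 1 eps; have e10 : 0 < e1 by rewrite lt_min ltr01.
      have e2 : 0 < e1 / 2 by rewrite divr_gt0.
      have [p p0 P1] := cder_cont fD e2; have [q q0 Q1] := Yc _ e2.
      have [r r0 R1] := Zc tab p0.
      exists (Num.min q r); first by rewrite lt_min q0.
      move=> u /andP[tu]; rewrite -ltrBlDl lt_min => /andP[uq ur] uc.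
      have uab : a <= u <= b by rewrite (le_trans ta (ltW tu)) (le_trans uc (ltW cb)).
      have ut : `|u - t| = u - t by rewrite ger0_norm// subr_ge0 ltW.
      have := R1 u uab; rewrite ut => /(_ ur)/P1; rewrite subrKC => h1.
      have := Q1 u uab; rewrite ut => /(_ uq) h2.
      have h3 : normc (Y u - f (Z u)) <= e1.
        rewrite (_ : _ - _ = (Y u - Y t) - (f (Z u) - f (Z t))); last by rewrite YE; ring.
        rewrite (_ : e1 = e1 / 2 + e1 / 2); last by field.
        by apply: normc_add_le; rewrite ?normcN.
      have h4 : e1 <= 1 by rewrite ge_min lexx.
      have h5 : e1 <= eps by rewrite ge_min lexx orbT.
      rewrite expr2; apply: le_trans h5; rewrite -[leRHS]mulr1.
      by apply: ler_pM; rewrite ?normc_ge0// (le_trans h3).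
    move=> eps eps0; have e2 : 0 < eps / 2 by rewrite divr_gt0.
    have [p p0 P1] := Ac _ _ _ (chart_cder hw gt) (sc tab) st _ e2.
    have [q q0 Q1] := Ac _ _ _ (dchart_cder hw gt) (sgc tab) sgt _ e2.
    exists (Num.min p q); first by rewrite lt_min p0.
    move=> u /andP[tu]; rewrite -ltrBlDl lt_min !ltrBlDl => /andP[up uq] uc.
    rewrite eE (_ : eps = eps / 2 + eps / 2); last by field.
    by apply: lerD; [apply: P1|apply: Q1] => //; rewrite tu.
have [gc _ _ _] := loc c tcd cb.
move: ec0; rewrite eE => /eqP; rewrite paddr_eq0 ?sqr_ge0// !expf_eq0 /= !normc_eq0.
by rewrite !subr_eq0 => /andP[/eqP sE /eqP sgE].
Qed.

Lemma chart_flow : a < b -> on_chart Z s sg a ->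
  (forall t, a <= t < b -> exists2 eta : R, 0 < eta &
    forall u, t < u < t + eta -> u < b -> [/\ pder Z u (rho u), pder s u (sg u * rho u),
     pder sg u (chart_force (s u) * rho u), is_derive u (1 : R) th (dth u) &
     normc (rho u) <= dth u]) ->
  forall t, a <= t <= b -> on_chart Z s sg t.
Proof.
move=> ab Ha H; apply: real_induction => // t tab.
  move=> Pt; have [eta eta0 etaH] := H t tab.
  have [d d0 dH] := on_chart_step tab eta0 Pt etaH.
  have tb : t < b by case/andP: tab.
  (* The endpoint b, where the equations may fail, is kept out of the step and is reached by
     [on_chart_closed]. *)
  exists (Num.min d (b - t)); first by rewrite lt_min d0 subr_gt0.
  move=> u /andP[tu]; rewrite -ltrBlDl lt_min ltrBlDl => /andP[ud ub] _.
  by apply: dH; [rewrite tu|lra].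
exact: on_chart_closed.
Qed.

End ChartFlow.

(** * The Carlson integral *)

Section TailIntegral.
Context {R : realType} (f : R -> R).
Local Notation mu := (@lebesgue_measure R).
Hypothesis f0 : forall x, 0 <= f x.
Hypothesis fi : mu.-integrable `[0, +oo[%classic (EFin \o f).

Definition prim (x : R) : R := \int[mu]_(t in `[0, x]) f t.
Definition total : R := \int[mu]_(t in `]0, +oo[) f t.

Let fi0 b : mu.-integrable `[0, b]%classic (EFin \o f).
Proof. by apply: integrableS fi => //; exact: subset_itvl. Qed.

Lemma total_cE : total = \int[mu]_(t in `[0, +oo[) f t.
Proof.
rewrite /total Rintegral_itv_obnd_cbnd//.
by apply: integrableS fi => //; apply: subset_itvr; rewrite bnd_simp.
Qed.

Lemma total_prim x : 0 <= x -> total - prim x = \int[mu]_(t in `]x, +oo[) f t.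
Proof. by move=> x0; rewrite total_cE /prim Rintegral_itvB. Qed.

Lemma prim_le x y : 0 <= x -> x <= y -> prim x <= prim y.
Proof.
move=> x0 xy; rewrite -subr_ge0 /prim (@Rintegral_itvB _ f (BLeft 0) (BRight y) x).
- by apply: Rintegral_ge0 => t _; exact: f0.
- exact: fi0.
- by rewrite bnd_simp.
- by rewrite bnd_simp.
Qed.

Lemma prim_le_total x : 0 <= x -> prim x <= total.
Proof. by move=> x0; rewrite -subr_ge0 total_prim//; apply: Rintegral_ge0 => t _; exact: f0. Qed.

Lemma prim0 : prim 0 = 0.
Proof. by rewrite /prim set_itv1 Rintegral_set1. Qed.

Lemma prim_total_lim (eps : R) : 0 < eps -> exists2 X : R, 0 <= X &
  forall x, X <= x -> total - prim x <= eps.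
Proof.
move=> eps0.
have : (\int[mu]_(x in `[0%R, n%:R]%classic) (f x)%:E)%E @[n --> \oo] -->
       (\int[mu]_(x in \bigcup_n `[0%R, n%:R]%classic) (f x)%:E)%E.
  apply: ge0_nondecreasing_set_cvg_integral => //.
  - move=> m n mn; rewrite subsetEset; apply: subset_itvl.
    by rewrite bnd_simp ler_nat.
  - by move=> n; exact: (measurable_int mu (fi0 _)).
  - by move=> n x _; rewrite lee_fin.
have -> : \bigcup_n `[0%R, n%:R]%classic = `[0, +oo[%classic :> set R.
  apply/seteqP; split => x /=.
    by move=> [n _] /=; rewrite !in_itv /= => /andP[->].
  rewrite in_itv /= andbT => x0; exists (Num.truncn x).+1 => //=.
  by rewrite in_itv /= x0 ltW// truncnS_gt.
have E n : (\int[mu]_(x in `[0%R, n%:R]%classic) (f x)%:E)%E = (prim n%:R)%:E.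
  by rewrite /prim /Rintegral fineK//; by apply: integrable_fin_num => //; exact: fi0.
have -> : (\int[mu]_(x in `[0%R, +oo[) (f x)%:E)%E = total%:E.
  by rewrite total_cE /Rintegral fineK//; exact: integrable_fin_num fi.
rewrite (eq_cvg _ _ E) => /fine_cvg h.
have {}h : prim n%:R @[n --> \oo] --> total by exact: h.
have /cvgrPdist_le/(_ _ eps0)[N _ HN] := h.
exists N%:R => // x Nx; have N0 : 0 <= N%:R :> R by [].
apply: le_trans (le_trans (ler_norm _) (HN N _)) => //=.
by rewrite lerD2l lerN2; exact: prim_le.
Qed.

Lemma prim_cont x (eps : R) : 0 <= x -> 0 < eps -> exists2 d : R, 0 < d &
  forall y, 0 <= y -> `|y - x| < d -> `|prim y - prim x| <= eps.
Proof.
move=> x0 eps0; have b0 : 0 <= x + 1 by rewrite addr_ge0.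
have b1 : 0 < x + 1 by rewrite ltr_wpDl.
have /(continuous_within_itvP _ b1)[c1 c2 _] :=
  parameterized_integral_continuous b0 (fi0 (x + 1)).
move: x0; rewrite le_eqVlt => /predU1P[x0|x0].
  move: c2 => /cvgrPdist_le/(_ _ eps0)[d /= d0 dH]; exists d => // y.
  rewrite -x0 le_eqVlt => /predU1P[<-|y0 yd]; first by move=> _; rewrite subrr normr0 ltW.
  by rewrite distrC; apply: dH => //; rewrite /= distrC.
have xI : x \in `]0, x + 1[ by rewrite in_itv /= x0 ltrDl ltr01.
have /cvgrPdist_le/(_ _ eps0)[d /= d0 dH] := c1 _ xI; exists d => // y _ yd.
by rewrite distrC; apply: dH => /=; rewrite distrC.
Qed.

Lemma prim_derive x : 0 < x -> {for x, continuous f} -> is_derive x (1 : R) prim (f x).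
Proof.
move=> x0 cf; have x1 : x < x + 1 by rewrite ltrDl.
have [D E] := continuous_FTC1_closed x1 (fi0 (x + 1)) x0 cf.
by apply: DeriveDef; [exact: D|rewrite -derive1E; exact: E].
Qed.

(* The tail integral from 1/tau - 1 to oo, as a function of tau in [0, 1]. *)
Definition tail (tau : R) : R :=
  if tau == 0 then 0 else total - prim (tau^-1 - 1).

Lemma tail0 : tail 0 = 0. Proof. by rewrite /tail eqxx. Qed.

Lemma tail1 : tail 1 = total.
Proof. by rewrite /tail oner_eq0 invr1 subrr prim0 subr0. Qed.

Let inv_ge (t : R) : 0 < t -> t <= 1 -> 0 <= t^-1 - 1.
Proof. by move=> t0 t1; rewrite subr_ge0 invf_ge1. Qed.

Lemma tail_le t u : 0 <= t -> t <= u -> u <= 1 -> tail t <= tail u.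
Proof.
rewrite le_eqVlt => /predU1P[<-|t0] tu u1.
  rewrite tail0 /tail; case: eqP => // /eqP u0; rewrite subr_ge0 prim_le_total//.
  by rewrite inv_ge// lt_neqAle eq_sym u0.
have u0 := lt_le_trans t0 tu.
rewrite /tail !gt_eqF// lerD2l lerN2 prim_le ?inv_ge// lerD2r lef_pV2//.
Qed.

Lemma tail_cont t (eps : R) : 0 <= t <= 1 -> 0 < eps -> exists2 d : R, 0 < d &
  forall u, 0 <= u <= 1 -> `|u - t| < d -> `|tail u - tail t| <= eps.
Proof.
move=> /andP[+ t1] eps0; rewrite le_eqVlt => /predU1P[<-|t0].
  have [X X0 XH] := prim_total_lim eps0.
  exists (X + 1)^-1; first by rewrite invr_gt0 ltr_wpDl.
  move=> u /andP[+ u1]; rewrite le_eqVlt => /predU1P[<-|u0 ud].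
    by move=> _; rewrite subrr normr0 ltW.
  rewrite tail0 subr0 /tail gt_eqF//.
  rewrite ger0_norm ?subr_ge0 ?prim_le_total ?inv_ge//; apply: XH.
  rewrite lerBrDr -(invrK (X + 1)) lef_pV2 ?posrE ?invr_gt0 ?ltr_wpDl//.
  by rewrite ltW// (le_lt_trans _ ud)// subr0 ler_norm.
have z0 := inv_ge t0 t1; have [d d0 dH] := prim_cont z0 eps0.
(* For u > t / 2 one has |1 / u - 1 / t| = |t - u| / (t u) <= 2 |t - u| / t^2. *)
exists (Num.min (t / 2) (d * t ^+ 2 / 2)).
  by rewrite lt_min !divr_gt0// mulr_gt0// exprn_gt0.
move=> u /andP[_ u1]; rewrite lt_min => /andP[ut ud].
have tu2 : t / 2 < u by move: ut; rewrite ltr_norml => /andP[+ _]; lra.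
have u0 : 0 < u by apply: lt_trans tu2; rewrite divr_gt0.
rewrite /tail !gt_eqF//.
rewrite (_ : _ - _ - _ = - (prim (u^-1 - 1) - prim (t^-1 - 1))); last by ring.
rewrite normrN; apply: dH; first exact: inv_ge.
rewrite (_ : _ - _ - _ = (t - u) / (t * u)); last by field; rewrite !gt_eqF.
rewrite normrM distrC normfV (gtr0_norm (mulr_gt0 t0 u0)) ltr_pdivrMr ?mulr_gt0//.
apply: lt_le_trans ud _; rewrite -mulrA ler_wpM2l ?(ltW d0)// expr2 -mulrA.
by rewrite ler_wpM2l ?(ltW t0)// ltW.
Qed.

Lemma tail_derive t : 0 < t < 1 -> {for (t^-1 - 1), continuous f} ->
  is_derive t (1 : R) tail (f (t^-1 - 1) / t ^+ 2).
Proof.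
move=> /andP[t0 t1] cf.
have z0 : 0 < t^-1 - 1 by rewrite subr_gt0 invf_gt1.
have D1 := prim_derive z0 cf.
have tn : t != 0 by rewrite gt_eqF.
have D2 : is_derive t (1 : R) (fun u : R => u^-1 - 1) (- t ^- 2).
  have D := is_deriveB (is_deriveV (f := id) tn (is_derive_id t (1 : R)))
    (is_derive_cst (1 : R) t (1 : R)).
  by apply: is_derive_eq D _; rewrite subr0 /GRing.scale /= mulr1.
have D3 := @is_derive1_comp _ prim (fun u : R => u^-1 - 1) t _ _ D1 D2.
have D4 : is_derive t (1 : R) (fun u => total - (prim \o (fun u : R => u^-1 - 1)) u) (f (t^-1 - 1) / t ^+ 2).
  apply: is_derive_eq (is_deriveB (is_derive_cst total t (1 : R)) D3) _; ring.
apply: is_derive_eps => eps eps0.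
have [d d0 dH] := eps_is_derive D4 eps0.
exists (Num.min d t); first by rewrite lt_min d0.
move=> h; rewrite lt_min => /andP[hd ht].
have th : t + h != 0 by apply/eqP => E; move: ht; rewrite ltr_norml => /andP[]; lra.
by rewrite /tail (negbTE tn) (negbTE th); exact: dH.
Qed.

End TailIntegral.

(** * A majorant with an inverse square root singularity *)

Section Majorant.
Context {R : realType}.
Local Notation mu := (@lebesgue_measure R).

(** On each compact piece the integral is a difference of two values of F, hence at most B + B;
    monotone convergence carries the bound to the union. *)
Lemma integral_exhaust_le (f F : R -> R) (u v : nat -> R) (B : R) :
  (forall n, u n < v n) ->
  (forall m n, (m <= n)%N -> u n <= u m /\ v m <= v n) ->
  (forall n x, u n <= x <= v n -> [/\ is_derive x (1 : R) F (f x),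
     {for x, continuous f} & 0 <= f x]) ->
  (forall x, `|F x| <= B) ->
  (\int[mu]_(x in \bigcup_n `[u n, v n]%classic) (f x)%:E <= (B + B)%:E)%E.
Proof.
move=> uv uvm H FB.
have cf n : {within `[u n, v n], continuous f}.
  apply: continuous_in_subspaceT => x; rewrite inE /= in_itv /= => xn.
  by have [_ + _] := H n x xn.
have h : (\int[mu]_(x in `[u n, v n]%classic) (f x)%:E)%E @[n --> \oo] -->
    (\int[mu]_(x in \bigcup_n `[u n, v n]%classic) (f x)%:E)%E.
  apply: ge0_nondecreasing_set_cvg_integral => //.
  - move=> m n mn; rewrite subsetEset; have [h1 h2] := uvm m n mn.
    by apply: subset_itv; rewrite bnd_simp.
  - move=> n; apply/measurable_EFinP.
    exact: subspace_continuous_measurable_fun.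
  - move=> n x; rewrite /= in_itv /= => xn; rewrite lee_fin.
    by have [_ _] := H n x xn.
rewrite -(cvg_lim _ h)//; apply: lime_le; first by apply/cvg_ex; eexists; exact: h.
apply: nearW => n.
have dF x : u n <= x <= v n -> derivable F x 1 by move=> /(H n)[[]].
have cF x : u n <= x <= v n -> {for x, continuous F}.
  by move=> /dF/derivable1_diffP/differentiable_continuous.
rewrite (@continuous_FTC2 _ f F _ _ (uv n) (cf n)).
- rewrite -EFinB lee_fin; apply: le_trans (ler_norm _) _.
  by apply: le_trans (ler_normB _ _) _; exact: lerD.
- split.
  + by move=> x; rewrite in_itv /= => /andP[h1 h2]; apply: dF; rewrite !ltW.
  + apply: cvg_at_right_filter; apply: cF; rewrite lexx ltW//.
  + apply: cvg_at_left_filter; apply: cF; rewrite lexx ltW//.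
- move=> x; rewrite in_itv /= => /andP[h1 h2].
  by rewrite derive1E; apply: derive_val; have [] := H n x; rewrite ?(ltW h1) ?(ltW h2).
Qed.

(* The antiderivative of the majorant on each side of a is 2 atan (sqrt |x - a|),
   so the majorant is integrable over the whole line. *)
Definition majorant (a x : R) : R := ((1 + `|x - a|) * Num.sqrt `|x - a|)^-1.

Lemma majorant_ge0 a x : 0 <= majorant a x.
Proof. by rewrite invr_ge0 mulr_ge0// addr_ge0. Qed.

Lemma majorant_cont a x : x != a -> {for x, continuous (majorant a)}.
Proof.
move=> xa; have xa0 : 0 < `|x - a| by rewrite normr_gt0 subr_eq0.
have cn : {for x, continuous (fun y => `|y - a|)}.
  by apply: cvg_norm; apply: cvgB; [exact: cvg_id|exact: cvg_cst].
apply: cvgV; first by rewrite mulf_neq0 ?gt_eqF ?sqrtr_gt0// addr_gt0.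
apply: cvgM; first by apply: cvgD; [exact: cvg_cst|exact: cn].
apply: (@continuous_comp _ _ _ (fun y => `|y - a|) (@Num.sqrt R)); first exact: cn.
exact: sqrt_continuous.
Qed.

Lemma majorant_derive (s a x : R) : s = 1 \/ s = -1 -> 0 < s * (x - a) ->
  is_derive x (1 : R) (fun y => s * (2 * atan (Num.sqrt (s * (y - a))))) (majorant a x).
Proof.
move=> s1 xa; have ss : s * s = 1 by case: s1 => ->; ring.
have E : `|x - a| = s * (x - a).
  by rewrite -(gtr0_norm xa) normrM; case: s1 => ->; rewrite ?normrN normr1 mul1r.
have D1 : is_derive x (1 : R) (fun y => s * (y - a)) s.
  have D := is_deriveZ s (is_deriveB (is_derive_id x (1 : R)) (is_derive_cst a x (1 : R))).
  by apply: is_derive_eq D _; rewrite subr0 /GRing.scale /= mulr1.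
have D2 := @is_derive1_comp _ _ (fun y => s * (y - a)) x _ _ (is_derive1_sqrt xa) D1.
have D3 := @is_derive1_comp _ atan _ x _ _ (is_derive1_atan _) D2.
have D4 := is_deriveZ s (is_deriveZ 2 D3).
apply: is_derive_eq D4 _; rewrite /majorant E /= /GRing.scale /= sqr_sqrtr ?(ltW xa)//.
have q0 : 0 < Num.sqrt (s * (x - a)) by rewrite sqrtr_gt0.
have p0 : 0 < 1 + s * (x - a) by rewrite addr_gt0.
move: p0 q0; move: (Num.sqrt _) (1 + _) => q p p0 q0.
rewrite (_ : s * _ = (s * s) / (p * q)); first by rewrite ss mul1r.
by field; rewrite !gt_eqF.
Qed.

Lemma atan_sqrt_bound (s y : R) : s = 1 \/ s = -1 ->
  `|s * (2 * atan (Num.sqrt y))| <= pi.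
Proof.
move=> s1; rewrite normrM (_ : `|s| = 1); last by case: s1 => ->; rewrite ?normrN normr1.
rewrite mul1r ler_norml; have := atan_gtNpi2 (Num.sqrt y).
by have := atan_ltpi2 (Num.sqrt y); move=> h1 h2; apply/andP; split; lra.
Qed.

(** On nonnegative numbers, 0 included, inversion agrees with [powR] at exponent -1. *)
Lemma measurable_inv_nneg (g : R -> R) : (forall x, 0 <= g x) ->
  measurable_fun setT g -> measurable_fun setT (fun x => (g x)^-1).
Proof.
move=> g0 mg; rewrite (_ : (fun x => _) = (@powR R ^~ (-1)) \o g).
  by apply: measurableT_comp => //; exact: measurable_powR.
by apply/funext => x; rewrite /= powR_inv1.
Qed.

Lemma measurable_majorant a : measurable_fun setT (majorant a).
Proof.
have mn : measurable_fun setT (fun x : R => `|x - a|).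
  by apply: continuous_measurable_fun => x; apply: cvg_norm; apply: cvgB;
    [exact: cvg_id|exact: cvg_cst].
apply: measurable_inv_nneg => [x|]; first by rewrite mulr_ge0// addr_ge0.
apply: measurable_funM; first exact: measurable_funD.
apply: (measurableT_comp (f := @Num.sqrt R)) => //.
by apply: continuous_measurable_fun; exact: sqrt_continuous.
Qed.

Let harm (n : nat) : R := n.+1%:R^-1.

Lemma majorant_right a :
  (\int[mu]_(x in `]a, +oo[%classic) (majorant a x)%:E <= (pi + pi)%:E)%E.
Proof.
(* The upper end uses n + 2: since [harm 0] is 1, the end n + 1 would make the interval of index 0
   degenerate. *)
have -> : `]a, +oo[%classic = \bigcup_n `[a + harm n, a + n.+2%:R]%classic :> set R.
  apply/seteqP; split => x /=.
    rewrite in_itv /= andbT => ax.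
    pose n := maxn (Num.truncn (x - a)) (Num.truncn (x - a)^-1).
    have xa : 0 < x - a by rewrite subr_gt0.
    exists n => //=; rewrite in_itv /= -lerBrDl -[x <= _]lerBlDl.
    apply/andP; split.
      rewrite /harm -(invrK (x - a)) lef_pV2 ?posrE ?invr_gt0//.
      apply: ltW; apply: lt_le_trans (truncnS_gt _) _.
      by rewrite ler_nat ltnS leq_maxr.
    apply: ltW; apply: lt_le_trans (truncnS_gt _) _.
    by rewrite ler_nat ltnS leqW// leq_maxl.
  move=> [n _] /=; rewrite !in_itv /= => /andP[h _]; rewrite andbT.
  by apply: lt_le_trans h; rewrite ltrDl invr_gt0.
have s1 : 1 = 1 :> R \/ 1 = -1 :> R by left.
apply: (integral_exhaust_le (F := fun y => 1 * (2 * atan (Num.sqrt (1 * (y - a)))))).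
- move=> n; rewrite ltrD2l; apply: (@le_lt_trans _ _ 1).
    by rewrite invf_le1// ler1n.
  by rewrite ltr1n.
- move=> m n mn; split; rewrite lerD2l; last by rewrite ler_nat !ltnS.
  by rewrite lef_pV2 ?posrE// ler_nat ltnS.
- move=> n x /andP[h _]; have xa : 0 < x - a.
    by rewrite subr_gt0 (lt_le_trans _ h)// ltrDl invr_gt0.
  split; [|by apply: majorant_cont; rewrite gt_eqF// -subr_gt0|exact: majorant_ge0].
  by apply: majorant_derive => //; rewrite mul1r.
- by move=> x; exact: atan_sqrt_bound.
Qed.

Lemma majorant_left a :
  (\int[mu]_(x in `]-oo, a[%classic) (majorant a x)%:E <= (pi + pi)%:E)%E.
Proof.
have -> : `]-oo, a[%classic = \bigcup_n `[a - n.+2%:R, a - harm n]%classic :> set R.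
  apply/seteqP; split => x /=.
    rewrite in_itv /= => ax.
    pose n := maxn (Num.truncn (a - x)) (Num.truncn (a - x)^-1).
    have xa : 0 < a - x by rewrite subr_gt0.
    exists n => //=; rewrite in_itv /=; apply/andP; split.
      rewrite lerBlDl -lerBlDr; apply: ltW; apply: lt_le_trans (truncnS_gt _) _.
      by rewrite ler_nat ltnS leqW// leq_maxl.
    rewrite lerBrDl -lerBrDr /harm -(invrK (a - x)) lef_pV2 ?posrE ?invr_gt0//.
    apply: ltW; apply: lt_le_trans (truncnS_gt _) _.
    by rewrite ler_nat ltnS leq_maxr.
  move=> [n _] /=; rewrite !in_itv /= => /andP[_ h].
  by apply: le_lt_trans h _; rewrite ltrBlDr ltrDl invr_gt0.
have s1 : -1 = 1 :> R \/ -1 = -1 :> R by right.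
apply: (integral_exhaust_le (F := fun y => -1 * (2 * atan (Num.sqrt (-1 * (y - a)))))).
- move=> n; rewrite ltrD2l ltrN2; apply: (@le_lt_trans _ _ 1).
    by rewrite invf_le1// ler1n.
  by rewrite ltr1n.
- move=> m n mn; split; rewrite lerD2l lerN2; first by rewrite ler_nat !ltnS.
  by rewrite lef_pV2 ?posrE// ler_nat ltnS.
- move=> n x /andP[_ h]; have xa : 0 < a - x.
    by rewrite subr_gt0 (le_lt_trans h)// ltrBlDr ltrDl invr_gt0.
  split; [|by apply: majorant_cont; rewrite lt_eqF// -subr_gt0|exact: majorant_ge0].
  by apply: majorant_derive => //; rewrite mulN1r opprB.
- by move=> x; exact: atan_sqrt_bound.
Qed.

Lemma majorant_integrable a (D : set R) : measurable D ->
  mu.-integrable D (EFin \o majorant a).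
Proof.
move=> mD; apply: (@integrableS _ _ _ mu setT) => //.
apply/integrableP; split; first by apply/measurable_EFinP; exact: measurable_majorant.
under eq_integral do rewrite /= ger0_norm ?majorant_ge0//.
have -> : [set: R] = `]-oo, a[%classic `|` ([set a] `|` `]a, +oo[%classic).
  apply/seteqP; split => x //= _; rewrite !in_itv /= andbT.
  by case: (ltgtP x a) => [|?|->]; [left|right; right|right; left].
have mm (A : set R) : measurable A -> measurable_fun A (EFin \o majorant a).
  by move=> mA; apply: measurable_funTS; apply/measurable_EFinP; exact: measurable_majorant.
rewrite ge0_integral_setU//=.
- rewrite ge0_integral_setU//=.
  + rewrite integral_set1 add0e.
    apply: (@le_lt_trans _ _ ((pi + pi)%:E + (pi + pi)%:E)%E); last by rewrite -EFinD ltry.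
    by apply: leeD; [exact: majorant_left|exact: majorant_right].
  + by apply: mm; apply: measurableU.
  + by move=> x _; rewrite lee_fin majorant_ge0.
  + by apply/disj_set2P; rewrite -subset0 => x [/= ->]; rewrite in_itv /= ltxx.
- exact: measurableU.
- by apply: mm; do ?apply: measurableU.
- by move=> x _; rewrite lee_fin majorant_ge0.
- apply/disj_set2P; rewrite -subset0 => x [/=]; rewrite in_itv /= => xa [xE|].
    by move: xa; rewrite xE ltxx.
  by rewrite in_itv /= andbT => /(lt_trans xa); rewrite ltxx.
Qed.

End Majorant.

(** * Integrability of the inverse square root of a cubic with simple roots *)

Section CubicRoots.
Context {R : realType} (g2 g3 e : R) (z1 z2 z3 : R[i]).
Local Notation C := R[i].
Local Notation mu := (@lebesgue_measure R).
Hypothesis fac : forall x : C, 4 * x ^+ 3 - g2%:C * x - g3%:C =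
  4 * ((x - z1) * (x - z2) * (x - z3)).
Hypotheses (n12 : z1 != z2) (n13 : z1 != z3) (n23 : z2 != z3).

Definition cubic (x : R) : R := 4 * x ^+ 3 - g2 * x - g3.

Lemma cubicC x : (cubic x)%:C = 4 * ((x%:C - z1) * (x%:C - z2) * (x%:C - z3)).
Proof.
by rewrite -fac /cubic !(rmorphB, rmorphXn, rmorphM) /= rmorph_nat.
Qed.

Lemma normr_cubic x : `|cubic x| =
  4 * (normc (x%:C - z1) * normc (x%:C - z2) * normc (x%:C - z3)).
Proof. by rewrite -normcR cubicC !normcM normc_nat. Qed.

(** Here a, b, d are the distances from x to the three roots, a being the smallest, and m is a lower
    bound for the separation of the roots. From m <= a + b <= 2 b follows c (1 + a) <= m / 4 + a / 2
    <= b, and likewise for d. *)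
Let near_bound (c a b d m : R) : 0 < m -> 0 < c -> c <= m / 4 -> c <= 1 / 2 ->
  0 <= a -> a <= b -> a <= d -> m <= a + b -> m <= a + d ->
  (2 * c * (1 + a)) ^+ 2 * a <= 4 * (a * b * d).
Proof.
move=> m0 c0 c1 c2 a0 ab ad mb md.
have h1 : c * (1 + a) <= b.
  apply: (@le_trans _ _ (c * 1 + 1 / 2 * a)); last lra.
  by rewrite mulrDr lerD2l ler_wpM2r.
have h2 : c * (1 + a) <= d.
  apply: (@le_trans _ _ (c * 1 + 1 / 2 * a)); last lra.
  by rewrite mulrDr lerD2l ler_wpM2r.
have h0 : 0 <= c * (1 + a) by rewrite mulr_ge0// ?(ltW c0)// addr_ge0.
have h3 := ler_pM h0 h0 h1 h2.
rewrite (_ : _ * a = 4 * (a * (c * (1 + a) * (c * (1 + a))))); last by ring.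
by rewrite ler_wpM2l// -(mulrA a b d) ler_wpM2l.
Qed.

Let major_bound (c d delta P : R) : 0 < c -> 0 < delta -> delta <= d ->
  (2 * c * (1 + d)) ^+ 2 * d <= P ->
  (Num.sqrt P)^-1 <= (2 * c)^-1 * ((1 + delta) * Num.sqrt delta)^-1.
Proof.
move=> c0 de0 ded dP; have d0 : 0 < d by exact: lt_le_trans ded.
rewrite -invfM lef_pV2 ?posrE; last 2 first.
- rewrite sqrtr_gt0; apply: lt_le_trans dP.
  by rewrite mulr_gt0// exprn_gt0// !mulr_gt0// addr_gt0.
- by rewrite !mulr_gt0// ?sqrtr_gt0// addr_gt0.
apply: (@le_trans _ _ (2 * c * (1 + d) * Num.sqrt d)).
  rewrite mulrA; apply: ler_pM; rewrite ?sqrtr_ge0//.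
  - by rewrite !mulr_ge0// ?(ltW c0)// addr_ge0// ltW.
  - by rewrite ler_wpM2l ?mulr_ge0// ?(ltW c0)// lerD2l.
  - by rewrite ler_wsqrtr.
have h : 0 <= 2 * c * (1 + d) by rewrite !mulr_ge0// ?(ltW c0)// addr_ge0// ltW.
rewrite -{1}(ger0_norm h) -sqrtr_sqr -sqrtrM ?sqr_ge0//.
by rewrite ler_wsqrtr.
Qed.

(** The nearest root produces the singularity and the other two factors are at least c (1 + a).
    Since |x - Re z| <= |x - z|, centring the majorants at the real parts also covers roots off the
    real line. *)
Lemma inv_sqrt_cubic_bound : exists2 B : R, 0 <= B & forall x,
  x != Re z1 -> x != Re z2 -> x != Re z3 ->
  (Num.sqrt `|cubic x|)^-1 <=
    B * (majorant (Re z1) x + majorant (Re z2) x + majorant (Re z3) x).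
Proof.
pose m := Num.min (normc (z1 - z2)) (Num.min (normc (z1 - z3)) (normc (z2 - z3))).
have m0 : 0 < m by rewrite !lt_min !normc_gt0 !subr_eq0 n12 n13.
have m12 : m <= normc (z1 - z2) by rewrite ge_min lexx.
have m13 : m <= normc (z1 - z3) by rewrite !ge_min lexx orbT.
have m23 : m <= normc (z2 - z3) by rewrite !ge_min lexx !orbT.
pose c := Num.min (m / 4) (1 / 2).
have c0 : 0 < c by rewrite lt_min !divr_gt0.
have c1 : c <= m / 4 by rewrite ge_min lexx.
have c2 : c <= 1 / 2 by rewrite ge_min lexx orbT.
exists (2 * c)^-1; first by rewrite invr_ge0 mulr_ge0// ltW.
move=> x x1 x2 x3; rewrite normr_cubic.
have M0 a := @majorant_ge0 R a x.
have tri (y z : C) : normc (y - z) <= normc (x%:C - y) + normc (x%:C - z).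
  rewrite (_ : y - z = (x%:C - z) - (x%:C - y)); last by ring.
  by rewrite addrC; apply: normc_add_le; rewrite ?normcN.
have pos (z : C) : x != Re z -> 0 < `|x - Re z| by rewrite normr_gt0 subr_eq0.
have le (z : C) : `|x - Re z| <= normc (x%:C - z).
  by have := normc_Re (x%:C - z); rewrite ReB.
have k0 : 0 <= (2 * c)^-1 by rewrite invr_ge0 mulr_ge0// ltW.
have t12 := le_trans m12 (tri z1 z2); have t13 := le_trans m13 (tri z1 z3).
have t23 := le_trans m23 (tri z2 z3).
have N1 := @normc_ge0 R (x%:C - z1); have N2 := @normc_ge0 R (x%:C - z2).
have N3 := @normc_ge0 R (x%:C - z3).
have fin (z : C) (P : R) : x != Re z ->
    (2 * c * (1 + normc (x%:C - z))) ^+ 2 * normc (x%:C - z) <= P ->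
    (Num.sqrt P)^-1 <= (2 * c)^-1 * majorant (Re z) x.
  by move=> xz; apply: major_bound; [|exact: pos|exact: le].
have [a12|a12] := leP (normc (x%:C - z1)) (normc (x%:C - z2)).
  have [a13|a13] := leP (normc (x%:C - z1)) (normc (x%:C - z3)).
    apply: le_trans (fin z1 _ x1 (near_bound m0 c0 c1 c2 N1 a12 a13 t12 t13)) _.
    by rewrite ler_wpM2l// -addrA lerDl addr_ge0.
  have a32 : normc (x%:C - z3) <= normc (x%:C - z2) by exact: le_trans (ltW a13) a12.
  rewrite addrC in t13; rewrite addrC in t23.
  have -> : normc (x%:C - z1) * normc (x%:C - z2) * normc (x%:C - z3) =
    normc (x%:C - z3) * normc (x%:C - z1) * normc (x%:C - z2) by ring.
  apply: le_trans (fin z3 _ x3 (near_bound m0 c0 c1 c2 N3 (ltW a13) a32 t13 t23)) _.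
  by rewrite ler_wpM2l// lerDr addr_ge0.
have [a23|a23] := leP (normc (x%:C - z2)) (normc (x%:C - z3)).
  rewrite addrC in t12.
  have -> : normc (x%:C - z1) * normc (x%:C - z2) * normc (x%:C - z3) =
    normc (x%:C - z2) * normc (x%:C - z1) * normc (x%:C - z3) by ring.
  apply: le_trans (fin z2 _ x2 (near_bound m0 c0 c1 c2 N2 (ltW a12) a23 t12 t23)) _.
  by rewrite ler_wpM2l// addrAC lerDr addr_ge0.
have a31 : normc (x%:C - z3) <= normc (x%:C - z1) by exact: ltW (lt_trans a23 a12).
rewrite addrC in t13; rewrite addrC in t23.
have -> : normc (x%:C - z1) * normc (x%:C - z2) * normc (x%:C - z3) =
  normc (x%:C - z3) * normc (x%:C - z1) * normc (x%:C - z2) by ring.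
apply: le_trans (fin z3 _ x3 (near_bound m0 c0 c1 c2 N3 a31 (ltW a23) t13 t23)) _.
by rewrite ler_wpM2l// lerDr addr_ge0.
Qed.

(** [Num.sqrt] vanishes on negative numbers and 0^-1 = 0, so this function is 0 where the cubic is
    negative and [isqrt_neg] is 0 where it is positive: at most one of them is nonzero at any t. *)
Definition isqrt_pos (t : R) : R := (Num.sqrt (cubic (e + t)))^-1.
Definition isqrt_neg (t : R) : R := (Num.sqrt (- cubic (e + t)))^-1.

Lemma isqrt_pos_ge0 t : 0 <= isqrt_pos t. Proof. by rewrite invr_ge0. Qed.
Lemma isqrt_neg_ge0 t : 0 <= isqrt_neg t. Proof. by rewrite invr_ge0. Qed.

Lemma inv_sqrt_abs (y : R) : (Num.sqrt y)^-1 <= (Num.sqrt `|y|)^-1.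
Proof.
have [y0|y0] := leP 0 y; first by rewrite ger0_norm.
by rewrite (ltr0_sqrtr y0) invr0 invr_ge0.
Qed.

Lemma cubic_shift_cont : continuous (fun t : R => cubic (e + t)).
Proof.
move=> t; rewrite /cubic.
have h : (e + x) @[x --> t] --> e + t by apply: cvgD; [exact: cvg_cst|exact: cvg_id].
apply: cvgB; last exact: cvg_cst.
apply: cvgB; apply: cvgM; (try exact: cvg_cst) => //.
under eq_fun do rewrite !exprS expr0 mulr1.
rewrite !exprS expr0 mulr1.
by apply: cvgM => //; apply: cvgM.
Qed.

Lemma majorant_shift a t : majorant a (e + t) = majorant (a - e) t.
Proof. by rewrite /majorant (_ : e + t - a = t - (a - e)); last by ring. Qed.

Lemma isqrt_integrable (s : R) : `|s| = 1 ->
  mu.-integrable `[0, +oo[%classic (EFin \o fun t => (Num.sqrt (s * cubic (e + t)))^-1).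
Proof.
move=> s1; pose f t := (Num.sqrt (s * cubic (e + t)))^-1.
have mf : measurable_fun setT f.
  apply: measurable_inv_nneg => [x|]; first exact: sqrtr_ge0.
  apply: continuous_measurable_fun => x.
  apply: (@continuous_comp _ _ _ (fun y => s * cubic (e + y)) (@Num.sqrt R)).
    by apply: cvgM; [exact: cvg_cst|exact: cubic_shift_cont].
  exact: sqrt_continuous.
(* At the centre a of a majorant its value is 0, because 0^-1 = 0, and the bound can fail; these
   three points form a null set. *)
pose N := [set Re z1 - e] `|` ([set Re z2 - e] `|` [set Re z3 - e]) : set R.
have mN : measurable N by do ?apply: measurableU.
have N0 : mu N = 0%E.
  apply: countable_lebesgue_measure0; apply: finite_set_countable.
  by rewrite /N !finite_setU; do ?split; exact: finite_set1.
have mD : measurable (`[0, +oo[%classic : set R) by [].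
have [B B0 HB] := inv_sqrt_cubic_bound.
apply: (proj2 (@negligible_integrable _ _ _ mu _ N _ mN mD _ N0)).
  by apply/measurable_EFinP; exact: measurable_funTS.
pose g t := B * (majorant (Re z1 - e) t + majorant (Re z2 - e) t + majorant (Re z3 - e) t).
have mDN : measurable (`[0, +oo[%classic `\` N : set R) by exact: measurableD.
apply: (@le_integrable _ _ _ mu _ mDN _ (EFin \o g)).
- by apply/measurable_EFinP; exact: measurable_funTS.
- move=> x [_ /= xN]; rewrite lee_fin.
  have g0 : 0 <= g x by rewrite mulr_ge0// !addr_ge0// majorant_ge0.
  rewrite (ger0_norm g0) ger0_norm ?invr_ge0// /g -!majorant_shift.
  apply: le_trans (HB (e + x) _ _ _).
  + by apply: le_trans (inv_sqrt_abs _) _; rewrite normrM s1 mul1r.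
  + by apply/eqP => E; apply: xN; left; rewrite /= -E; ring.
  + by apply/eqP => E; apply: xN; right; left; rewrite /= -E; ring.
  + by apply/eqP => E; apply: xN; right; right; rewrite /= -E; ring.
- rewrite (_ : EFin \o g = fun x => (B%:E * (((EFin \o majorant (Re z1 - e)) \+
    (EFin \o majorant (Re z2 - e))) \+ (EFin \o majorant (Re z3 - e))) x)%E);
    last by apply/funext.
  apply: integrableZl => //; apply: integrableD => //; last exact: majorant_integrable.
  by apply: integrableD => //; exact: majorant_integrable.
Qed.

Lemma isqrt_pos_integrable : mu.-integrable `[0, +oo[%classic (EFin \o isqrt_pos).
Proof.
have := @isqrt_integrable 1 (normr1 _); rewrite /isqrt_pos.
by under [fun t => (Num.sqrt (1 * _))^-1]eq_fun do rewrite mul1r.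
Qed.

Lemma isqrt_neg_integrable : mu.-integrable `[0, +oo[%classic (EFin \o isqrt_neg).
Proof.
have := @isqrt_integrable (-1) _; rewrite normrN normr1 => /(_ erefl).
by under [fun t => (Num.sqrt (-1 * _))^-1]eq_fun do rewrite mulN1r.
Qed.

(** Where h < 0 the function is locally the constant 0, by the conventions for [Num.sqrt] and for
    0^-1. *)
Lemma inv_sqrt_cont (h : R -> R) t : h t != 0 -> {for t, continuous h} ->
  {for t, continuous (fun u => (Num.sqrt (h u))^-1)}.
Proof.
move=> ht hc; have [h0|h0|h0] := ltgtP (h t) 0; last by rewrite h0 eqxx in ht.
  have Z : \forall u \near t, (Num.sqrt (h u))^-1 = 0.
    have Z0 : \forall u \near t, h u < 0 by exact: (cvgr_lt (h t) hc).
    by near=> u; rewrite ltr0_sqrtr ?invr0//; near: u.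
  apply/cvgrPdist_le => eps eps0; rewrite ltr0_sqrtr// invr0.
  by near=> u; rewrite (near Z u)// subrr normr0 ltW.
apply: cvgV; first by rewrite gt_eqF// sqrtr_gt0.
by apply: (@continuous_comp _ _ _ h (@Num.sqrt R)) => //; exact: sqrt_continuous.
Unshelve. all: by end_near. Qed.

Lemma isqrt_pos_cont t : cubic (e + t) != 0 -> {for t, continuous isqrt_pos}.
Proof. by move=> ht; apply: inv_sqrt_cont => //; exact: cubic_shift_cont. Qed.

Lemma isqrt_neg_cont t : cubic (e + t) != 0 -> {for t, continuous isqrt_neg}.
Proof.
move=> ht; apply: inv_sqrt_cont; first by rewrite oppr_eq0.
by apply: cvgN; exact: cubic_shift_cont.
Qed.

Lemma cubic_root x : cubic x = 0 -> [\/ x = Re z1, x = Re z2 | x = Re z3].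
Proof.
move=> /(congr1 (fun x => `|x|)); rewrite normr_cubic normr0 => /eqP.
rewrite !mulf_eq0 pnatr_eq0 /= !normc_eq0 !subr_eq0 -orbA => /or3P[]/eqP <-.
- by apply: Or31.
- by apply: Or32.
- by apply: Or33.
Qed.

End CubicRoots.

(** * Continuity and real square roots along paths *)

Section PathTools.
Context {R : realType}.
Local Notation C := R[i].

Lemma pcont_parts (Y : R -> C) (a b t : R) :
  (forall eps : R, 0 < eps -> exists2 d : R, 0 < d &
    forall u, a <= u <= b -> `|u - t| < d -> `|Re (Y u) - Re (Y t)| <= eps) ->
  (forall eps : R, 0 < eps -> exists2 d : R, 0 < d &
    forall u, a <= u <= b -> `|u - t| < d -> `|Im (Y u) - Im (Y t)| <= eps) ->
  pcont Y a b t.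
Proof.
move=> hr hi eps eps0; have e2 : 0 < eps / 2 by rewrite divr_gt0.
have [d d0 dH] := hr _ e2; have [d' d'0 dH'] := hi _ e2.
exists (Num.min d d'); first by rewrite lt_min d0.
move=> u uab; rewrite lt_min => /andP[/(dH u uab) h1 /(dH' u uab) h2].
apply: le_trans (normc_ReIm _) _; rewrite ReB ImB.
by rewrite (_ : eps = eps / 2 + eps / 2) ?lerD//; field.
Qed.

Lemma continuous_eps (g : R -> R) (a b t : R) : {for t, continuous g} ->
  forall eps : R, 0 < eps -> exists2 d : R, 0 < d &
    forall u, a <= u <= b -> `|u - t| < d -> `|g u - g t| <= eps.
Proof.
move=> /cvgrPdist_le gc eps /gc[d /= d0 dH]; exists d => // u _ ud.
by rewrite distrC; apply: dH; rewrite /= distrC.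
Qed.

Lemma avoid_point (a t : R) : exists2 d : R, 0 < d & forall u, t < u < t + d -> u != a.
Proof.
have [->|at0] := eqVneq a t; first by exists 1 => // u /andP[tu _]; rewrite gt_eqF.
exists `|a - t|; first by rewrite normr_gt0 subr_eq0.
move=> u /andP[tu ut]; apply/eqP => E; move: ut; rewrite -E.
by rewrite -ltrBlDl gtr0_norm ?subr_gt0// ltxx.
Qed.

(** The case h t < 0 is included: both the function near t and the stated derivative are then 0. *)
Lemma sqrt_derive (h : R -> R) (t h' : R) : h t != 0 -> is_derive t (1 : R) h h' ->
  is_derive t (1 : R) (fun u => Num.sqrt (h u)) (h' / 2 * (Num.sqrt (h t))^-1).
Proof.
move=> ht D; have hc : {for t, continuous h}.
  by apply/differentiable_continuous/derivable1_diffP; have [] := D.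
have [h0|h0|h0] := ltgtP (h t) 0; last by rewrite h0 eqxx in ht.
  have /= [d d0 dH] : \forall u \near t, h u < 0 by exact: (cvgr_lt (h t) hc).
  apply: is_derive_eps => eps eps0; exists d => // x xd.
  rewrite (ltr0_sqrtr h0) invr0 !mulr0 !subr0 ltr0_sqrtr ?normr0 ?mulr_ge0// ?ltW//.
  by apply: dH; rewrite /= opprD addrA subrr sub0r normrN.
have D2 := @is_derive1_comp _ _ h t _ _ (is_derive1_sqrt h0) D.
by apply: is_derive_eq D2 _; rewrite invfM; ring.
Qed.

Lemma sqrtc_real (y : R) : sqrtc (y%:C) = Num.sqrt y +i* Num.sqrt (- y).
Proof.
rewrite /sqrtc /= eqxx mul1r expr0n addr0 sqrtr_sqr.
have [y0|y0] := leP 0 y.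
  rewrite ger0_norm// subrr mul0r sqrtr0 (_ : (y + y) / 2 = y); last by field.
  by rewrite [Num.sqrt (- y)]ler0_sqrtr// oppr_le0.
rewrite ltr0_norm// addNr mul0r sqrtr0 (_ : (- y - y) / 2 = - y); last by field.
by rewrite [Num.sqrt y]ltr0_sqrtr.
Qed.

Lemma inv_sqrtc_parts (y : R) : (Num.sqrt y +i* Num.sqrt (- y))^-1 =
  (Num.sqrt y)^-1 +i* (- (Num.sqrt (- y))^-1).
Proof.
have [y0|y0|->] := ltgtP y 0.
- have h : Num.sqrt (- y) != 0 by rewrite gt_eqF// sqrtr_gt0 oppr_gt0.
  apply: (mulfI (_ : (Num.sqrt y +i* Num.sqrt (- y)) != 0)).
    by rewrite eq_complex /= (negbTE h) andbF.
  rewrite mulfV; last by rewrite eq_complex /= (negbTE h) andbF.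
  by rewrite ltr0_sqrtr// invr0; simpc; rewrite mulfV.
- have h : Num.sqrt y != 0 by rewrite gt_eqF// sqrtr_gt0.
  apply: (mulfI (_ : (Num.sqrt y +i* Num.sqrt (- y)) != 0)).
    by rewrite eq_complex /= (negbTE h).
  rewrite mulfV; last by rewrite eq_complex /= (negbTE h).
  by rewrite [Num.sqrt (- y)]ltr0_sqrtr ?oppr_lt0// invr0 oppr0; simpc; rewrite mulfV.
by rewrite oppr0 sqrtr0 -[Complex (0 : R) 0]/(0 : C) !invr0 oppr0.
Qed.

Lemma chart_forceR (w1 w2 : C) (g2 g3 k s : R) :
  60 * G4 w1 w2 = g2%:C -> 140 * G6 w1 w2 = g3%:C ->
  chart_force w1 w2 k%:C s%:C = (2 + 12 * k * s + 3 / 2 * (12 * k ^+ 2 - g2) * s ^+ 2 +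
    2 * (4 * k ^+ 3 - g2 * k - g3) * s ^+ 3)%:C.
Proof.
move=> hg2 hg3; rewrite /chart_force hg2 hg3.
have nC n : n%:R = (n%:R : R)%:C by rewrite (rmorph_nat (real_complex R)).
have XC (x : R) n : x%:C ^+ n = (x ^+ n)%:C by rewrite (rmorphXn (real_complex R)).
by rewrite !nC !XC -!(rmorphM, rmorphB, rmorphD, fmorphV).
Qed.

End PathTools.

(** * The Carlson integral inverts the Weierstrass function *)

Section CarlsonInverse.
Context {R : realType} (g2 g3 e : R) (z1 z2 z3 w1 w2 : R[i]).
Local Notation C := R[i].
Local Notation mu := (@lebesgue_measure R).
Local Notation wp := (wp w1 w2).
Local Notation epole := (epole w1 w2).
Local Notation cubic := (cubic g2 g3).
Local Notation isqrt_pos := (isqrt_pos g2 g3 e).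
Local Notation isqrt_neg := (isqrt_neg g2 g3 e).

Hypothesis fac : forall x : C, 4 * x ^+ 3 - g2%:C * x - g3%:C =
  4 * ((x - z1) * (x - z2) * (x - z3)).
Hypotheses (n12 : z1 != z2) (n13 : z1 != z3) (n23 : z2 != z3).
Hypothesis hw : real_independent w1 w2.
Hypothesis hg2 : 60 * G4 w1 w2 = g2%:C.
Hypothesis hg3 : 140 * G6 w1 w2 = g3%:C.
Hypothesis e0 : 0 <= cubic e.

Let posi := isqrt_pos_integrable e fac n12 n13 n23.
Let negi := isqrt_neg_integrable e fac n12 n13 n23.

Let sqrt_quarter (y : R) : Num.sqrt (y / 4) = Num.sqrt y / 2.
Proof.
have [y0|y0] := leP 0 y; last by rewrite !ltr0_sqrtr ?mul0r// pmulr_llt0.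
by rewrite sqrtrM// (_ : 4^-1 = (2^-1) ^+ 2 :> R) ?sqrtr_sqr ?ger0_norm//; field.
Qed.

(** The product under the root is cubic (e + t) / 4, a real number. The 4 produces the factor 2 that
    the 1 / 2 of [carlson_RF] cancels, and the inverse of a principal root on the negative axis has
    negative imaginary part. *)
Let carlson_integrand (t : R) :
  (sqrtc ((t%:C + (e%:C - z1)) * (t%:C + (e%:C - z2)) * (t%:C + (e%:C - z3))))^-1 =
  (2 * isqrt_pos t) +i* (2 * - isqrt_neg t).
Proof.
have -> : (t%:C + (e%:C - z1)) * (t%:C + (e%:C - z2)) * (t%:C + (e%:C - z3)) =
    (cubic (e + t) / 4)%:C.
  apply: (mulfI (_ : (4 : C) != 0)); first by rewrite pnatr_eq0.
  have -> : 4 * (cubic (e + t) / 4)%:C = (cubic (e + t))%:C.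
    by rewrite -(rmorph_nat (real_complex R)) -rmorphM /= [4 * _]mulrC divfK// pnatr_eq0.
  by rewrite (cubicC fac) !rmorphD /= !addrA [t%:C + _]addrC.
rewrite sqrtc_real inv_sqrtc_parts -mulNr !sqrt_quarter /isqrt_pos /isqrt_neg.
by rewrite !invfM !invrK mulrN ![2 * _]mulrC.
Qed.

Lemma carlson_RFE : carlson_RF (e%:C - z1) (e%:C - z2) (e%:C - z3) =
  total isqrt_pos +i* (- total isqrt_neg).
Proof.
have i0 (f : R -> R) : mu.-integrable `[0, +oo[%classic (EFin \o f) ->
    mu.-integrable `]0, +oo[%classic (EFin \o f).
  by move=> h; apply: integrableS h => //; apply: subset_itvr; rewrite bnd_simp.
rewrite /carlson_RF.
have -> : \int[mu]_(t in `]0, +oo[) Re (sqrtc ((t%:C + (e%:C - z1)) *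
    (t%:C + (e%:C - z2)) * (t%:C + (e%:C - z3))))^-1 = 2 * total isqrt_pos.
  under eq_Rintegral do rewrite carlson_integrand /=.
  by rewrite RintegralZl//; exact: i0.
have -> : \int[mu]_(t in `]0, +oo[) Im (sqrtc ((t%:C + (e%:C - z1)) *
    (t%:C + (e%:C - z2)) * (t%:C + (e%:C - z3))))^-1 = 2 * - total isqrt_neg.
  under eq_Rintegral do rewrite carlson_integrand /= mulrN -mulNr.
  by rewrite RintegralZl ?mulNr ?mulrN//; exact: i0.
have -> : (2 * total isqrt_pos) +i* (2 * - total isqrt_neg) =
    2 * (total isqrt_pos +i* (- total isqrt_neg)) :> C.
  by rewrite -(rmorph_nat (real_complex R)); simpc.
by rewrite mulrA mulVf ?mul1r// pnatr_eq0.
Qed.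

(** With this base point the value wp = e + (1 / tau - 1) has chart coordinate 1 / (wp - k) =
    tau. *)
Let k : R := e - 1.
Let p1 : R := 12 * k ^+ 2 - g2.
Let p0 : R := 4 * k ^+ 3 - g2 * k - g3.

(** The quartic with (chart')^2 = q(chart), that is t^4 cubic (k + 1 / t), expanded so that it also
    makes sense at t = 0. *)
Let q (t : R) : R := 4 * t + 12 * k * t ^+ 2 + p1 * t ^+ 3 + p0 * t ^+ 4.
Let dq (t : R) : R := 4 + 24 * k * t + 3 * p1 * t ^+ 2 + 4 * p0 * t ^+ 3.

Let qE t : t != 0 -> q t = (t ^+ 2) ^+ 2 * cubic (e + (t^-1 - 1)).
Proof. by move=> t0; rewrite /q /p1 /p0 /k /cubic; field. Qed.

Let q_derive t : is_derive t (1 : R) q (dq t).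
Proof.
pose f := fun u : R => u; have D1 : is_derive t (1 : R) f 1 := is_derive_id t (1 : R).
have D2 := is_deriveM D1 D1; have D3 := is_deriveM D1 D2; have D4 := is_deriveM D2 D2.
have D := is_deriveD (is_deriveD (is_deriveD (is_deriveZ 4 D1) (is_deriveZ (12 * k) D2))
  (is_deriveZ p1 D3)) (is_deriveZ p0 D4).
have -> : q = (4 *: f + (12 * k) *: (f * f) + p1 *: (f * (f * f)) +
    p0 *: ((f * f) * (f * f))).
  apply/funext => u; change (q u = 4 * u + 12 * k * (u * u) +
    p1 * (u * (u * u)) + p0 * ((u * u) * (u * u))).
  by rewrite /q; ring.
apply: is_derive_eq D _.
have fE g : (f * g) t = t * g t by [].
by rewrite /dq /GRing.scale /= !fE /f; ring.
Qed.

Let sqrt_q t : 0 < t -> Num.sqrt (q t) = t ^+ 2 * Num.sqrt (cubic (e + (t^-1 - 1))).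
Proof.
by move=> t0; rewrite qE ?gt_eqF// sqrtrM ?sqr_ge0// sqrtr_sqr ger0_norm ?sqr_ge0.
Qed.

Let sqrt_Nq t : 0 < t -> Num.sqrt (- q t) = t ^+ 2 * Num.sqrt (- cubic (e + (t^-1 - 1))).
Proof.
by move=> t0; rewrite qE ?gt_eqF// -mulrN sqrtrM ?sqr_ge0// sqrtr_sqr ger0_norm ?sqr_ge0.
Qed.

Let q_neq0 t : 0 < t -> q t != 0 -> cubic (e + (t^-1 - 1)) != 0.
Proof.
move=> t0; rewrite (qE (lt0r_neq0 t0)); apply: contraNneq => ->.
by rewrite mulr0.
Qed.

(** The speed [rho] of this path is 1 / [sg], where [sg] is the principal root of q. The chart
    coordinate is therefore expected to grow at speed 1 and to equal tau. *)
Let Z t : C := tail isqrt_pos t +i* (- tail isqrt_neg t).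
Let sg t : C := Num.sqrt (q t) +i* Num.sqrt (- q t).
Let rho t : C := (Num.sqrt (q t))^-1 +i* (- (Num.sqrt (- q t))^-1).
Let th t : R := tail isqrt_pos t + tail isqrt_neg t.
Let dth t : R := (Num.sqrt (q t))^-1 + (Num.sqrt (- q t))^-1.

Let pos_derive t : 0 < t < 1 -> q t != 0 ->
  is_derive t (1 : R) (tail isqrt_pos) (Num.sqrt (q t))^-1.
Proof.
move=> /[dup] /andP[t0 _] t01 qt.
have D := tail_derive posi t01 (isqrt_pos_cont (q_neq0 t0 qt)).
by apply: is_derive_eq D _; rewrite sqrt_q// [RHS]invfM mulrC.
Qed.

Let neg_derive t : 0 < t < 1 -> q t != 0 ->
  is_derive t (1 : R) (tail isqrt_neg) (Num.sqrt (- q t))^-1.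
Proof.
move=> /[dup] /andP[t0 _] t01 qt.
have D := tail_derive negi t01 (isqrt_neg_cont (q_neq0 t0 qt)).
by apply: is_derive_eq D _; rewrite sqrt_Nq// [RHS]invfM mulrC.
Qed.

Let flow_eqs t : 0 < t < 1 -> q t != 0 ->
  [/\ pder Z t (rho t), pder (fun u => u%:C) t (sg t * rho t),
      pder sg t (chart_force w1 w2 k%:C t%:C * rho t), is_derive t (1 : R) th (dth t) &
      normc (rho t) <= dth t].
Proof.
move=> t01 qt; have D1 := pos_derive t01 qt; have D2 := neg_derive t01 qt.
have nqt : - q t != 0 by rewrite oppr_eq0.
split.
- exact: pderP.
- rewrite /rho -inv_sqrtc_parts mulfV.
    by apply: pderR; exact: is_derive_id.
  rewrite /sg -sqrtc_real sqrtc_eq0 eq_complex /= negb_and qt//.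
- have -> : chart_force w1 w2 k%:C t%:C = (dq t / 2)%:C.
    by rewrite (chart_forceR _ _ hg2 hg3); congr (_%:C); rewrite /dq /p1 /p0; field.
  have -> : (dq t / 2)%:C * rho t = (dq t / 2 * (Num.sqrt (q t))^-1) +i*
      (- dq t / 2 * (Num.sqrt (- q t))^-1).
    by rewrite /rho; apply/eqP; rewrite eq_complex /=; apply/andP; split; apply/eqP; ring.
  apply: pderP; first exact: sqrt_derive.
  by apply: sqrt_derive => //; exact: is_deriveN.
- exact: is_deriveD.
- apply: le_trans (normc_ReIm _) _; rewrite /rho /= normrN.
  by rewrite !ger0_norm ?invr_ge0.
Qed.

Let q_cont t : {for t, continuous q}.
Proof.
by apply/differentiable_continuous/derivable1_diffP; have [] := q_derive t.
Qed.

Let q_roots t : 0 <= t < 1 -> exists2 eta : R, 0 < eta &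
  forall u, t < u < t + eta -> q u != 0.
Proof.
move=> /andP[t0 _].
(* For u > 0, q u = 0 makes e + 1 / u - 1 a real root of the cubic, so u is among the three numbers
   avoided here. *)
have [d1 d10 H1] := avoid_point (Re z1 - e + 1)^-1 t.
have [d2 d20 H2] := avoid_point (Re z2 - e + 1)^-1 t.
have [d3 d30 H3] := avoid_point (Re z3 - e + 1)^-1 t.
exists (Num.min d1 (Num.min d2 d3)); first by rewrite !lt_min d10 d20.
move=> u /andP[tu]; rewrite -ltrBlDl !lt_min !ltrBlDl => /and3P[h1 h2 h3].
have u0 : 0 < u by exact: le_lt_trans tu.
rewrite (qE (lt0r_neq0 u0)); apply: mulf_neq0; first by rewrite !expf_neq0 ?lt0r_neq0.
have key (a : R) : e + (u^-1 - 1) = a -> u = (a - e + 1)^-1.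
  by move=> <-; rewrite (_ : _ - e + 1 = u^-1) ?invrK//; ring.
apply/eqP => /(cubic_root fac)[] /key E.
- by have := H1 u; rewrite tu h1 -E eqxx => /(_ isT).
- by have := H2 u; rewrite tu h2 -E eqxx => /(_ isT).
- by have := H3 u; rewrite tu h3 -E eqxx => /(_ isT).
Qed.

Lemma carlson_chart : on_chart w1 w2 k%:C Z (fun u => u%:C) sg 1.
Proof.
apply: (@chart_flow R w1 w2 k%:C hw Z _ sg rho th dth 0 1) => //.
- move=> t t01; apply: pcont_parts => eps eps0 /=.
    exact: (tail_cont (@isqrt_pos_ge0 _ g2 g3 e) posi t01 eps0).
  have [d d0 dH] := tail_cont (@isqrt_neg_ge0 _ g2 g3 e) negi t01 eps0.
  by exists d => // u u01 /(dH u u01); rewrite -opprD normrN.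
- move=> t t01; apply: pcont_parts => eps eps0 /=; first by exists eps => // u _ /ltW.
  by exists 1 => // u _ _; rewrite subrr normr0 ltW.
- move=> t t01; apply: pcont_parts => eps eps0 /=.
    apply: continuous_eps => //.
    apply: (@continuous_comp _ _ _ q (@Num.sqrt R)); [exact: q_cont|exact: sqrt_continuous].
  apply: (continuous_eps (g := fun u => Num.sqrt (- q u))) => //.
  apply: (@continuous_comp _ _ _ (fun u => - q u) (@Num.sqrt R)).
    by apply: cvgN; exact: q_cont.
  exact: sqrt_continuous.
- move=> t u t0 tu u1; rewrite /th lerD//.
    exact: (tail_le (@isqrt_pos_ge0 _ g2 g3 e) posi).
  exact: (tail_le (@isqrt_neg_ge0 _ g2 g3 e) negi).
- have Z0 : Z 0 = 0 by rewrite /Z !tail0 oppr0.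
  have L0 : lattice w1 w2 (Z 0) by rewrite Z0; exact: lattice0.
  split; first by left.
    by rewrite chart_lat.
  rewrite dchart_lat// /sg (_ : q 0 = 0); last by rewrite /q; ring.
  by rewrite oppr0 sqrtr0.
- move=> t /[dup] /q_roots[eta eta0 H] /andP[t0 t1]; exists eta => // u utd u1.
  have u0 : 0 < u by case/andP: utd => tu _; exact: le_lt_trans tu.
  by apply: flow_eqs; [rewrite u0|exact: H].
- by rewrite ler01 lexx.
Qed.

Lemma carlson_inverse : let RF := carlson_RF (e%:C - z1) (e%:C - z2) (e%:C - z3) in
  [/\ ~ lattice w1 w2 RF, wp RF = e%:C & 2 * epole 3 RF = (Num.sqrt (cubic e))%:C].
Proof.
move=> RF; have Z1 : Z 1 = RF by rewrite /RF carlson_RFE /Z !tail1.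
have [_] := carlson_chart; rewrite Z1 => s1 sg1.
have nL : ~ lattice w1 w2 RF.
  by move=> L; move: s1; rewrite chart_lat// => /eqP; rewrite eq_complex /= oner_eq0.
have oRF : offlat w1 w2 RF by apply/offlatP.
have wE : wp RF - k%:C = 1.
  by move: s1; rewrite chart_off// => /(congr1 GRing.inv); rewrite invrK invr1.
split => //.
  by move/eqP: wE; rewrite subr_eq => /eqP ->; rewrite /k rmorphB /= addrC subrK.
move: sg1; rewrite dchart_off// wE invr1 expr1n mulr1 /sg => <-.
have -> : q 1 = cubic e by rewrite qE ?oner_eq0// invr1 subrr addr0 !expr1n mul1r.
by rewrite [Num.sqrt (- _)]ler0_sqrtr ?oppr_le0.
Qed.

End CarlsonInverse.

(** * Photon orbits *)

Section Geometry.
Context {R : realType} (lambda M Q : R).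
Local Notation Delta := (RNdS_Delta lambda M Q).
Local Notation g := (RNdS_metric lambda M Q).

Definition dDelta (r : R) : R := - 2 * lambda * r + 2 * M / r ^+ 2 - 2 * Q ^+ 2 / r ^+ 3.

Lemma Delta_derive r : r != 0 -> is_derive r (1 : R) Delta (dDelta r).
Proof.
move=> r0; pose f := fun u : R => u.
have D1 : is_derive r (1 : R) f 1 := is_derive_id r (1 : R).
have D2 := is_deriveM D1 D1.
have D3 := is_deriveV r0 D1.
have D4 := is_deriveM D3 D3.
have D := is_deriveD (is_deriveB (is_deriveB (is_derive_cst (1 : R) r (1 : R))
  (is_deriveZ lambda D2)) (is_deriveZ (2 * M) D3)) (is_deriveZ (Q ^+ 2) D4).
have -> : Delta = (cst 1 - lambda *: (f * f) - (2 * M) *: (fun y => (f y)^-1) +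
   Q ^+ 2 *: ((fun y => (f y)^-1) * (fun y => (f y)^-1))).
  apply/funext => u; change (Delta u = 1 - lambda * (u * u) - 2 * M * u^-1 + Q ^+ 2 * (u^-1 * u^-1)).
  by rewrite /RNdS_Delta -exprVn !expr2.
apply: is_derive_eq D _.
have fE (a b : R -> R) : (a * b) r = a r * b r by [].
by rewrite /dDelta /GRing.scale /= /f; field.
Qed.

Lemma derive_along (V : normedModType R) (f : V -> R) (x v : V) (l : R) :
  is_derive (0 : R) (1 : R) (fun h : R => f (h *: v + x)) l -> 'D_v f x = l.
Proof.
move=> D; rewrite -(@derive_val _ _ _ _ _ _ _ D) /derive /=.
congr (lim (_ @ 0^')); apply/funext => h /=.
by rewrite addr0 scale0r add0r -[h *: (1 : R)]/(h * 1) mulr1.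
Qed.

Definition gdiag (y : 'rV[R]_4) (i : 'I_4) : R :=
  [:: - Delta (y 0 cr); (Delta (y 0 cr))^-1; y 0 cr ^+ 2;
      y 0 cr ^+ 2 * sin (y 0 ctheta) ^+ 2]`_i.

Lemma metricE y i j : g y i j = gdiag y i *+ (i == j).
Proof. by rewrite /RNdS_metric !mxE. Qed.

(** The row of r is the one that enters the radial geodesic equation; the motion in t and phi is
    given by E and L. *)
Lemma metric_inv (x : 'rV[R]_4) (l : 'I_4) : RNdS_chart lambda M Q x ->
  invmx (g x) cr l = Delta (x 0 cr) *+ (l == cr).
Proof.
move=> [r0 D0 th].
have s0 : sin (x 0 ctheta) != 0 by rewrite gt_eqF// sin_gt0_pi.
have d0 i : gdiag x i != 0.
  rewrite /gdiag; case: i => [[|[|[|[|]]]]] //= _.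
  - by rewrite oppr_eq0.
  - by rewrite invr_eq0.
  - by rewrite expf_neq0// gt_eqF.
  - by rewrite mulf_neq0// expf_neq0// gt_eqF.
have U : g x \in unitmx.
  rewrite unitmxE /RNdS_metric det_diag unitfE; apply/prodf_neq0 => i _.
  by rewrite mxE; exact: d0.
have /matrixP/(_ cr l) := mulVmx U.
rewrite mxE (bigD1 l)//= big1 ?addr0; last first.
  by move=> j jl; rewrite metricE (negbTE jl) mulr0n mulr0.
rewrite metricE eqxx mulr1n mxE => /(canRL (mulfK (d0 l))) ->.
rewrite eq_sym; case: eqP => [->|_]; last by rewrite mul0r.
by rewrite /gdiag /= mul1r invrK.
Qed.

Lemma dmetric_offdiag (i j k : 'I_4) x : j != k -> dmetric g i j k x = 0.
Proof.
move=> jk; apply: derive_along.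
rewrite (_ : (fun h => _) = cst 0); first exact: is_derive_cst.
by apply/funext => h; rewrite metricE (negbTE jk).
Qed.

Lemma shift_coord (h : R) (i j : 'I_4) (x : 'rV[R]_4) :
  (h *: delta_mx 0 i + x) 0 j = h * (j == i)%:R + x 0 j.
Proof. by rewrite !mxE eqxx. Qed.

Lemma dmetric_rr (i : 'I_4) x : i != cr -> dmetric g i cr cr x = 0.
Proof.
move=> ir; apply: derive_along.
rewrite (_ : (fun h => _) = cst (gdiag x cr)); first exact: is_derive_cst.
apply/funext => h; rewrite metricE eqxx mulr1n /gdiag /=.
by rewrite !shift_coord [cr == i]eq_sym (negbTE ir) mulr0 add0r.
Qed.

Definition dgdiag (x : 'rV[R]_4) (i : 'I_4) : R :=
  [:: - dDelta (x 0 cr); - dDelta (x 0 cr) / Delta (x 0 cr) ^+ 2; 2 * x 0 cr;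
      2 * x 0 cr * sin (x 0 ctheta) ^+ 2]`_i.

Lemma dmetric_r (i : 'I_4) x : RNdS_chart lambda M Q x ->
  dmetric g cr i i x = dgdiag x i.
Proof.
move=> [r0 D0 _]; apply: derive_along.
have E h j : (h *: delta_mx 0 cr + x) 0 j = h * (j == cr)%:R + x 0 j.
  exact: shift_coord.
have D1 : is_derive (0 : R) (1 : R) (fun h : R => h + x 0 cr) 1.
  have D := is_deriveD (is_derive_id (0 : R) (1 : R)) (is_derive_cst (x 0 cr) (0 : R) (1 : R)).
  by apply: is_derive_eq D _; rewrite addr0.
have r0' : 0 + x 0 cr != 0 by rewrite add0r gt_eqF.
have D2 : is_derive (0 : R) (1 : R) (fun h : R => Delta (h + x 0 cr)) (dDelta (x 0 cr)).
  have D := @is_derive1_comp _ _ (fun h : R => h + x 0 cr) 0 _ _ (Delta_derive r0') D1.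
  by apply: is_derive_eq D _; rewrite add0r mulr1.
have D3 : is_derive (0 : R) (1 : R) (fun h : R => (h + x 0 cr) ^+ 2) (2 * x 0 cr).
  have -> : (fun h : R => (h + x 0 cr) ^+ 2) = (fun h : R => h + x 0 cr) * (fun h : R => h + x 0 cr).
    by apply/funext => h; rewrite expr2.
  apply: is_derive_eq (is_deriveM D1 D1) _.
  by rewrite /GRing.scale /= add0r; ring.
case: i => [[|[|[|[|]]]]] //= hi.
- rewrite (_ : (fun h => _) = fun h : R => - Delta (h + x 0 cr)).
    exact: is_deriveN.
  by apply/funext => h; rewrite metricE eqxx mulr1n /gdiag /= E mulr1.
- rewrite (_ : (fun h => _) = fun h : R => (Delta (h + x 0 cr))^-1).
    have D0' : Delta (0 + x 0 cr) != 0 by rewrite add0r.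
    have D := @is_deriveV R (fun h : R => Delta (h + x 0 cr)) 0 _ _ D0' D2.
    by apply: is_derive_eq D _; rewrite add0r /dgdiag /GRing.scale /= mulNr mulrC mulNr.
  by apply/funext => h; rewrite metricE eqxx mulr1n /gdiag /= E mulr1.
- rewrite (_ : (fun h => _) = fun h : R => (h + x 0 cr) ^+ 2); first exact: D3.
  by apply/funext => h; rewrite metricE eqxx mulr1n /gdiag /= E mulr1.
- rewrite (_ : (fun h => _) = fun h : R => sin (x 0 ctheta) ^+ 2 * (h + x 0 cr) ^+ 2).
    have D := is_deriveZ (sin (x 0 ctheta) ^+ 2) D3.
    by apply: is_derive_eq D _; rewrite /dgdiag /GRing.scale /=; ring.
  by apply/funext => h; rewrite metricE eqxx mulr1n /gdiag /= !E mulr1 mulr0 add0r mulrC.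
Qed.

(** The metric is diagonal and its rr entry depends on r alone, so only the symbols with i = j
    survive. *)
Lemma christoffel_r (i j : 'I_4) x : RNdS_chart lambda M Q x ->
  christoffel g cr i j x = 2^-1 * (Delta (x 0 cr) *
    (2 * dgdiag x cr *+ ((i == cr) && (j == cr)) - dgdiag x i *+ (i == j))).
Proof.
move=> cx; rewrite /christoffel; congr (_ * _).
rewrite (bigD1 cr)//= big1 ?addr0; last first.
  by move=> l lr; rewrite metric_inv// (negbTE lr) mulr0n mul0r.
rewrite metric_inv// eqxx mulr1n; congr (_ * (_ - _)); last first.
  by case: eqP => [->|/eqP ij]; [rewrite dmetric_r|rewrite dmetric_offdiag].
have dr (a b : 'I_4) : dmetric g a b cr x = dgdiag x cr *+ ((a == cr) && (b == cr)).
  have [->|bn] := eqVneq b cr; last by rewrite andbF dmetric_offdiag.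
  by have [->|an] := eqVneq a cr; [rewrite dmetric_r|rewrite dmetric_rr].
by rewrite !dr andbC; case: andP => _; rewrite ?mulr1n ?mulr0n ?addr0//; ring.
Qed.

Lemma radial_christoffel_sum (v : 'I_4 -> R) x : RNdS_chart lambda M Q x ->
  \sum_(i < 4) \sum_(j < 4) christoffel g cr i j x * v i * v j =
  2^-1 * Delta (x 0 cr) * dDelta (x 0 cr) * v ct ^+ 2 -
  2^-1 * dDelta (x 0 cr) / Delta (x 0 cr) * v cr ^+ 2 -
  x 0 cr * Delta (x 0 cr) * v ctheta ^+ 2 -
  x 0 cr * Delta (x 0 cr) * sin (x 0 ctheta) ^+ 2 * v cphi ^+ 2.
Proof.
move=> /[dup] cx [_ D0 _].
have E (i j : 'I_4) : christoffel g cr i j x * v i * v j =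
    2^-1 * (Delta (x 0 cr) * (2 * dgdiag x cr *+ ((i == cr) && (j == cr)) -
      dgdiag x i *+ (i == j))) * v i * v j by rewrite christoffel_r.
under eq_bigr do under eq_bigr do rewrite E.
have o0 : ord0 = ct :> 'I_4 by apply: val_inj.
have o1 : lift ord0 ord0 = cr :> 'I_4 by apply: val_inj.
have o2 : lift ord0 (lift ord0 ord0) = ctheta :> 'I_4 by apply: val_inj.
have o3 : lift ord0 (lift ord0 (lift ord0 ord0)) = cphi :> 'I_4 by apply: val_inj.
rewrite !big_ord_recl !big_ord0 !o3 !o2 !o1 !o0 /=.
rewrite !mulr1n !mulr0n /dgdiag /=.
by field.
Qed.

End Geometry.

(** * The radial quartic and its flow in the chart *)

Section Orbit.
Context {R : realType} (delta M Q rbar : R).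
Local Notation C := R[i].

(** The value of (dr/dphi)^2 on the orbit as a function of r. *)
Definition quartic (x : R) : R := delta * x ^+ 4 - x ^+ 2 + 2 * M * x - Q ^+ 2.

Definition dquartic (x : R) : R := 4 * delta * x ^+ 3 - 2 * x + 2 * M.

(** [taylor1], [taylor2] and [taylor3] are alpha, beta and c: together with delta, the Taylor
    coefficients of [quartic] at rbar. *)
Definition taylor1 : R := 4 * rbar ^+ 3 * delta - 2 * rbar + 2 * M.

Definition taylor2 : R := 6 * rbar ^+ 2 * delta - 1.

Definition taylor3 : R := 4 * rbar * delta.

Definition inv2 : R := 4^-1 * (taylor2 ^+ 2 / 3 - taylor1 * taylor3).

Definition inv3 : R := 8^-1 * (taylor1 * taylor2 * taylor3 / 6 -
  taylor1 ^+ 2 * delta / 2 - taylor2 ^+ 3 / 27).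

(** When alpha = 0, g2 = beta^2 / 12 and g3 = - beta^3 / 216. So a nonzero discriminant forces alpha
    <> 0, that is, rbar is a simple root. *)
Lemma inv_discr0 : taylor1 = 0 -> inv2 ^+ 3 - 27 * inv3 ^+ 2 = 0.
Proof. by rewrite /inv2 /inv3 => ->; field. Qed.

Hypothesis a0 : taylor1 != 0.

Section Flow.
Context {w1 w2 : C}.
Hypothesis hw : real_independent w1 w2.
Hypothesis hg2 : 60 * G4 w1 w2 = inv2%:C.
Hypothesis hg3 : 140 * G6 w1 w2 = inv3%:C.

(** Both sides are the second derivative in phi of s = 4 (r - rbar) / alpha, one from the chart
    equation and one from r'' = [dquartic] / 2. Matching the powers of r - rbar is what determines
    g2 and g3. *)
Lemma orbit_force x :
  chart_force w1 w2 (taylor2 / 12)%:C (4 * (x - rbar) / taylor1)%:C =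
  (2 / taylor1 * dquartic x)%:C.
Proof.
rewrite (chart_forceR _ _ hg2 hg3); congr (_%:C).
have E : dquartic x = taylor1 + 2 * taylor2 * (x - rbar) +
    3 * taylor3 * (x - rbar) ^+ 2 + 4 * delta * (x - rbar) ^+ 3.
  by rewrite /dquartic /taylor1 /taylor2 /taylor3; ring.
by rewrite E /inv2 /inv3; move: (taylor1) (taylor2) a0 => a b a0'; field.
Qed.

Variables (L : R) (r ph w : R -> R).

Let Z (z0 : C) t : C := z0 + (ph t)%:C.
Let s t : C := (4 * (r t - rbar) / taylor1)%:C.
Let sg t : C := (4 / taylor1 * w t)%:C.

(** The comparison runs in the affine parameter, with phi' = L / r^2 as speed. The increasing
    function for the Gronwall rate is the sign of L times phi, whatever that sign is. *)
Lemma orbit_flow (z0 : C) (a b : R) : L != 0 -> a < b ->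
  (forall t, a <= t <= b -> [/\ r t != 0, is_derive t (1 : R) ph (L / r t ^+ 2),
    is_derive t (1 : R) r (L * w t / r t ^+ 2) &
    is_derive t (1 : R) w (L * dquartic (r t) / (2 * r t ^+ 2))]) ->
  on_chart w1 w2 (taylor2 / 12)%:C (Z z0) s sg a ->
  on_chart w1 w2 (taylor2 / 12)%:C (Z z0) s sg b.
Proof.
move=> L0 ab H Ha.
have cd (f : R -> R) t l : is_derive t (1 : R) f l -> {for t, continuous f}.
  by move=> D; apply/differentiable_continuous/derivable1_diffP; have [] := D.
have pc (f : R -> R) t l : is_derive t (1 : R) f l -> pcont (fun u => (f u)%:C) a b t.
  move=> D; apply: pcont_parts => eps eps0 /=; last first.
    by exists 1 => // u _ _; rewrite subrr normr0 ltW.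
  by apply: continuous_eps => //; exact: cd D.
have Ds t l : is_derive t (1 : R) r l ->
    is_derive t (1 : R) (fun u => 4 * (r u - rbar) / taylor1) (4 / taylor1 * l).
  move=> D; rewrite (_ : (fun u => _) = (4 / taylor1) *: (r - cst rbar)).
    by have := is_deriveZ (4 / taylor1) (is_deriveB D (is_derive_cst rbar t (1 : R))); rewrite subr0.
  apply/funext => u; change (4 * (r u - rbar) / taylor1 = 4 / taylor1 * (r u - rbar)).
  by rewrite mulrAC.
have Dsg t l : is_derive t (1 : R) w l ->
    is_derive t (1 : R) (fun u => 4 / taylor1 * w u) (4 / taylor1 * l).
  by move=> D; exact: is_deriveZ.
have Dth t l : is_derive t (1 : R) ph l ->
    is_derive t (1 : R) (fun u => Num.sg L * ph u) (Num.sg L * l).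
  by move=> D; exact: is_deriveZ.
apply: (@chart_flow R w1 w2 (taylor2 / 12)%:C hw (Z z0) s sg (fun t => (L / r t ^+ 2)%:C)
  (fun t => Num.sg L * ph t) (fun t => `|L| / r t ^+ 2) a b) => //.
- move=> t /H[_ D _ _] eps eps0; have [d d0 dH] := pc _ _ _ D _ eps0.
  exists d => // u uab ud; rewrite /Z (_ : _ - _ = (ph u)%:C - (ph t)%:C); last by ring.
  exact: dH.
- by move=> t /H[_ _ D _]; exact: pc (Ds _ _ D).
- by move=> t /H[_ _ _ D]; exact: pc (Dsg _ _ D).
- move=> t u at_ tu ub.
  have [->//|tu'] := eqVneq t u; have {}tu : t < u by rewrite lt_neqAle tu'.
  have tuab x : t <= x <= u -> a <= x <= b.
    by move=> /andP[tx xu]; rewrite (le_trans at_ tx) (le_trans xu ub).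
  have [||x xtu E] := @MVT R (fun x => Num.sg L * ph x)
    (fun x => Num.sg L * (L / r x ^+ 2)) t u tu.
  + move=> x; rewrite in_itv /= => /andP[/ltW tx /ltW xu].
    by apply: Dth; have [] := H x _; rewrite ?tuab ?tx.
  + apply: derivable_within_continuous => x; rewrite in_itv /= => /tuab/H[_ D _ _].
    by have [] := Dth _ _ D.
  + rewrite -subr_ge0 E mulr_ge0 ?subr_ge0 ?(ltW tu)// mulrA -normrEsg.
    by rewrite divr_ge0 ?sqr_ge0 ?normr_ge0.
- move=> t /andP[at_ tb]; exists 1 => // u /andP[tu _] ub.
  have [r0 D1 D2 D3] : [/\ r u != 0, is_derive u (1 : R) ph (L / r u ^+ 2),
    is_derive u (1 : R) r (L * w u / r u ^+ 2) &
    is_derive u (1 : R) w (L * dquartic (r u) / (2 * r u ^+ 2))].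
    by apply: H; rewrite (le_trans at_ (ltW tu)) ltW.
  split.
  + by rewrite -[(_ / _)%:C]add0r; apply: pderD; [exact: pder_cst|exact: pderR].
  + rewrite /sg -rmorphM; apply: pderR; apply: is_derive_eq (Ds _ _ D2) _.
    by rewrite -!mulrA; congr (_ * (_ * _)); rewrite mulrCA.
  + rewrite /s orbit_force -rmorphM; apply: pderR; apply: is_derive_eq (Dsg _ _ D3) _.
    by move: (taylor1) a0 => a' a0'; field; rewrite r0.
  + apply: is_derive_eq (Dth _ _ D1) _; rewrite mulrA -normrEsg//.
  + by rewrite normcR normrM normfV [`|_ ^+ 2|]ger0_norm ?sqr_ge0.
- by rewrite ltW//= lexx.
Qed.

End Flow.
End Orbit.

(** * Equations of motion of an equatorial photon *)

Section PhotonOrbit.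
Context {R : realType} (lambda M Q L E : R).
Context (I : set R) (gamma : R -> 'rV[R]_4).
Local Notation coord := Defs.coord.
Local Notation Delta := (RNdS_Delta lambda M Q).
Local Notation delta := (lambda + E ^+ 2 / L ^+ 2).
Local Notation r := (coord gamma cr).
Local Notation dr := (derive1 (coord gamma cr)).

(* On the orbit this is dr/dphi, as phi' = L / r^2. *)
Definition radial_momentum t : R := r t ^+ 2 * dr t / L.

Hypothesis L0 : L != 0.
Hypothesis hgeod : geodesic (RNdS_metric lambda M Q) (RNdS_chart lambda M Q) I gamma.
Hypothesis hnull : null_curve (RNdS_metric lambda M Q) I gamma.
Hypothesis hequat : equatorial I gamma.
Hypothesis henergy : has_energy lambda M Q I gamma E.
Hypothesis hangmom : has_angular_momentum I gamma L.

Lemma is_derive_coord k t : I t ->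
  is_derive t (1 : R) (coord gamma k) (derive1 (coord gamma k) t).
Proof.
move=> It; have [_ _ _ /(_ t It)[_ /(_ k) D _ _]] := hgeod.
by rewrite derive1E; exact: derivableP.
Qed.

Let theta_derive t : I t -> derive1 (coord gamma ctheta) t = 0.
Proof.
move=> It; have [oI _ _ _] := hgeod; rewrite derive1E.
rewrite (@near_eq_derive _ _ _ _ (cst (pi / 2))) ?derive_cst//.
by apply: filterS (open_nbhs_nbhs (conj oI It)) => u /hequat.
Qed.

Let t_derive t : I t -> derive1 (coord gamma ct) t = E / Delta (r t).
Proof.
move=> It; have [_ _ _ /(_ t It)[[_ D0 _] _ _ _]] := hgeod.
by rewrite -(henergy It) mulrAC divff ?mul1r.
Qed.

Lemma phi_derive t : I t -> derive1 (coord gamma cphi) t = L / r t ^+ 2.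
Proof.
move=> It; have [_ _ _ /(_ t It)[[r0 _ _] _ _ _]] := hgeod.
by rewrite -(hangmom It) mulrAC divff ?mul1r// expf_neq0// lt0r_neq0.
Qed.

Let sin_equator t : I t -> sin (gamma t 0 ctheta) = 1.
Proof. by move=> /hequat; rewrite /coord => ->; exact: sin_pihalf. Qed.

(** The null condition, with t' and phi' eliminated through E and L. *)
Lemma photon_energy t : I t -> dr t ^+ 2 = E ^+ 2 - Delta (r t) * L ^+ 2 / r t ^+ 2.
Proof.
move=> It; have [_ _ _ /(_ t It)[[r0 D0 _] _ _ _]] := hgeod.
have := hnull It; rewrite (eq_bigr (fun i => gdiag lambda M Q (gamma t) i *
    derive1 (coord gamma i) t ^+ 2)); last first.
  move=> i _; rewrite (bigD1 i)//= big1 ?addr0.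
    by rewrite metricE eqxx mulr1n -mulrA -expr2.
  by move=> j ji; rewrite metricE eq_sym (negbTE ji) mulr0n !mul0r.
have o0 : ord0 = ct :> 'I_4 by apply: val_inj.
have o1 : lift ord0 ord0 = cr :> 'I_4 by apply: val_inj.
have o2 : lift ord0 (lift ord0 ord0) = ctheta :> 'I_4 by apply: val_inj.
have o3 : lift ord0 (lift ord0 (lift ord0 ord0)) = cphi :> 'I_4 by apply: val_inj.
rewrite !big_ord_recl big_ord0 o3 o2 o1 o0 theta_derive// t_derive// phi_derive//.
rewrite /gdiag /= sin_equator//.
move: r0 D0; rewrite /coord; set x := gamma t 0 cr; set D := Delta x => r0 D0.
rewrite !expr0n /= mulr0 add0r addr0 expr1n mulr1 => H.
apply: (mulfI (invr_neq0 D0)); apply/eqP; rewrite -subr_eq0; apply/eqP.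
by rewrite -[RHS]H; field; rewrite ?D0 ?lt0r_neq0.
Qed.

(** Taken from the geodesic equation: differentiating [photon_energy] would require a division by
    r', which vanishes at turning points. *)
Lemma photon_radial t : I t -> derive1 dr t =
  L ^+ 2 * (Delta (r t) / r t ^+ 3 - dDelta lambda M Q (r t) / (2 * r t ^+ 2)).
Proof.
move=> It; have [_ _ _ /(_ t It)[/[dup] cx [r0 D0 _] _ _ /(_ cr)]] := hgeod.
have := radial_christoffel_sum (fun i => derive1 (coord gamma i) t) cx.
move=> -> /eqP; rewrite addr_eq0 => /eqP ->.
rewrite theta_derive// t_derive// phi_derive// sin_equator// photon_energy//.
move: r0 D0; rewrite /coord; set x := gamma t 0 cr; set D := Delta x => r0 D0.
by field; rewrite D0/= lt0r_neq0.
Qed.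

Lemma photon_orbit t : I t -> [/\ 0 < r t,
  is_derive t (1 : R) (coord gamma cphi) (L / r t ^+ 2),
  is_derive t (1 : R) r (L * radial_momentum t / r t ^+ 2),
  is_derive t (1 : R) radial_momentum (L * dquartic delta M (r t) / (2 * r t ^+ 2)) &
  radial_momentum t ^+ 2 = quartic delta M Q (r t)].
Proof.
move=> It; have [_ _ _ /(_ t It)[[r0 _ _] _ dd _]] := hgeod.
have r0' : r t != 0 by exact: lt0r_neq0.
have Dr := is_derive_coord cr It; split => //.
- by rewrite -phi_derive//; exact: is_derive_coord.
- apply: is_derive_eq Dr _; rewrite /radial_momentum.
  by field; rewrite L0 r0'.
- have Ddr : is_derive t (1 : R) dr (derive1 dr t) by rewrite derive1E; exact: derivableP.
  rewrite (_ : radial_momentum = L^-1 *: (r * r * dr)); last first.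
    apply/funext => u; change (r u ^+ 2 * dr u / L = L^-1 * (r u * r u * dr u)).
    by rewrite expr2 mulrC.
  apply: is_derive_eq (is_deriveZ _ (is_deriveM (is_deriveM Dr Dr) Ddr)) _.
  have fE (f g : R -> R) : (f * g) t = f t * g t by [].
  rewrite /GRing.scale /= fE photon_radial// mulrDr.
  have -> : dr t * (r t * dr t + r t * dr t) = 2 * r t * dr t ^+ 2 by ring.
  rewrite photon_energy// /dDelta /RNdS_Delta /dquartic; field.
  by rewrite L0 r0'.
- rewrite /radial_momentum expr_div_n exprMn photon_energy// /RNdS_Delta /quartic.
  by field; rewrite L0 r0'.
Qed.

End PhotonOrbit.

(** * Discriminant of the cubic and inversion of the chart *)

Section RootsAndChart.
Context {R : realType}.
Local Notation C := R[i].

(** Evaluation at 0, 1 and -1 replaces the comparison of coefficients: b = -2 a, g2 = 12 a^2 and g3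
    = -8 a^3. *)
Lemma double_root_discr (g2 g3 a b : C) :
  (forall x, 4 * x ^+ 3 - g2 * x - g3 = 4 * ((x - a) * (x - a) * (x - b))) ->
  g2 ^+ 3 - 27 * g3 ^+ 2 = 0.
Proof.
move=> H; have h0 : g3 = 4 * (a * a * b).
  by apply: oppr_inj; have := H 0; rewrite expr0n /= !mulr0 !subr0 sub0r => ->; ring.
have n2 (n : nat) : n != 0%N -> (n%:R : C) != 0 by rewrite pnatr_eq0.
have h1 : b = - 2 * a.
  have : (4 * 1 ^+ 3 - g2 * 1 - g3) + (4 * (-1) ^+ 3 - g2 * (-1) - g3) = - 2 * g3 by ring.
  rewrite !H h0 => E; apply/eqP; rewrite -subr_eq0; apply/eqP.
  by apply: (mulfI (n2 8 isT)); apply/eqP; rewrite -subr_eq0; apply/eqP; move: E => /eqP;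
    rewrite -subr_eq0 => /eqP E; rewrite -[RHS]oppr0 -[in RHS]E; ring.
have h2 : g2 = 12 * a ^+ 2.
  have := H 1; rewrite h0 h1 => E; apply/eqP; rewrite -subr_eq0; apply/eqP.
  by move: E => /eqP; rewrite -subr_eq0 => /eqP E; rewrite -[RHS]oppr0 -[in RHS]E; ring.
by rewrite h0 h1 h2; ring.
Qed.

Lemma chart_solve (w1 w2 z : C) (rbar x a b : R) : a != 0 ->
  chartdom w1 w2 (b / 12)%:C z ->
  (4 * (x - rbar) / a)%:C = chart w1 w2 (b / 12)%:C z ->
  let den := 4 * wp w1 w2 z - (b / 3)%:C in
  (lattice w1 w2 z -> x = rbar) /\
  (~ lattice w1 w2 z -> den != 0 /\ x%:C = rbar%:C + a%:C / den).
Proof.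
move=> a0 dom sE den; split.
  move=> Lz; move: sE; rewrite chart_lat// => -[] /eqP.
  by rewrite !mulf_eq0 pnatr_eq0 invr_eq0 (negbTE a0) orbF /= subr_eq0 => /eqP.
move=> nL; case: dom => // wk; have oz := (offlatP w1 w2 z).1 nL.
have fourC : (4 : C) != 0 by rewrite pnatr_eq0.
have denE : den = 4 * (wp w1 w2 z - (b / 12)%:C).
  rewrite /den mulrBr; congr (_ - _).
  by rewrite -(rmorph_nat (real_complex R)) -rmorphM; congr (_%:C); field.
have d0 : den != 0 by rewrite denE mulf_neq0// subr_eq0.
split => //; move: sE; rewrite chart_off// => sE.
have aC : a%:C != 0 by rewrite eq_complex /= negb_and a0.
have -> : x%:C = rbar%:C + (x - rbar)%:C.
  by rewrite -rmorphD; congr (_%:C); ring.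
have -> : (x - rbar)%:C = a%:C / 4 * (4 * (x - rbar) / a)%:C.
  rewrite -[4 : C](rmorph_nat (real_complex R)) -fmorphV -!rmorphM; congr (_%:C).
  by field.
by rewrite sE denE invfM mulrA.
Qed.

End RootsAndChart.

(** * The starting point z0 on the chart *)

Section InitialPoint.
Context {R : realType} (delta M Q rbar : R) (w1 w2 z1 z2 z3 : R[i]).
Local Notation C := R[i].
Local Notation alpha := (taylor1 delta M rbar).
Local Notation beta := (taylor2 delta rbar).
Local Notation g2 := (inv2 delta M rbar).
Local Notation g3 := (inv3 delta M rbar).

Hypothesis a0 : alpha != 0.
Hypothesis hw : real_independent w1 w2.
Hypothesis hg2 : 60 * G4 w1 w2 = g2%:C.
Hypothesis hg3 : 140 * G6 w1 w2 = g3%:C.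
Hypothesis fac : forall x : C, 4 * x ^+ 3 - g2%:C * x - g3%:C =
  4 * ((x - z1) * (x - z2) * (x - z3)).
Hypotheses (n12 : z1 != z2) (n13 : z1 != z3) (n23 : z2 != z3).
Hypothesis hrbar : quartic delta M Q rbar = 0.

(** For x <> rbar the cubic at e is the square of alpha w / (4 (x - rbar)^2), so it is nonnegative
    and [carlson_inverse] fixes wp and the modulus of wp'. As wp is even and wp' odd, the sign of
    alpha w decides between RF and - RF. For x = rbar the quartic vanishes, hence w = 0, in
    agreement with a pole of wp. *)
Lemma initial_chart (x w : R) : w ^+ 2 = quartic delta M Q x ->
  let e := (alpha / (4 * (x - rbar)) + beta / 12)%:C in
  let RF := carlson_RF (e - z1) (e - z2) (e - z3) in
  let z0 := if x == rbar then 0 else if 0 <= alpha * w then RF else - RF in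
  [/\ chartdom w1 w2 (beta / 12)%:C z0,
      (4 * (x - rbar) / alpha)%:C = chart w1 w2 (beta / 12)%:C z0 &
      (4 / alpha * w)%:C = dchart w1 w2 (beta / 12)%:C z0].
Proof.
move=> wE e RF z0; rewrite /z0; have [xr|xr] := eqVneq x rbar.
  have L0 := lattice0 w1 w2; split; [by left| |].
    by rewrite chart_lat// xr subrr mulr0 mul0r.
  move/eqP: wE; rewrite xr hrbar sqrf_eq0 => /eqP ->.
  by rewrite dchart_lat// mulr0.
have u0 : x - rbar != 0 by rewrite subr_eq0.
set er := alpha / (4 * (x - rbar)) + beta / 12.
have cE : cubic g2 g3 er = (alpha * w / (4 * (x - rbar) ^+ 2)) ^+ 2.
  have qE : quartic delta M Q x = alpha * (x - rbar) + beta * (x - rbar) ^+ 2 +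
      taylor3 delta rbar * (x - rbar) ^+ 3 + delta * (x - rbar) ^+ 4.
    apply/eqP; rewrite -subr_eq0; apply/eqP; rewrite -[RHS]hrbar.
    by rewrite /quartic /taylor1 /taylor2 /taylor3; ring.
  rewrite expr_div_n exprMn wE qE /cubic /er /inv2 /inv3.
  by move: (x - rbar) u0 (alpha) (beta) => u u0 a b; field.
have c0 : 0 <= cubic g2 g3 er by rewrite cE sqr_ge0.
have [nL wpE epE] := carlson_inverse fac n12 n13 n23 hw hg2 hg3 c0.
rewrite -/RF in nL wpE epE.
have oRF := (offlatP w1 w2 RF).1 nL.
have oNRF : offlat w1 w2 (- RF).
  by move=> c E; apply: (oRF (- c)); rewrite latN -E opprK.
have sqE : Num.sqrt (cubic g2 g3 er) = `|alpha * w| / (4 * (x - rbar) ^+ 2).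
  rewrite cE sqrtr_sqr normrM normfV; congr (_ / _).
  by rewrite ger0_norm// mulr_ge0// sqr_ge0.
have kE : er%:C - (beta / 12)%:C = (alpha / (4 * (x - rbar)))%:C.
  by rewrite -rmorphB /er addrK.
have kN : (alpha / (4 * (x - rbar)))%:C != 0.
  rewrite eq_complex /= negb_and mulf_neq0// invr_eq0 mulf_neq0// pnatr_eq0//.
have iE : ((alpha / (4 * (x - rbar)))%:C)^-1 = (4 * (x - rbar) / alpha)%:C.
  by rewrite -fmorphV; congr (_%:C); rewrite invf_div.
have key (z : C) (y : R) : offlat w1 w2 z -> wp w1 w2 z = er%:C ->
    2 * epole w1 w2 3 z = (y / (4 * (x - rbar) ^+ 2))%:C -> y = alpha * w ->
    [/\ chartdom w1 w2 (beta / 12)%:C z,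
      (4 * (x - rbar) / alpha)%:C = chart w1 w2 (beta / 12)%:C z &
      (4 / alpha * w)%:C = dchart w1 w2 (beta / 12)%:C z].
  move=> oz zE ez yE; split.
  - by right; rewrite zE -subr_eq0 kE.
  - by rewrite chart_off// zE kE iE.
  - rewrite dchart_off// zE kE iE ez -rmorphXn -rmorphM yE; congr (_%:C).
    by move: (x - rbar) u0 (alpha) a0 => u u0' a a0'; field; rewrite u0' a0'.
case: ifPn => aw.
  by apply: key oRF wpE _ (erefl _); rewrite epE sqE ger0_norm.
apply: key oNRF _ _ (erefl _); first by rewrite wpN.
rewrite epoleN3//; last exact: offlat_regular.
rewrite mulrN epE sqE ltr0_norm ?ltNge// -rmorphN; congr (_%:C).
by rewrite mulNr opprK.
Qed.

End InitialPoint.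

(** [orbit_flow] only moves forward. Earlier points are reached by reversing the affine parameter,
    which turns L into - L. *)
Lemma orbit_reach {R : realType} (delta M rbar : R) (w1 w2 z0 : R[i]) (L : R)
    (I : set R) (r ph w : R -> R) (t0 t : R) :
  taylor1 delta M rbar != 0 -> real_independent w1 w2 ->
  60 * G4 w1 w2 = (inv2 delta M rbar)%:C -> 140 * G6 w1 w2 = (inv3 delta M rbar)%:C ->
  L != 0 -> is_interval I ->
  (forall t, I t -> [/\ r t != 0, is_derive t (1 : R) ph (L / r t ^+ 2),
    is_derive t (1 : R) r (L * w t / r t ^+ 2) &
    is_derive t (1 : R) w (L * dquartic delta M (r t) / (2 * r t ^+ 2))]) ->
  let Y t := on_chart w1 w2 (taylor2 delta rbar / 12)%:C (fun t => z0 + (ph t)%:C)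
    (fun t => (4 * (r t - rbar) / taylor1 delta M rbar)%:C)
    (fun t => (4 / taylor1 delta M rbar * w t)%:C) t in
  I t0 -> I t -> Y t0 -> Y t.
Proof.
move=> a0 hw hg2 hg3 L0 iI H Y I0 It Y0.
have [tt|tt|<-//] := ltgtP t0 t.
  apply: (orbit_flow a0 hw hg2 hg3 L0 tt) => // u /andP[tu ut].
  by apply: H; apply: (iI _ _ I0 It); rewrite tu.
have tt' : - t0 < - t by rewrite ltrN2.
have L0' : - L != 0 by rewrite oppr_eq0.
have DN u : is_derive u (1 : R) (fun v : R => - v) (-1).
  exact: is_deriveN (is_derive_id u (1 : R)).
have := @orbit_flow R delta M rbar a0 w1 w2 hw hg2 hg3 (- L) (fun u => r (- u))
  (fun u => ph (- u)) (fun u => w (- u)) z0 (- t0) (- t) L0' tt'.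
rewrite /on_chart !opprK; apply=> // u /andP[tu ut].
have [r0 D1 D2 D3] := H (- u) (iI _ _ It I0 (- u) ltac:(by rewrite lerNr ut lerNl tu)).
split=> //.
- apply: is_derive_eq (@is_derive1_comp _ ph _ u _ _ D1 (DN u)) _; ring.
- apply: is_derive_eq (@is_derive1_comp _ r _ u _ _ D2 (DN u)) _; ring.
- apply: is_derive_eq (@is_derive1_comp _ w _ u _ _ D3 (DN u)) _; ring.
Qed.

(* RF is the solution z of wp(z) = wp0 selected by the principal square root, for
   which wp'(z) <= 0; the solution is -RF when the prescribed derivative at 0 of
   wp(z0 + phi), which is - alpha dr0 / (4 (r0 - rbar)^2), is positive. At a pole
   of wp the formula reads rbar + alpha / oo = rbar. *)
Theorem corollary4p2p3 (R : realType) (lambda M Q : R)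
  (hM : 0 <= M) (hQ : 0 <= Q)
  (L E r0 dr0 : R) (hL : L != 0) (hE : 0 < E) (hr0 : 0 < r0)
  (hLE : 0 <= lambda * L ^+ 2 + E ^+ 2)
  (I : set R) (gamma : R -> 'rV[R]_4)
  (hgeod : maximal_geodesic (RNdS_metric lambda M Q) (RNdS_chart lambda M Q)
             I gamma)
  (hnull : null_curve (RNdS_metric lambda M Q) I gamma)
  (hequat : equatorial I gamma)
  (hcirc : ~ circular I gamma) (hrad : ~ radial I gamma)
  (henergy : has_energy lambda M Q I gamma E)
  (hangmom : has_angular_momentum I gamma L)
  (D : set R) (r : R -> R) (hpolar : polar_parametrization I gamma D r)
  (hD0 : D 0) (hr0E : r 0 = r0) (hdr0E : is_derive (0 : R) (1 : R) r dr0)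
  (rbar : R)
  (hrbar : (lambda + E ^+ 2 / L ^+ 2) * rbar ^+ 4 - rbar ^+ 2
             + 2 * M * rbar - Q ^+ 2 = 0) :
  let delta := lambda + E ^+ 2 / L ^+ 2 in
  let c := 4 * rbar * delta in
  let beta := 6 * rbar ^+ 2 * delta - 1 in
  let alpha := 4 * rbar ^+ 3 * delta - 2 * rbar + 2 * M in
  let g2 := 4^-1 * (beta ^+ 2 / 3 - alpha * c) in
  let g3 := 8^-1 * (alpha * beta * c / 6 - alpha ^+ 2 * delta / 2
                    - beta ^+ 3 / 27) in
  g2 ^+ 3 - 27 * g3 ^+ 2 != 0 ->
  forall w1 w2 : R[i], weierstrass_periods g2%:C g3%:C w1 w2 ->
  forall z1 z2 z3 : R[i],
  (4 *: 'X^3 - g2%:C *: 'X - g3%:C%:P : {poly R[i]})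
    = 4 *: (('X - z1%:P) * ('X - z2%:P) * ('X - z3%:P)) ->
  let wp0 := (alpha / (4 * (r0 - rbar)) + beta / 12)%:C in
  let RF := carlson_RF (wp0 - z1) (wp0 - z2) (wp0 - z3) in
  let z0 := if r0 == rbar then 0 else
            if 0 <= alpha * dr0 then RF else - RF in
  forall phi : R, D phi ->
    let z := z0 + phi%:C in
    let den := 4 * weierstrass_p w1 w2 z - (beta / 3)%:C in
    (lattice w1 w2 z -> r phi = rbar) /\
    (~ lattice w1 w2 z ->
       den != 0 /\ (r phi)%:C = rbar%:C + alpha%:C / den).
Proof.
move=> delta c beta alpha g2 g3 disc w1 w2 [hw hp2 hp3] z1 z2 z3 hpoly wp0 RF z0 phi Dphi z den.
have [hg _] := hgeod.
have hg2 : 60 * G4 w1 w2 = g2%:C by rewrite hp2 lattice_sumE.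
have hg3 : 140 * G6 w1 w2 = g3%:C by rewrite hp3 lattice_sumE.
have fac (x : R[i]) : 4 * x ^+ 3 - g2%:C * x - g3%:C = 4 * ((x - z1) * (x - z2) * (x - z3)).
  by have := congr1 (fun p => p.[x]) hpoly; rewrite !hornerE.
have discC : g2%:C ^+ 3 - 27 * g3%:C ^+ 2 != 0.
  have -> : g2%:C ^+ 3 - 27 * g3%:C ^+ 2 = (g2 ^+ 3 - 27 * g3 ^+ 2)%:C.
    by rewrite -(rmorph_nat (real_complex R)) -!rmorphXn -rmorphM -rmorphB.
  by rewrite eq_complex /= negb_and disc.
have n12 : z1 != z2.
  apply: contraNneq discC => E12; apply/eqP; apply: (double_root_discr (a := z2) (b := z3)).
  by move=> x; rewrite fac E12.
have n13 : z1 != z3.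
  apply: contraNneq discC => E13; apply/eqP; apply: (double_root_discr (a := z3) (b := z2)).
  by move=> x; rewrite fac E13; ring.
have n23 : z2 != z3.
  apply: contraNneq discC => E23; apply/eqP; apply: (double_root_discr (a := z3) (b := z1)).
  by move=> x; rewrite fac E23; ring.
have a0 : taylor1 delta M rbar != 0.
  by apply: contraNneq disc => /inv_discr0 H; apply/eqP.
have orbit := photon_orbit hL hg hnull hequat henergy hangmom.
have [DE rE] := hpolar.
(* The comparison runs along the geodesic, from a parameter [t0] over the angle 0 to a parameter [t]
   over the angle [phi]. *)
have [t0 It0 p0] : exists2 t, I t & Defs.coord gamma cphi t = 0 by move: hD0; rewrite DE.
have [t It pt] : exists2 t, I t & Defs.coord gamma cphi t = phi by move: Dphi; rewrite DE.
have r0E : Defs.coord gamma cr t0 = r0 by rewrite -rE// p0.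
have mE : radial_momentum L gamma t0 = dr0.
  (* Chain rule for r composed with phi: dr/dl = dr0 L / r^2 at [t0], so the prescribed slope is the
     radial momentum there. *)
  have [_ D1 _ _ _] := orbit _ It0; rewrite -p0 in hdr0E.
  have D2 := @is_derive1_comp _ r (Defs.coord gamma cphi) t0 _ _ hdr0E D1.
  have [oI _ _ _] := hg.
  have D3 : is_derive t0 (1 : R) (Defs.coord gamma cr) (dr0 * (L / Defs.coord gamma cr t0 ^+ 2)).
    by apply: near_eq_is_derive D2; apply: filterS (open_nbhs_nbhs (conj oI It0)) => u /rE.
  rewrite /radial_momentum derive1E derive_val r0E; field.
  by rewrite hL gt_eqF.
have wE : dr0 ^+ 2 = quartic delta M Q r0.
  by have [_ _ _ _] := orbit _ It0; rewrite mE r0E.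
have [dom0 s0 sg0] := initial_chart a0 hw hg2 hg3 fac n12 n13 n23 hrbar wE.
have [_ iI _ _] := hg.
have := @orbit_reach R delta M rbar w1 w2 z0 L I (Defs.coord gamma cr)
  (Defs.coord gamma cphi) (radial_momentum L gamma) t0 t a0 hw hg2 hg3 hL iI _ It0 It.
case=> [u /orbit[ru D1 D2 D3 _]||dom s _].
- by split=> //; exact: lt0r_neq0.
- by split; rewrite p0 addr0 ?mE ?r0E.
rewrite pt in dom s; have [HL HN] := chart_solve a0 dom s.
have rphi : r phi = Defs.coord gamma cr t by rewrite -pt rE.
rewrite rphi; split=> // nL; have := HN nL.
by rewrite /den /wp weierstrass_pE.
Qed.
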